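(* On the standard unit sphere $S^2\subset\mathbb{R}^3$ let $V_1=\{\zeta\in L^2(S^2):\int_{S^2}\zeta\,dS=0,\ X_3\zeta=i\zeta\}$, and let $M_1:V_1\to V_1$ be $$M_1\zeta=A(x_3)\zeta+B(x_3)\Delta^{-1}\zeta,\qquad A(x_3)=x_3,\quad B(x_3)=\Omega+6x_3 .$$ If $\Omega>0$, then $M_1$ has only real spectrum on $V_1$.
   Context: $L^2(S^2)$ consists of complex-valued functions. $\Delta$ is the Laplace–Beltrami operator on $S^2$; $\Delta^{-1}$ annihilates constants and has range orthogonal to constants. $X_3$ is the vector field generating the $2\pi$-periodic rotation about the $x_3$-axis. The eigenvalues of $-\Delta$ are $\lambda_\ell=\ell(\ell+1)$, and $6=\lambda_2$. *)

(* Defs.v *)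
From HB Require Import structures.
From mathcomp Require Import all_boot all_order all_algebra.
From mathcomp Require Import complex.
From mathcomp Require Import all_classical all_reals all_analysis.
From mathcomp Require Import measurable_realfun.

Set Implicit Arguments.
Unset Strict Implicit.
Unset Printing Implicit Defensive.
Import Order.TTheory GRing.Theory Num.Theory.
Import numFieldNormedType.Exports.
Local Open Scope classical_set_scope.
Local Open Scope ring_scope.

Section complex_L2.
Context (d : measure_display) (T : measurableType d) (R : realType).
Variable mu : {measure set T -> \bar R}.
Implicit Types f g : T -> R[i].

Definition Cintegral f : R[i] :=
  Complex (\int[mu]_x complex.Re (f x)) (\int[mu]_x complex.Im (f x)).

(* Elements of the complex L^2 space are handled through representatives;
   [ae_eq2] is equality in L^2. *)
Definition L2 : set (T -> R[i]) :=
  [set f | (fun x => complex.Re (f x)) \in Lfun mu 2%:E /\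
           (fun x => complex.Im (f x)) \in Lfun mu 2%:E].

Definition ae_eq2 f g : Prop := {ae mu, forall x, f x = g x}.

Definition normL2 f : \bar R := 'N[mu]_2%:E[(EFin \o (fun x => Normc.normc (f x)))]%E.

(* [V] stands for a closed subspace of L^2 and [A] for an operator V -> V;
   [lam] is in the resolvent set iff A - lam is a bijection of V (up to
   a.e. equality) whose inverse is bounded.  The lower bound yields both
   injectivity and boundedness of the inverse. *)
Definition resolvent_set (V : set (T -> R[i]))
    (A : (T -> R[i]) -> (T -> R[i])) : set R[i] :=
  [set lam | [/\ (forall f, V f -> V (A f)),
     (forall g, V g ->
        exists f, V f /\ ae_eq2 (fun x => A f x - lam * f x) g) &
     (exists C : R, forall f, V f ->
        (normL2 f <= C%:E * normL2 (fun x => (A f x - lam * f x)%R))%E)]].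

Definition spectrum V A : set R[i] := ~` resolvent_set V A.

End complex_L2.

Section sphere.
Context (R : realType).

Notation R3 := (R * R * R)%type.
Implicit Types (p : R3) (phi : R3 -> R) (zeta eta u : R3 -> R[i]).

Definition x1 p : R := p.1.1.
Definition x2 p : R := p.1.2.
Definition x3 p : R := p.2.

(* Cylindrical (longitude, height) parametrization of the unit sphere.  Its
   area element |d_th P x d_z P| is identically 1, so the surface measure dS is
   the image of Lebesgue measure on [0, 2 pi] x [-1, 1]. *)
Definition sphere_param (q : measurableTypeR R * measurableTypeR R) : R3 :=
  (Num.sqrt (1 - q.2 ^+ 2) * cos q.1, Num.sqrt (1 - q.2 ^+ 2) * sin q.1, q.2).

Lemma measurable_sphere_param : measurable_fun setT sphere_param.
Proof.
pose Q := (measurableTypeR R * measurableTypeR R)%type.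
have m1 : measurable_fun setT (fun q : Q => Num.sqrt (1 - q.2 ^+ 2)).
  apply: (measurableT_comp (continuous_measurable_fun (@sqrt_continuous R))).
  apply: measurable_funB => //; apply: measurable_funX; exact: measurable_snd.
have m2 : measurable_fun setT (fun q : Q => cos q.1).
  apply: (measurableT_comp (continuous_measurable_fun (@continuous_cos R))).
  exact: measurable_fst.
have m3 : measurable_fun setT (fun q : Q => sin q.1).
  apply: (measurableT_comp (continuous_measurable_fun (@continuous_sin R))).
  exact: measurable_fst.
apply: measurable_fun_pair; last exact: measurable_snd.
by apply: measurable_fun_pair; apply: measurable_funM.
Qed.

HB.instance Definition _ := isMeasurableFun.Build _ _ _ _ sphere_param
  measurable_sphere_param.

Definition sphere_chart : set (measurableTypeR R * measurableTypeR R) :=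
  `[0, 2 * pi] `*` `[-1, 1].

Lemma measurable_sphere_chart : measurable sphere_chart.
Proof. by apply: measurableX; exact: measurable_itv. Qed.

(* The surface measure as a Borel measure on R^3 carried by the unit sphere:
   L^2(S^2) is L^2 of this measure. *)
Definition surface_measure : set R3 -> \bar R :=
  pushforward
    (mrestr ((@lebesgue_measure R) \x (@lebesgue_measure R))%E
       measurable_sphere_chart)
    sphere_param.

Lemma surface_measure0 : surface_measure set0 = 0%E.
Proof. exact: measure0. Qed.

Lemma surface_measure_ge0 A : (0 <= surface_measure A)%E.
Proof. exact: measure_ge0. Qed.

Lemma surface_measure_sigma_additive : semi_sigma_additive surface_measure.
Proof. exact: measure_semi_sigma_additive. Qed.

HB.instance Definition _ := isMeasure.Build _ _ _ surface_measure
  surface_measure0 surface_measure_ge0 surface_measure_sigma_additive.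

Local Notation dS := surface_measure.

Fixpoint Ck (k : nat) phi : Prop :=
  continuous phi /\
  if k is k'.+1 then
    forall v : R3, (forall p, derivable phi p v) /\ Ck k' ('D_v phi)
  else True.

(* Restrictions to the sphere of functions smooth on R^3 are exactly the smooth
   functions on the sphere; they serve as test functions. *)
Definition smooth phi : Prop := forall k, Ck k phi.

Definition rot3 (t : R) p : R3 :=
  (cos t * x1 p - sin t * x2 p, sin t * x1 p + cos t * x2 p, x3 p).

Definition X3 phi p : R := derive1 (fun t : R => phi (rot3 t p)) 0.

(* The spherical Laplacian of phi is the Euclidean Laplacian, on the sphere, of
   the extension of phi that is constant along rays. *)
Definition radial_ext phi p : R :=
  let r := Num.sqrt (x1 p ^+ 2 + x2 p ^+ 2 + x3 p ^+ 2) in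
  phi (x1 p / r, x2 p / r, x3 p / r).

Definition laplacian phi p : R :=
  'D_((1, 0, 0) : R3) ('D_((1, 0, 0) : R3) phi) p +
  'D_((0, 1, 0) : R3) ('D_((0, 1, 0) : R3) phi) p +
  'D_((0, 0, 1) : R3) ('D_((0, 0, 1) : R3) phi) p.

Definition sphere_laplacian phi p : R := laplacian (radial_ext phi) p.

(* X_3 zeta = eta and Delta u = eta for elements of L^2(S^2), in the sense of
   distributions; X_3 is divergence free, hence formally skew-adjoint. *)
Definition weak_X3 zeta eta : Prop := forall phi, smooth phi ->
  Cintegral dS (fun p => zeta p * (X3 phi p)%:C%C) =
  - Cintegral dS (fun p => eta p * (phi p)%:C%C).

Definition weak_sphere_laplacian u eta : Prop := forall phi, smooth phi ->
  Cintegral dS (fun p => u p * (sphere_laplacian phi p)%:C%C) =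
  Cintegral dS (fun p => eta p * (phi p)%:C%C).

Definition sphere_mean zeta : R[i] := Cintegral dS zeta / (4 * pi)%:C%C.

(* Delta^-1 zeta is the solution u, unique up to a.e. equality, of
   Delta u = zeta - (mean of zeta), int u dS = 0. *)
Definition inv_laplacian zeta : R3 -> R[i] :=
  xget (cst 0) [set u | [/\ L2 dS u, Cintegral dS u = 0 &
    weak_sphere_laplacian u (fun p => zeta p - sphere_mean zeta)]].

Definition V1 : set (R3 -> R[i]) :=
  [set zeta | [/\ L2 dS zeta, Cintegral dS zeta = 0 &
    weak_X3 zeta (fun p => 'i%C * zeta p)]].

Definition coefA (z : R) : R := z.
Definition coefB (Omega z : R) : R := Omega + 6 * z.

Definition M1 (Omega : R) zeta : R3 -> R[i] := fun p =>
  (coefA (x3 p))%:C%C * zeta p + (coefB Omega (x3 p))%:C%C * inv_laplacian zeta p.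

End sphere.

(* Main.v *)
Require Import Defs.
From HB Require Import structures.
From mathcomp Require Import all_boot all_order all_algebra.
From mathcomp Require Import complex.
From mathcomp Require Import all_classical all_reals all_analysis.
From mathcomp Require Import measurable_realfun ring lra zify.
Import Order.TTheory GRing.Theory Num.Theory.
Import numFieldNormedType.Exports.
Local Open Scope classical_set_scope.
Local Open Scope ring_scope.

Set Implicit Arguments.
Unset Strict Implicit.
Unset Printing Implicit Defensive.

(** Write K for the inverse Laplacian, Z for multiplication by the height x3 and
    H = 1 + 6 K, so that M1 = Z H + Omega K on the mode of order one.  An
    orthonormal basis of the mode is given by the spherical harmonics
    e_n = (x1 + i x2) p_n(x3), n >= 0, normalized, with p_n a polynomial of
    degree n; e_n has degree l = n + 1, and H multiplies it by
    1 - 6 / (l (l + 1)), that is by -2 for l = 1, by 0 for l = 2, and by a number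
    between 1/2 and 1 for l >= 3.

    Since Z and K are symmetric and K commutes with H, the operator is symmetric
    for the form <H f, g>, and the difficulty is that this form is negative on
    e_0 and degenerate on e_1.  Both defects are repaired by hand.  As p_0 = 1 and
    p_1 is the variable, Z e_0 is a multiple a e_1 of e_1, and H e_1 = 0; hence
    <M1 f, e_0> = <H f, a e_1> - Omega/2 <f, e_0> = - Omega/2 <f, e_0>: the
    coefficient along e_0 obeys a closed real equation, and adding
    3 <f, e_0> <e_0, g> to the form keeps the operator symmetric and makes the form
    nonnegative.  Adding eps <f, e_1> <e_1, g> makes it equivalent to the inner
    product, at the price of a defect of symmetry: the imaginary part of the form
    at (M1 f, f) is that of eps <H f, Z e_1> <e_1, f>, which is at most
    sqrt (8 eps) times the form at (f, f) because both H f and sqrt eps <f, e_1>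
    are controlled by the form ([energy_skew]).  For lam off the real axis, eps can
    be chosen so small that, up to a rotation by plus or minus i, M1 - lam is
    strongly monotone and Lipschitz for the form, so that it is surjective with a
    lower bound ([monotone_lipschitz_surjective], [zonal_resolvent]).

    The rest of the file supplies what this argument presupposes.  Square
    integrable functions form a complete space ([L2_complete],
    [annihilator_complete]).  On the sphere the Laplacian is the sum of the squares
    of the three rotation fields ([sphere_laplacianE], [rot_sum]), whose integrals
    vanish ([integral_rotX], [integral_rotY], [integral_rotZ]); this gives Green's
    formula ([green]), hence the orthogonality of the harmonics.  A bounded
    support makes a density determined by its moments ([moments_null]).  Evaluating
    the Laplacian, respectively the square of the rotation about the axis, on
    monomials then shows by induction on the degree that a function of mean zero
    and zero distributional Laplacian is null ([harmonic_null]) and that the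
    harmonics of order one are total in the mode ([circular_null], [V1_total]).
    Finally the inverse Laplacian is computed termwise in the orthonormal basis
    ([laplacian_solvable], [inv_laplacian_coef]). *)

(** * Semi-inner product spaces and monotone maps *)

Section semi_inner_space.
Context {R : realType} {E : lmodType R[i]}.
Implicit Types (V W : set E) (dot : E -> E -> R) (f g h : E).

(** The inner products met below are positive semidefinite only, on functions
    that are not identified almost everywhere; they are taken real valued, the
    complex structure entering as multiplication by scalars. *)
Record subspace V : Prop := Subspace {
  subspace0 : V 0;
  subspaceD : forall f g, V f -> V g -> V (f + g);
  subspaceZ : forall (a : R[i]) f, V f -> V (a *: f) }.

Lemma subspaceB V f g : subspace V -> V f -> V g -> V (f - g).
Proof.
by move=> sV Vf Vg; rewrite -scaleN1r; apply: subspaceD => //; apply: subspaceZ.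
Qed.

Record semi_inner V dot : Prop := SemiInner {
  siC : forall f g, V f -> V g -> dot f g = dot g f;
  siD : forall f g h, V f -> V g -> V h -> dot (f + g) h = dot f h + dot g h;
  siZ : forall (a : R) f g, V f -> V g -> dot (a%:C%C *: f) g = a * dot f g;
  si_ge0 : forall f, V f -> 0 <= dot f f }.

Definition cauchy_complete V dot := forall u : nat -> E, (forall n, V (u n)) ->
  (forall e : R, 0 < e -> exists N, forall m n, (N <= m)%N -> (N <= n)%N ->
     dot (u m - u n) (u m - u n) <= e) ->
  exists2 l, V l & forall e : R, 0 < e -> exists N, forall n, (N <= n)%N ->
     dot (u n - l) (u n - l) <= e.

Section form.
Variables (V : set E) (dot : E -> E -> R).
Hypotheses (sV : subspace V) (sd : semi_inner V dot).

Let VB f g : V f -> V g -> V (f - g). Proof. exact: subspaceB. Qed.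
Let VZ a f : V f -> V (a *: f). Proof. exact: subspaceZ. Qed.
Let VD f g : V f -> V g -> V (f + g). Proof. exact: subspaceD. Qed.

Lemma siN f g : V f -> V g -> dot (- f) g = - dot f g.
Proof.
move=> Vf Vg; have -> : - f = (-1)%:C%C *: f by rewrite rmorphN rmorph1 scaleN1r.
by rewrite (siZ sd) // mulN1r.
Qed.

Lemma siB f g h : V f -> V g -> V h -> dot (f - g) h = dot f h - dot g h.
Proof.
by move=> Vf Vg Vh; rewrite (siD sd) ?siN// -scaleN1r; exact: VZ.
Qed.

Lemma siDr f g h : V f -> V g -> V h -> dot h (f + g) = dot h f + dot h g.
Proof.
by move=> Vf Vg Vh; rewrite (siC sd) ?(siD sd)// ?(siC sd _ Vh)//; exact: VD.
Qed.

Lemma siBr f g h : V f -> V g -> V h -> dot h (f - g) = dot h f - dot h g.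
Proof.
by move=> Vf Vg Vh; rewrite (siC sd) ?siB// ?(siC sd _ Vh)//; exact: VB.
Qed.

Lemma siZr (a : R) f g : V f -> V g -> dot g (a%:C%C *: f) = a * dot g f.
Proof.
by move=> Vf Vg; rewrite (siC sd) ?(siZ sd)// ?(siC sd Vf)//; exact: VZ.
Qed.

Lemma si_sqrB f g : V f -> V g ->
  dot (f - g) (f - g) = dot f f - 2 * dot f g + dot g g.
Proof.
move=> Vf Vg; rewrite siB ?siBr//; last exact: VB.
by rewrite (siC sd Vg Vf); ring.
Qed.

Lemma si_sqrD f g : V f -> V g ->
  dot (f + g) (f + g) = dot f f + 2 * dot f g + dot g g.
Proof.
move=> Vf Vg; rewrite (siD sd) ?siDr//; last exact: VD.
by rewrite (siC sd Vg Vf); ring.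
Qed.

Lemma si_sqrZ (a : R) f : V f -> dot (a%:C%C *: f) (a%:C%C *: f) = a ^+ 2 * dot f f.
Proof. by move=> Vf; rewrite (siZ sd) ?siZr// ?mulrA//; exact: VZ. Qed.

Lemma si_dist f g : V f -> V g -> dot (f - g) (f - g) = dot (g - f) (g - f).
Proof. by move=> Vf Vg; rewrite !si_sqrB// (siC sd Vf Vg); ring. Qed.

Lemma cauchy_schwarz f g : V f -> V g -> dot f g ^+ 2 <= dot f f * dot g g.
Proof.
move=> Vf Vg.
have H (t : R) : 0 <= dot f f - 2 * t * dot f g + t ^+ 2 * dot g g.
  have := si_ge0 sd (VB Vf (VZ t%:C%C Vg)).
  by rewrite si_sqrB// ?si_sqrZ// ?siZr//; [rewrite mulrA | exact: VZ].
have gg := si_ge0 sd Vg; have ff := si_ge0 sd Vf.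
have [g0|gn0] := eqVneq (dot g g) 0.
  rewrite g0 mulr0; have [->|p0] := eqVneq (dot f g) 0; first by rewrite expr0n.
  have := H ((dot f f + 1) / (2 * dot f g)); rewrite g0 mulr0 addr0.
  rewrite (_ : _ - _ = -1); last by field.
  by rewrite ler0N1.
have gp : 0 < dot g g by rewrite lt_def gn0.
have := H (dot f g / dot g g).
rewrite (_ : _ + _ = (dot f f * dot g g - dot f g ^+ 2) / dot g g); last by field.
by rewrite pmulr_lge0 ?invr_gt0// subr_ge0.
Qed.

Lemma si_null_l f g : V f -> V g -> dot f f = 0 -> dot f g = 0.
Proof.
move=> Vf Vg f0; have := cauchy_schwarz Vf Vg; rewrite f0 mul0r => h.
by apply/eqP; rewrite -sqrf_eq0 eq_le h sqr_ge0.
Qed.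

Lemma si_null_eql f f' g : V f -> V f' -> V g -> dot (f - f') (f - f') = 0 ->
  dot f g = dot f' g.
Proof.
move=> Vf Vf' Vg f0; apply/eqP; rewrite -subr_eq0 -siB//; apply/eqP.
by apply: si_null_l => //; exact: VB.
Qed.

Lemma si_sqrD_le f g : V f -> V g ->
  dot (f + g) (f + g) <= 2 * (dot f f + dot g g).
Proof.
move=> Vf Vg; rewrite -subr_ge0 si_sqrD//.
by rewrite (_ : _ - _ = dot (f - g) (f - g)) ?(si_ge0 sd (VB Vf Vg))// si_sqrB//; ring.
Qed.

Lemma si_sqrB_le f g : V f -> V g ->
  dot (f - g) (f - g) <= 2 * (dot f f + dot g g).
Proof.
move=> Vf Vg; rewrite -subr_ge0 si_sqrB//.
by rewrite (_ : _ - _ = dot (f + g) (f + g)) ?(si_ge0 sd (VD Vf Vg))// si_sqrD//; ring.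
Qed.

Lemma geometric_small (k c e : R) : 0 <= k < 1 -> 0 < e ->
  exists N, forall n, (N <= n)%N -> c * k ^+ n <= e.
Proof.
move=> /andP[k0 k1] e0.
have /cvgrPdist_le : (fun n => c * k ^+ n) @ \oo --> (c * 0 : R).
  by apply: cvgMr; apply: cvg_expr; rewrite ger0_norm.
move=> /(_ e e0)[N _ h]; exists N => n Nn; have := h n Nn.
by rewrite mulr0 sub0r normrN; apply: le_trans; exact: ler_norm.
Qed.

(** Zarantonello's theorem.  For the step t = kap / L' the map
    f -> f - t (N f - g) multiplies the squared residual of N f = g by at most
    k = 1 - kap^2 / L' < 1, and strong monotonicity bounds distances by residuals,
    so the iterates converge.  The map N may be nonlinear; this allows for
    operators whose values are only determined up to null vectors. *)
Lemma monotone_lipschitz_surjective (N : E -> E) (kap L : R) g :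
  cauchy_complete V dot -> (forall f, V f -> V (N f)) -> 0 < kap ->
  (forall f h, V f -> V h ->
     kap * dot (f - h) (f - h) <= dot (N f - N h) (f - h)) ->
  (forall f h, V f -> V h ->
     dot (N f - N h) (N f - N h) <= L * dot (f - h) (f - h)) ->
  V g -> exists2 f, V f & dot (N f - g) (N f - g) = 0.
Proof.
move=> cV VN k0 Nmon Nlip Vg.
pose L' := Num.max L (kap ^+ 2).
have L'0 : 0 < L' by rewrite lt_max exprn_gt0 ?orbT.
have Nlip' f h : V f -> V h ->
    dot (N f - N h) (N f - N h) <= L' * dot (f - h) (f - h).
  move=> Vf Vh; apply: le_trans (Nlip f h Vf Vh) _.
  by rewrite ler_wpM2r ?(si_ge0 sd)//; [exact: VB | rewrite le_max lexx].
pose t := kap / L'.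
have t0 : 0 < t by rewrite divr_gt0.
pose k := 1 - kap ^+ 2 / L'.
have k01 : 0 <= k < 1.
  rewrite /k subr_ge0 ler_pdivrMr// mul1r le_max lexx orbT /=.
  by rewrite ltrBlDr ltrDl divr_gt0// exprn_gt0.
pose Phi f := f - t%:C%C *: (N f - g).
pose u n := iter n Phi 0.
have Vu n : V (u n).
  elim: n => [|n ih]; first exact: subspace0.
  by apply: VB => //; apply: VZ; apply: VB => //; exact: VN.
have VNg f : V f -> V (N f - g) by move=> Vf; apply: VB => //; exact: VN.
have Vr n := VNg _ (Vu n).
pose r n := dot (N (u n) - g) (N (u n) - g).
have dE n : u n - u n.+1 = t%:C%C *: (N (u n) - g).
  by rewrite /= /Phi opprB addrCA subrr addr0.
have rk n : r n.+1 <= k * r n.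
  have e1 : N (u n.+1) - g = (N (u n) - g) - (N (u n) - N (u n.+1)).
    by rewrite opprB [RHS]addrC addrA subrK.
  have VNN : V (N (u n) - N (u n.+1)) by apply: VB; exact: VN.
  have mon := Nmon _ _ (Vu n) (Vu n.+1); have lip := Nlip' _ _ (Vu n) (Vu n.+1).
  move: mon lip; rewrite dE si_sqrZ// siZr// => mon lip.
  rewrite /r e1 si_sqrB// -!/(r n) -/(r n) (siC sd (Vr n) VNN).
  set D := dot (N _ - N _) (N _ - _) in mon *.
  set DD := dot (N _ - N _) (N _ - N _) in lip *.
  have mon' : kap * t * r n <= D.
    rewrite -(ler_pM2l t0); apply: le_trans mon; rewrite -/(r n).
    by rewrite le_eqVlt; apply/orP; left; apply/eqP; ring.
  have -> : k * r n = r n - 2 * (kap * t * r n) + L' * (t ^+ 2 * r n).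
    by rewrite /k /t; field; rewrite gt_eqF.
  by move: mon' lip; rewrite -/(r n); lra.
have r0 n : 0 <= r n by exact: (si_ge0 sd).
have rgeo n : r n <= r 0 * k ^+ n.
  elim: n => [|n ih]; first by rewrite expr0 mulr1.
  apply: le_trans (rk n) _; rewrite exprS mulrCA.
  by apply: ler_wpM2l => //; case/andP: k01.
have dist f h : V f -> V h -> kap ^+ 2 * dot (f - h) (f - h) <=
    2 * (dot (N f - g) (N f - g) + dot (N h - g) (N h - g)).
  move=> Vf Vh.
  have Vd := VB Vf Vh; have VD' : V (N f - N h) by apply: VB; exact: VN.
  apply: (@le_trans _ _ (dot (N f - N h) (N f - N h))).
    have [d0|dn0] := eqVneq (dot (f - h) (f - h)) 0.
      by rewrite d0 mulr0 (si_ge0 sd).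
    have dp : 0 < dot (f - h) (f - h) by rewrite lt_def dn0 (si_ge0 sd).
    rewrite -(ler_pM2r dp); apply: le_trans (cauchy_schwarz VD' Vd).
    have := Nmon _ _ Vf Vh.
    rewrite -ler_sqr ?nnegrE ?mulr_ge0 ?(ltW k0) ?(ltW dp)//.
      by move=> h1; apply: le_trans h1; rewrite exprMn -mulrA -expr2.
    by apply: le_trans (Nmon _ _ Vf Vh); rewrite mulr_ge0 ?(ltW k0) ?(ltW dp).
  have -> : N f - N h = (N f - g) - (N h - g) by rewrite opprB addrA subrK.
  by apply: si_sqrB_le; exact: VNg.
have [|l Vl ul] := cV u Vu.
  move=> e e0.
  have [|N0 hN] := @geometric_small k (r 0) (kap ^+ 2 * e / 4) k01.
    by rewrite divr_gt0// mulr_gt0// exprn_gt0.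
  exists N0 => m n Nm Nn; rewrite -(ler_pM2l (exprn_gt0 2 k0)).
  apply: le_trans (dist _ _ (Vu m) (Vu n)) _; rewrite -/(r m) -/(r n).
  have := le_trans (rgeo m) (hN m Nm); have := le_trans (rgeo n) (hN n Nn).
  lra.
exists l => //; apply/eqP; rewrite eq_le (si_ge0 sd (VNg _ Vl)) andbT.
apply/ler_addgt0Pl => e e0; rewrite addr0.
have [N1 h1] := ul (e / (4 * L')) (divr_gt0 e0 (mulr_gt0 (ltr0n _ 4) L'0)).
have [|N2 h2] := @geometric_small k (r 0) (e / 4) k01; first by rewrite divr_gt0.
pose n := maxn N1 N2.
have u1 := h1 n (leq_maxl _ _).
have u2 := le_trans (rgeo n) (h2 n (leq_maxr _ _)).
have -> : N l - g = (N (u n) - g) - (N (u n) - N l) by rewrite opprB [RHS]addrC addrA subrK.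
have VNN : V (N (u n) - N l) by apply: VB; exact: VN.
apply: le_trans (si_sqrB_le (Vr n) VNN) _.
have : dot (N (u n) - N l) (N (u n) - N l) <= e / 4.
  apply: le_trans (Nlip' _ _ (Vu n) Vl) _.
  have -> : e / 4 = L' * (e / (4 * L')) by field; rewrite gt_eqF.
  by rewrite ler_pM2l.
rewrite -/(r n); lra.
Qed.

End form.
End semi_inner_space.

(** * Orthonormal families *)

Section orthonormal_family.
Context {R : realType} {E : lmodType R[i]}.
Variables (W V : set E) (dot : E -> E -> R) (b : nat -> E).
Hypotheses (sW : subspace W) (sd : semi_inner W dot).
Hypotheses (sV : subspace V) (VW : V `<=` W) (cV : cauchy_complete V dot).
Hypotheses (Vb : forall j, V (b j)).
Hypothesis ortho : forall i j, dot (b i) (b j) = (i == j)%:R.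
Hypothesis total : forall f, V f -> (forall j, dot f (b j) = 0) -> dot f f = 0.

Let Wb j : W (b j). Proof. exact: VW. Qed.

Definition lincomb (c : nat -> R) (n : nat) : E :=
  \sum_(j < n) (c j)%:C%C *: b j.

Lemma lincombS c n : lincomb c n.+1 = lincomb c n + (c n)%:C%C *: b n.
Proof. by rewrite /lincomb big_ord_recr. Qed.

Lemma lincomb_mem c n : V (lincomb c n).
Proof.
elim: n => [|n ih]; first by rewrite /lincomb big_ord0; exact: subspace0.
by rewrite lincombS; apply: subspaceD => //; exact: subspaceZ.
Qed.

Let Wl c n : W (lincomb c n). Proof. exact/VW/lincomb_mem. Qed.

Lemma dot_lincomb c n t : W t ->
  dot (lincomb c n) t = \sum_(j < n) c j * dot (b j) t.
Proof.
move=> Wt; elim: n => [|n ih].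
  rewrite big_ord0 /lincomb big_ord0.
  have -> : (0 : E) = 0%:C%C *: 0 by rewrite scaler0.
  by rewrite (siZ sd) ?mul0r//; exact: subspace0.
rewrite lincombS (siD sd) ?(siZ sd)// ?ih ?big_ord_recr//.
by apply: subspaceZ.
Qed.

Lemma dot_lincomb_basis c n k :
  dot (lincomb c n) (b k) = if (k < n)%N then c k else 0.
Proof.
rewrite dot_lincomb//; case: ltnP => [kn|nk].
  rewrite (bigD1 (Ordinal kn))//= ortho eqxx mulr1 big1 ?addr0// => i.
  by rewrite -val_eqE /= => ik; rewrite ortho (negbTE ik) mulr0.
rewrite big1// => i _; rewrite ortho.
by rewrite ltn_eqF ?mulr0// (leq_trans (ltn_ord i)).
Qed.

Lemma dot_lincombB c m n : (m <= n)%N ->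
  dot (lincomb c n - lincomb c m) (lincomb c n - lincomb c m) =
  \sum_(m <= j < n) c j ^+ 2.
Proof.
move=> mn; rewrite (siB sW sd)//; last exact: subspaceB.
rewrite !dot_lincomb//; [|exact: subspaceB..].
rewrite -(big_mkord xpredT (fun j => c j * dot (b j) (lincomb c n - lincomb c m))).
rewrite -(big_mkord xpredT (fun j => c j * dot (b j) (lincomb c n - lincomb c m))).
rewrite (big_cat_nat (leq0n m) mn) /= addrAC subrr add0r.
rewrite !big_nat; apply: eq_bigr => j /andP[mj jn].
rewrite (siBr sW sd)// (siC sd (Wb j) (Wl c n)) (siC sd (Wb j) (Wl c m)).
by rewrite !dot_lincomb_basis jn ltnNge mj /= subr0 expr2.
Qed.

Lemma dot_lincomb_sqr c n : dot (lincomb c n) (lincomb c n) = \sum_(j < n) c j ^+ 2.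
Proof.
have := dot_lincombB c (leq0n n); rewrite big_mkord => <-.
have -> : lincomb c 0 = 0 by rewrite /lincomb big_ord0.
by rewrite subr0.
Qed.

Lemma bessel f n : W f -> \sum_(j < n) dot f (b j) ^+ 2 <= dot f f.
Proof.
move=> Wf; set S := \sum_(j < n) _.
have Wfl := subspaceB sW Wf (Wl (fun j => dot f (b j)) n).
have := si_ge0 sd Wfl.
rewrite (si_sqrB sW sd)// (siC sd Wf (Wl _ n)) dot_lincomb// dot_lincomb_sqr.
rewrite (eq_bigr (fun j : 'I_n => dot f (b j) ^+ 2)); last first.
  by move=> j _; rewrite (siC sd (Wb j) Wf) expr2.
by rewrite -/S; lra.
Qed.

(** The squared distances of partial sums are tails of a convergent series.  The
    limit is described weakly, by its products with all of the ambient space W,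
    since test functions need not belong to V. *)
Lemma riesz_fischer (c : nat -> R) (B : R) :
  (forall n, \sum_(j < n) c j ^+ 2 <= B) ->
  exists2 f, V f & forall t, W t ->
    (fun n => \sum_(j < n) c j * dot (b j) t) @ \oo --> dot f t.
Proof.
move=> cB; pose S n := \sum_(0 <= j < n) c j ^+ 2.
have Scvg : cvgn S.
  apply: nondecreasing_is_cvgn.
    apply/nondecreasing_seqP => n; rewrite /S big_nat_recr//= lerDl.
    exact: sqr_ge0.
  by exists B => _ [n _ <-]; rewrite /S big_mkord.
have [|l Vl ul] := cV (lincomb_mem c).
  move=> e e0; move/cauchy_cvgP : Scvg => /cauchy_seriesP /(_ _ e0).
  case=> -[A A'] /= [[N1 _ hA] [N2 _ hA']] h.
  exists (maxn N1 N2) => m n.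
  rewrite !geq_max => /andP[m1 m2] /andP[n1 n2].
  wlog mn : m n m1 m2 n1 n2 / (m <= n)%N => [wlg|].
    case: (leqP m n) => [mn|/ltnW nm]; first exact: wlg.
    by rewrite (si_dist sW sd)//; exact: wlg.
  rewrite (si_dist sW sd)// dot_lincombB//.
  apply: le_trans (ler_norm _) (ltW _).
  apply: (h (m, n)); split; [exact: hA | exact: hA'].
exists l => // t Wt; apply/cvgrPdist_le => e e0.
have [|N hN] := ul (e ^+ 2 / (dot t t + 1)).
  by rewrite divr_gt0 ?exprn_gt0// ltr_wpDl// (si_ge0 sd).
exists N => // n Nn /=; rewrite -dot_lincomb// distrC -(siB sW sd)//; last exact: VW.
have Wd : W (lincomb c n - l) by apply: subspaceB => //; exact: VW.
rewrite -ler_sqr ?nnegrE//; last exact: ltW.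
rewrite real_normK ?num_real//; apply: le_trans (cauchy_schwarz sW sd Wd Wt) _.
have t1 : 0 < dot t t + 1 by rewrite ltr_wpDl// (si_ge0 sd).
apply: (@le_trans _ _ (e ^+ 2 / (dot t t + 1) * dot t t)).
  by apply: ler_wpM2r; [exact: (si_ge0 sd) | exact: hN].
rewrite mulrAC ler_pdivrMr// ler_wpM2l ?exprn_ge0 ?(ltW e0)//.
by rewrite lerDl.
Qed.

Lemma cst_cvg_coef (c : nat -> R) f k : (forall t, W t ->
    (fun n => \sum_(j < n) c j * dot (b j) t) @ \oo --> dot f t) ->
  dot f (b k) = c k.
Proof.
move=> /(_ _ (Wb k)) h; apply: cvg_unique h _ => //.
apply/cvgrPdist_le => e e0; exists k.+1 => // n /= kn.
by rewrite -dot_lincomb// dot_lincomb_basis kn subrr normr0 ltW.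
Qed.

Lemma parseval f t : V f -> W t ->
  (fun n => \sum_(j < n) dot f (b j) * dot (b j) t) @ \oo --> dot f t.
Proof.
move=> Vf Wt.
have [g Vg hg] := @riesz_fischer (fun j => dot f (b j)) _ (fun n => bessel n (VW Vf)).
have fg : dot (f - g) (f - g) = 0.
  apply: total; first exact: subspaceB.
  move=> j; rewrite (siB sW sd)//; [|exact: VW..].
  have hj : dot g (b j) = dot f (b j) by exact: (@cst_cvg_coef (fun j => dot f (b j)) g j hg).
  by rewrite hj subrr.
by rewrite (si_null_eql sW sd (VW Vf) (VW Vg) Wt fg); exact: hg.
Qed.

End orthonormal_family.

(** * The operator Z (1 + 6 K) + Omega K *)

(** A named constant, so that simplification keeps the scalar folded. *)
Definition imu {R : realType} : R[i] := 'i%C.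

Section sum_limits.
Context {R : realType}.

Lemma sum_cvg_le (x y : nat -> R) (X Y : R) :
  (fun n => \sum_(0 <= j < n) x j) @ \oo --> X ->
  (fun n => \sum_(0 <= j < n) y j) @ \oo --> Y ->
  (forall j, x j <= y j) -> X <= Y.
Proof.
move=> hX hY xy; apply: (ler_cvg_to hX hY); apply: nearW => n.
by apply: ler_sum => j _.
Qed.

Lemma sum_cvg_unique (x : nat -> R) (X Y : R) :
  (fun n => \sum_(0 <= j < n) x j) @ \oo --> X ->
  (fun n => \sum_(0 <= j < n) x j) @ \oo --> Y -> X = Y.
Proof. by move=> hX hY; apply: cvg_unique hX hY. Qed.

Lemma sum_cvgD (x y : nat -> R) (X Y : R) :
  (fun n => \sum_(0 <= j < n) x j) @ \oo --> X ->
  (fun n => \sum_(0 <= j < n) y j) @ \oo --> Y ->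
  (fun n => \sum_(0 <= j < n) (x j + y j)) @ \oo --> X + Y.
Proof.
move=> hX hY; under eq_fun do rewrite big_split /=; exact: cvgD.
Qed.

Lemma sum_cvgZ (a : R) (x : nat -> R) (X : R) :
  (fun n => \sum_(0 <= j < n) x j) @ \oo --> X ->
  (fun n => \sum_(0 <= j < n) (a * x j)) @ \oo --> a * X.
Proof.
by move=> hX; under eq_fun do rewrite -mulr_sumr; exact: cvgMr.
Qed.

Lemma sum_cvg_fin (m : nat) (x : nat -> R) : (forall j, (m <= j)%N -> x j = 0) ->
  (fun n => \sum_(0 <= j < n) x j) @ \oo --> \sum_(0 <= j < m) x j.
Proof.
move=> x0; apply/cvgrPdist_le => e e0; exists m => // n /= mn.
rewrite (big_cat_nat (leq0n m) mn) /= [X in _ - (_ + X)]big_nat.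
rewrite [X in _ - (_ + X)]big1; first by rewrite addr0 subrr normr0 ltW.
by move=> j /andP[mj _]; exact: x0.
Qed.

Lemma sum_cvg_ext (x y : nat -> R) (X : R) : x =1 y ->
  (fun n => \sum_(0 <= j < n) x j) @ \oo --> X -> (fun n => \sum_(0 <= j < n) y j) @ \oo --> X.
Proof. by move=> xy; under eq_fun do (under eq_bigr do rewrite xy). Qed.

End sum_limits.
Arguments sum_cvgZ {R} a {x X}.

(** The vectors b (2 n) and b (2 n + 1) are e_n and i e_n; - kap are the
    eigenvalues of the inverse Laplacian K, and Z is multiplication by the
    height. *)
Section zonal_operator.
Context {R : realType} {E : lmodType R[i]}.
Variables (W V : set E) (dot : E -> E -> R) (b : nat -> E).
Hypotheses (sW : subspace W) (sd : semi_inner W dot).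
Hypotheses (sV : subspace V) (VW : V `<=` W) (cV : cauchy_complete V dot).
Hypotheses (Vb : forall j, V (b j)).
Hypothesis ortho : forall i j, dot (b i) (b j) = (i == j)%:R.
Hypothesis total : forall f, V f -> (forall j, dot f (b j) = 0) -> dot f f = 0.
Hypothesis dotJ : forall f g, W f -> W g -> dot (imu *: f) g = - dot f (imu *: g).
Hypothesis bJ : forall n, b n.*2.+1 = imu *: b n.*2.

Variables (kap : nat -> R) (K Z : E -> E).
Hypothesis kapJ : forall n, kap n.*2.+1 = kap n.*2.
Hypothesis kap0 : kap 0 = 2^-1.
Hypothesis kap2 : kap 2 = 6^-1.
Hypothesis kap4 : forall j, (4 <= j)%N -> 0 <= kap j <= 12^-1.
Hypothesis VK : forall f, V f -> V (K f).
Hypothesis KE : forall f j, V f -> dot (K f) (b j) = - (kap j * dot f (b j)).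
Hypothesis VZ : forall f, V f -> V (Z f).
Hypothesis ZD : forall f g, Z (f + g) = Z f + Z g.
Hypothesis ZS : forall a f, Z (a *: f) = a *: Z f.
Hypothesis Zsym : forall f g, V f -> V g -> dot (Z f) g = dot f (Z g).
Hypothesis Zle : forall f, V f -> dot (Z f) (Z f) <= dot f f.
Variable a : R.
Hypothesis Zb0 : Z (b 0) = a%:C%C *: b 2.

Let sVd : semi_inner V dot.
Proof.
split; first by move=> *; apply: (siC sd); exact: VW.
- by move=> *; apply: (siD sd); exact: VW.
- by move=> *; apply: (siZ sd); exact: VW.
- by move=> *; apply: (si_ge0 sd); exact: VW.
Qed.

Let VD f g : V f -> V g -> V (f + g). Proof. exact: subspaceD. Qed.
Let VB f g : V f -> V g -> V (f - g). Proof. exact: subspaceB. Qed.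
Let VS c f : V f -> V (c *: f). Proof. exact: subspaceZ. Qed.
Let VN f : V f -> V (- f). Proof. by rewrite -scaleN1r; exact: VS. Qed.
Local Ltac mem := solve [repeat match goal with
  | |- V (_ - _) => apply: VB
  | |- V (_ + _) => apply: VD
  | |- V (_ *: _) => apply: VS
  | |- V (- _) => apply: VN
  | |- V (Z _) => apply: VZ
  | |- V (K _) => apply: VK
  | |- V (b _) => exact: Vb
  | |- V _ => assumption
  end].

Let dC f g : V f -> V g -> dot f g = dot g f. Proof. exact: (siC sVd). Qed.
Let dD := siD sVd.
Let dDr := siDr sV sVd.
Let dS := siZ sVd.
Let dSr := siZr sV sVd.
Let dJ f g : V f -> V g -> dot (imu *: f) g = - dot f (imu *: g).
Proof. by move=> Vf Vg; apply: dotJ; exact: VW. Qed.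

Let iiN f : imu *: (imu *: f) = - f :> E.
Proof. by rewrite scalerA /imu -expr2 sqr_i scaleN1r. Qed.

Let dJJ f g : V f -> V g -> dot (imu *: f) (imu *: g) = dot f g.
Proof.
move=> Vf Vg; rewrite dJ; try mem; rewrite iiN dC; try mem.
by rewrite (siN sVd)// opprK dC.
Qed.

Let dJ0 f : V f -> dot f (imu *: f) = 0.
Proof.
move=> Vf; have := dJ Vf Vf; rewrite (dC (VS _ Vf) Vf); lra.
Qed.

Let pars f g : V f -> V g ->
  (fun n => \sum_(0 <= j < n) dot f (b j) * dot g (b j)) @ \oo --> dot f g.
Proof.
move=> Vf Vg.
have := parseval sW sd sV VW cV Vb ortho total Vf (VW Vg).
under eq_fun => n do rewrite -(big_mkord xpredT (fun j => dot f (b j) * dot (b j) g)).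
by apply: sum_cvg_ext => j; rewrite (dC (Vb j) Vg).
Qed.

Let cJ0 f n : V f -> dot (imu *: f) (b n.*2) = - dot f (b n.*2.+1).
Proof. by move=> Vf; rewrite dJ// bJ. Qed.

Let cJ1 f n : V f -> dot (imu *: f) (b n.*2.+1) = dot f (b n.*2).
Proof. by move=> Vf; rewrite bJ dJJ. Qed.

Let c0J f : V f -> dot (imu *: f) (b 0) = - dot f (b 1). Proof. exact: (cJ0 0). Qed.
Let c1J f : V f -> dot (imu *: f) (b 1) = dot f (b 0). Proof. exact: (cJ1 0). Qed.
Let c2J f : V f -> dot (imu *: f) (b 2) = - dot f (b 3). Proof. exact: (cJ0 1). Qed.
Let c3J f : V f -> dot (imu *: f) (b 3) = dot f (b 2). Proof. exact: (cJ1 1). Qed.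

(* k is a value of K at d, up to a null vector: K itself need not be additive. *)
Let isK d k := forall j, dot k (b j) = - (kap j * dot d (b j)).

Let isK_K f : V f -> isK f (K f). Proof. by move=> Vf j; rewrite KE. Qed.

Let isK_uniq d k k' g : V d -> V k -> V k' -> V g -> isK d k -> isK d k' ->
  dot k g = dot k' g.
Proof.
move=> Vd Vk Vk' Vg hk hk'; apply: (si_null_eql sV sVd) => //; apply: total; try mem.
by move=> j; rewrite (siB sV sVd)// hk hk' subrr.
Qed.

Let isK_sym d k d' k' : V d -> V k -> V d' -> V k' -> isK d k -> isK d' k' ->
  dot k d' = dot d k'.
Proof.
move=> Vd Vk Vd' Vk' hk hk'; apply: (sum_cvg_unique (pars Vk Vd')).
by apply: (sum_cvg_ext _ (pars Vd Vk')) => j; rewrite hk hk'; ring.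
Qed.

Let isK_J d k : V d -> V k -> isK d k -> isK (imu *: d) (imu *: k).
Proof.
move=> Vd Vk hk j; rewrite -(odd_double_half j); case: (odd j) => /=.
  by rewrite add1n !cJ1// hk kapJ.
by rewrite add0n !cJ0// hk kapJ; ring.
Qed.

Let isK_B d k d' k' : V d -> V k -> V d' -> V k' -> isK d k -> isK d' k' ->
  isK (d - d') (k - k').
Proof. by move=> Vd Vk Vd' Vk' hk hk' j; rewrite !(siB sV sVd)// hk hk'; ring. Qed.

(* K is symmetric and commutes with i, so that <K d, d> is real. *)
Let dotK_J d k : V d -> V k -> isK d k -> dot k (imu *: d) = 0.
Proof.
move=> Vd Vk hk; have h := isK_sym Vd Vk (VS imu Vd) (VS imu Vk) hk (isK_J Vd Vk hk).
have := dJ Vd Vk; rewrite (dC (VS _ Vd) Vk) h; lra.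
Qed.

Section form.
Variable eps : R.
Hypothesis eps0 : 0 < eps <= 2^-1.

(* the eigenvalues of the modified form: 1 on e_0, eps on e_1, and between 1/2
   and 1 on the others *)
Let s j : R := 1 - 6 * kap j + (if (j < 2)%N then 3 else if (j < 4)%N then eps else 0).

Let kap1 : kap 1 = 2^-1. Proof. by rewrite (kapJ 0) kap0. Qed.
Let kap3 : kap 3 = 6^-1. Proof. by rewrite (kapJ 1) kap2. Qed.

Let s_bound j : eps <= s j <= 4.
Proof.
have /andP[e0 e1] := eps0.
rewrite /s; case: j => [|[|[|[|j]]]] /=; rewrite ?kap0 ?kap1 ?kap2 ?kap3; try lra.
by have /andP[h1 h2] := @kap4 j.+4 isT; lra.
Qed.

Let s_h j : (1 - 6 * kap j) ^+ 2 <= 4 * s j.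
Proof.
have /andP[e0 e1] := eps0.
rewrite /s; case: j => [|[|[|[|j]]]] /=; rewrite ?kap0 ?kap1 ?kap2 ?kap3; try lra.
by have /andP[h1 h2] := @kap4 j.+4 isT; nra.
Qed.

(** The form <H f, g>, with H = 1 + 6 K, is negative on e_0 and degenerate on e_1;
    the two corrections make it equivalent to the inner product. *)
Definition energy f g : R := dot f g + 6 * dot (K f) g
  + 3 * (dot f (b 0) * dot g (b 0) + dot f (b 1) * dot g (b 1))
  + eps * (dot f (b 2) * dot g (b 2) + dot f (b 3) * dot g (b 3)).
Local Notation Q := energy.

Let Q_sum f g : V f -> V g ->
  (fun n => \sum_(0 <= j < n) s j * (dot f (b j) * dot g (b j))) @ \oo --> Q f g.
Proof.
move=> Vf Vg.
pose w j : R := if (j < 2)%N then 3 else if (j < 4)%N then eps else 0.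
have w0 j : (4 <= j)%N -> w j * (dot f (b j) * dot g (b j)) = 0.
  by case: j => [|[|[|[|j]]]]//= _; rewrite /w /= mul0r.
have hQ := sum_cvgD (sum_cvgD (pars Vf Vg) (sum_cvgZ 6 (pars (VK Vf) Vg)))
  (sum_cvg_fin w0).
have <- : dot f g + 6 * dot (K f) g + \sum_(0 <= j < 4) w j * (dot f (b j) * dot g (b j))
    = Q f g.
  by rewrite !big_nat_recr//= big_geq//= /w /= /Q; ring.
by apply: (sum_cvg_ext _ hQ) => j; rewrite KE// /s /w; ring.
Qed.

Let QC f g : V f -> V g -> Q f g = Q g f.
Proof.
move=> Vf Vg; apply: (sum_cvg_unique (Q_sum Vf Vg)).
by apply: (sum_cvg_ext _ (Q_sum Vg Vf)) => j; ring.
Qed.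

Let Q_ge f : V f -> eps * dot f f <= Q f f.
Proof.
move=> Vf; apply: sum_cvg_le (sum_cvgZ eps (pars Vf Vf)) (Q_sum Vf Vf) _ => j.
by rewrite ler_wpM2r// -?expr2 ?sqr_ge0//; have /andP[] := s_bound j.
Qed.

Let Q_le f : V f -> Q f f <= 4 * dot f f.
Proof.
move=> Vf; apply: sum_cvg_le (Q_sum Vf Vf) (sum_cvgZ 4 (pars Vf Vf)) _ => j.
by rewrite ler_wpM2r// -?expr2 ?sqr_ge0//; have /andP[] := s_bound j.
Qed.

Let eps_gt0 : 0 < eps. Proof. by case/andP: eps0. Qed.

Let Q_si : semi_inner V Q.
Proof.
split; first exact: QC.
- move=> f g h Vf Vg Vh; apply: (sum_cvg_unique (Q_sum (VD Vf Vg) Vh)).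
  apply: (sum_cvg_ext _ (sum_cvgD (Q_sum Vf Vh) (Q_sum Vg Vh))) => j.
  by rewrite dD//; ring.
- move=> c f g Vf Vg; apply: (sum_cvg_unique (Q_sum (VS c%:C%C Vf) Vg)).
  apply: (sum_cvg_ext _ (sum_cvgZ c (Q_sum Vf Vg))) => j.
  by rewrite dS//; ring.
- move=> f Vf; apply: le_trans (Q_ge Vf).
  by rewrite mulr_ge0 ?(ltW eps_gt0)// (si_ge0 sVd).
Qed.

Let Q_complete : cauchy_complete V Q.
Proof.
move=> u Vu cu; have [|l Vl ul] := cV Vu.
  move=> e e0; have [N hN] := cu (eps * e) (mulr_gt0 eps_gt0 e0).
  exists N => m n Nm Nn; rewrite -(ler_pM2l eps_gt0).
  by apply: le_trans (Q_ge _) (hN m n Nm Nn); exact: VB.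
exists l => // e e0; have [N hN] := ul (e / 4) (divr_gt0 e0 (ltr0n _ 4)).
exists N => n Nn; apply: le_trans (Q_le _) _; first exact: VB.
by have := hN n Nn; lra.
Qed.

Let Q_JJ f : V f -> Q (imu *: f) (imu *: f) = Q f f.
Proof.
move=> Vf; rewrite /Q !c0J// !c1J// !c2J// !c3J// dJJ//.
rewrite (isK_uniq (VS imu Vf) (VK (VS imu Vf)) (VS imu (VK Vf)) (VS imu Vf)
  (isK_K (VS imu Vf)) (isK_J Vf (VK Vf) (isK_K Vf))) dJJ; try mem.
by ring.
Qed.

Let Q_J f g : V f -> V g -> Q (imu *: f) g = - Q f (imu *: g).
Proof.
move=> Vf Vg; rewrite /Q !c0J// !c1J// !c2J// !c3J// dJ//.
rewrite (isK_uniq (VS imu Vf) (VK (VS imu Vf)) (VS imu (VK Vf)) Vg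
  (isK_K (VS imu Vf)) (isK_J Vf (VK Vf) (isK_K Vf))) dJ; try mem.
by ring.
Qed.

Let Q_J0 f : V f -> Q f (imu *: f) = 0.
Proof.
move=> Vf; have := Q_J Vf Vf; rewrite (QC (VS _ Vf) Vf); lra.
Qed.

Variable Om : R.

(* d and k stand for a difference of vectors and the difference of their images
   under K *)
Let opD d k : E := Z d + Om%:C%C *: k + 6%:C%C *: Z k.

Let opD_H d k : opD d k = Z (d + 6%:C%C *: k) + Om%:C%C *: k.
Proof. by rewrite /opD ZD ZS addrAC. Qed.

Let V_opD d k : V d -> V k -> V (opD d k).
Proof. by move=> Vd Vk; rewrite /opD; mem. Qed.

(* The form <H d, d> contributes nothing, Z and K being symmetric, and neither does
   e_0, because Z e_0 is a multiple of e_1 and H e_1 = 0; the defect comes from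
   e_1 alone and carries a factor eps. *)
Let energy_skew d k : V d -> V k -> isK d k ->
  Q (opD d k) (imu *: d) ^+ 2 <= 8 * eps * Q d d ^+ 2.
Proof.
move=> Vd Vk hk; pose h := d + 6%:C%C *: k; have Vh : V h by rewrite /h; try mem.
have hb j : dot h (b j) = (1 - 6 * kap j) * dot d (b j).
  by rewrite /h dD ?dS ?hk; try mem; ring.
have hh : dot h h <= 4 * Q d d.
  apply: sum_cvg_le (pars Vh Vh) (sum_cvgZ 4 (Q_sum Vd Vd)) _ => j.
  have := s_h j; rewrite !hb => sh.
  rewrite mulrACA -!expr2 [leRHS]mulrA.
  by rewrite ler_wpM2r// sqr_ge0.
have hk0 : dot (imu *: h) k = 0.
  rewrite dJ// (dC Vh (VS _ Vk)) /h dDr ?dSr; try mem.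
  rewrite (dC (VS imu Vk) Vk) (dJ0 Vk) mulr0 addr0 dJ// (dC Vk (VS _ Vd)).
  by rewrite dC ?(dotK_J Vd Vk hk) ?oppr0; try mem.
have hZ0 : dot (imu *: h) (Z h) = 0.
  have h1 : dot (imu *: h) (Z h) = dot h (imu *: Z h).
    by rewrite (dC (VS imu Vh) (VZ Vh)) (Zsym Vh (VS imu Vh)) ZS.
  by have := dJ Vh (VZ Vh); rewrite -h1; lra.
have VO := V_opD Vd Vk.
have hD : dot (imu *: h) (opD d k) = 0.
  by rewrite opD_H dDr ?dSr; try mem; rewrite hZ0 hk0 mulr0 addr0.
have cD t : V t -> dot (opD d k) t = dot h (Z t) + Om * dot k t.
  by move=> Vt; rewrite opD_H dD ?dS ?Zsym; try mem.
have Zb1 : Z (b 1) = a%:C%C *: b 3.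
  by rewrite (bJ 0) ZS Zb0 !scalerA mulrC -scalerA -(bJ 1).
have c0 : dot (opD d k) (b 0) = - (Om / 2) * dot d (b 0).
  by rewrite cD// Zb0 dSr// hb hk kap0 kap2; field.
have c1 : dot (opD d k) (b 1) = - (Om / 2) * dot d (b 1).
  by rewrite cD// Zb1 dSr// hb hk kap1 kap3; field.
have c2 : dot (opD d k) (b 2) = dot h (Z (b 2)) - Om / 6 * dot d (b 2).
  by rewrite cD// hk kap2; ring.
have c3 : dot (opD d k) (b 3) = dot h (Z (b 3)) - Om / 6 * dot d (b 3).
  by rewrite cD// hk kap3; ring.
have bound j : dot h (Z (b j)) ^+ 2 <= 4 * Q d d.
  apply: le_trans (cauchy_schwarz sV sVd Vh (VZ (Vb j))) _.
  have := Zle (Vb j); rewrite ortho eqxx => z1.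
  apply: le_trans hh; rewrite -[leRHS]mulr1 ler_wpM2l//; exact: (si_ge0 sVd).
have QE : Q (opD d k) (imu *: d) =
    eps * (dot h (Z (b 3)) * dot d (b 2) - dot h (Z (b 2)) * dot d (b 3)).
  rewrite QC; try mem; rewrite /Q.
  rewrite (isK_uniq (VS imu Vd) (VK (VS imu Vd)) (VS imu Vk) VO
    (isK_K (VS imu Vd)) (isK_J Vd Vk hk)).
  have -> : dot (imu *: d) (opD d k) + 6 * dot (imu *: k) (opD d k) =
      dot (imu *: h) (opD d k).
    have -> : imu *: h = imu *: d + 6%:C%C *: (imu *: k).
      by rewrite /h scalerDr !scalerA [imu * _]mulrC.
    by rewrite dD ?dS; try mem.
  rewrite hD c0 c1 c2 c3 c0J// c1J// c2J// c3J//; ring.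
have dq : eps * (dot d (b 2) ^+ 2 + dot d (b 3) ^+ 2) <= Q d d.
  have w0 : forall j, (4 <= j)%N -> (if (2 <= j < 4)%N then eps * dot d (b j) ^+ 2 else 0) = 0.
    by move=> j j4; rewrite [(j < 4)%N]ltnNge j4 andbF.
  have := sum_cvg_fin w0.
  rewrite !big_nat_recr//= big_geq//= !add0r -mulrDr => hw.
  apply: sum_cvg_le hw (Q_sum Vd Vd) _ => j.
  have /andP[s1 s2] := s_bound j.
  case: ifP => _; first by rewrite -expr2 ler_wpM2r// sqr_ge0.
  by rewrite mulr_ge0 -?expr2 ?sqr_ge0// (le_trans _ s1)// ltW.
rewrite QE; set p := dot h (Z (b 3)); set q := dot h (Z (b 2)).
have b3 := bound 3%N; have b2 := bound 2%N; rewrite -/p in b3; rewrite -/q in b2.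
have e0 := eps_gt0.
set x := dot d (b 2) in dq *; set y := dot d (b 3) in dq *.
have cs : (p * x - q * y) ^+ 2 <= (p ^+ 2 + q ^+ 2) * (x ^+ 2 + y ^+ 2).
  rewrite -subr_ge0 (_ : _ - _ = (p * y + q * x) ^+ 2) ?sqr_ge0//; ring.
have Q0 := si_ge0 Q_si Vd.
rewrite exprMn; apply: (@le_trans _ _ (eps ^+ 2 * ((8 * Q d d) * (x ^+ 2 + y ^+ 2)))).
  apply: ler_wpM2l; first exact: sqr_ge0.
  apply: le_trans cs _; apply: ler_wpM2r; first by rewrite addr_ge0 ?sqr_ge0.
  by lra.
rewrite (_ : eps ^+ 2 * _ = 8 * eps * Q d d * (eps * (x ^+ 2 + y ^+ 2))); last by ring.
rewrite (_ : 8 * eps * Q d d ^+ 2 = 8 * eps * Q d d * Q d d); last by ring.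
by apply: ler_wpM2l => //; rewrite !mulr_ge0// ltW.
Qed.

Variable lam : R[i].
Let al : R := complex.Re lam.
Let be : R := complex.Im lam.
Hypothesis be0 : be != 0.
Hypothesis eps_be : 32 * eps <= be ^+ 2.

Let lamE (f : E) : lam *: f = al%:C%C *: f + be%:C%C *: (imu *: f).
Proof.
rewrite scalerA -scalerDl; congr (_ *: _); rewrite /al /be /imu.
by case: lam => x y /=; simpc.
Qed.

(* Rotating by i or - i turns the imaginary part of the shift by lam into a
   positive multiple of the form. *)
Let rot : R[i] := (Num.sg be)%:C%C * imu.

Let Q_rot f g : V f -> V g -> Q (rot *: f) g = - (Num.sg be * Q f (imu *: g)).
Proof.
move=> Vf Vg; rewrite /rot -scalerA (siZ Q_si); try mem.
by rewrite Q_J// mulrN.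
Qed.

Let sg2 : Num.sg be ^+ 2 = 1. Proof. by rewrite sqr_sg be0. Qed.

Let Q_rotrot f : V f -> Q (rot *: f) (rot *: f) = Q f f.
Proof.
move=> Vf; rewrite /rot -scalerA (si_sqrZ sV Q_si); try mem.
by rewrite Q_JJ// sg2 mul1r.
Qed.

Let shifted d k : E := opD d k - lam *: d.

Let V_shifted d k : V d -> V k -> V (shifted d k).
Proof. by move=> Vd Vk; rewrite /shifted; have := V_opD Vd Vk => ?; mem. Qed.

Let coercive d k : V d -> V k -> isK d k ->
  (`|be| / 2) * Q d d <= Q (rot *: shifted d k) d.
Proof.
move=> Vd Vk hk; have VO := V_opD Vd Vk.
rewrite Q_rot//; last exact: V_shifted.
rewrite /shifted (siB sV Q_si); try mem.
have Vi := VS imu Vd.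
rewrite lamE (siD Q_si (VS _ Vd) (VS _ Vi) Vi) (siZ Q_si _ Vd Vi) (siZ Q_si _ Vi Vi).
rewrite Q_J0// Q_JJ// mulr0 add0r mulrBr opprB.
have -> : Num.sg be * (be * Q d d) = `|be| * Q d d by rewrite mulrA -normrEsg.
have Q0 := si_ge0 Q_si Vd.
suff : Num.sg be * Q (opD d k) (imu *: d) <= `|be| / 2 * Q d d by lra.
apply: le_trans (ler_norm _) _.
rewrite normrM normr_sg be0 mul1r.
rewrite -ler_sqr ?nnegrE ?mulr_ge0//.
rewrite real_normK ?num_real//; apply: le_trans (energy_skew Vd Vk hk) _.
rewrite exprMn ler_wpM2r ?sqr_ge0// expr_div_n real_normK ?num_real//.
by move: eps_be; lra.
Qed.

Let dotK_le d k : V d -> V k -> isK d k -> dot k k <= dot d d.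
Proof.
move=> Vd Vk hk; apply: sum_cvg_le (pars Vk Vk) (pars Vd Vd) _ => j.
rewrite hk mulrNN mulrACA -!expr2 -[leRHS]mul1r ler_wpM2r ?sqr_ge0//.
case: j => [|[|[|[|j]]]]; rewrite ?kap0 ?kap1 ?kap2 ?kap3; try lra.
by have /andP[h1 h2] := @kap4 j.+4 isT; nra.
Qed.

Let lip : R := 16 * (1 + Om ^+ 2) + 288 + 2 * (al ^+ 2 + be ^+ 2).

Let shifted_le d k : V d -> V k -> isK d k ->
  dot (shifted d k) (shifted d k) <= lip * dot d d.
Proof.
move=> Vd Vk hk; have VO := V_opD Vd Vk.
apply: le_trans (si_sqrB_le sV sVd VO (VS lam Vd)) _.
have -> : dot (lam *: d) (lam *: d) = (al ^+ 2 + be ^+ 2) * dot d d.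
  rewrite lamE (si_sqrD sV sVd) ?(si_sqrZ sV sVd) ?dS ?dSr ?dJJ ?dJ0; try mem.
  by ring.
have h1 : dot (opD d k) (opD d k) <=
    2 * (dot (Z d + Om%:C%C *: k) (Z d + Om%:C%C *: k)
      + dot (6%:C%C *: Z k) (6%:C%C *: Z k)).
  by apply: (si_sqrD_le sV sVd); mem.
have h2 : dot (Z d + Om%:C%C *: k) (Z d + Om%:C%C *: k) <=
    2 * (dot (Z d) (Z d) + dot (Om%:C%C *: k) (Om%:C%C *: k)).
  by apply: (si_sqrD_le sV sVd); mem.
rewrite !(si_sqrZ sV sVd) in h1 h2; try mem.
have z1 := Zle Vd; have z2 := Zle Vk; have kd := dotK_le Vd Vk hk.
have k2 : Om ^+ 2 * dot k k <= Om ^+ 2 * dot d d by rewrite ler_wpM2l// sqr_ge0.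
have d0 := si_ge0 sVd Vd; have o0 : 0 <= Om ^+ 2 * dot d d by rewrite mulr_ge0// sqr_ge0.
rewrite /lip !mulrDl !mulrDr; lra.
Qed.

Let shiftedB f h k l :
  shifted f k - shifted h l = shifted (f - h) (k - l).
Proof.
have ZB x y : Z (x - y) = Z x - Z y by rewrite ZD -scaleN1r ZS scaleN1r.
rewrite /shifted /opD !ZB !scalerBr !opprD addrACA; congr (_ + _).
by rewrite addrACA; congr (_ + _); rewrite addrACA.
Qed.

Definition zonal_op f : E := Z f + Om%:C%C *: K f + 6%:C%C *: Z (K f).
Local Notation M := zonal_op.

Let zonal_surj g : V g ->
  exists2 f, V f & dot (M f - lam *: f - g) (M f - lam *: f - g) = 0.
Proof.
move=> Vg; pose N f := rot *: (M f - lam *: f).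
have VN' f : V f -> V (N f) by move=> Vf; apply: VS; exact: (V_shifted Vf (VK Vf)).
have NB f h : V f -> V h -> N f - N h = rot *: shifted (f - h) (K f - K h).
  by move=> Vf Vh; rewrite -shiftedB scalerBr.
have hB f h : V f -> V h -> isK (f - h) (K f - K h).
  by move=> Vf Vh; apply: isK_B; try mem; exact: isK_K.
have [|f h Vf Vh|f h Vf Vh|f Vf hf] :=
  @monotone_lipschitz_surjective _ _ V Q sV Q_si N (`|be| / 2) (4 * lip / eps)
    (rot *: g) Q_complete VN' _ _ _ (VS rot Vg).
- by rewrite divr_gt0// normr_gt0.
- by rewrite NB//; apply: coercive; [mem|mem|exact: hB].
- rewrite NB// Q_rotrot; last by apply: V_shifted; mem.
  apply: le_trans (Q_le _) _; first by apply: V_shifted; mem.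
  rewrite -!mulrA ler_pM2l//; apply: le_trans (shifted_le _ _ (hB _ _ Vf Vh)) _; try mem.
  have l0 : 0 <= lip by rewrite /lip !addr_ge0// ?mulr_ge0 ?addr_ge0 ?sqr_ge0.
  by rewrite ler_wpM2l// mulrC ler_pdivlMr// mulrC Q_ge//; mem.
exists f => //; have Vs := V_shifted Vf (VK Vf).
apply/eqP; rewrite eq_le (si_ge0 sVd) ?andbT; last exact: VB.
rewrite -(ler_pM2l eps_gt0) mulr0 -hf /N -scalerBr Q_rotrot; last exact: VB.
by apply: Q_ge; exact: VB.
Qed.

Let zonal_bound f : V f ->
  dot f f <= 16 / (be ^+ 2 * eps) * dot (M f - lam *: f) (M f - lam *: f).
Proof.
move=> Vf; have Vs := V_shifted Vf (VK Vf); have hk := isK_K Vf.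
have co := coercive Vf (VK Vf) hk.
have b0 : 0 < `|be| by rewrite normr_gt0.
have be2 : 0 < be ^+ 2 by rewrite -(real_normK (num_real be)) exprn_gt0.
have q1 : (`|be| / 2) ^+ 2 * Q f f <= Q (shifted f (K f)) (shifted f (K f)).
  have [q0|qn0] := eqVneq (Q f f) 0; first by rewrite q0 mulr0 (si_ge0 Q_si).
  have qp : 0 < Q f f by rewrite lt_def qn0 (si_ge0 Q_si).
  rewrite -(ler_pM2r qp) -(Q_rotrot Vs).
  apply: le_trans (cauchy_schwarz sV Q_si (VS _ Vs) Vf).
  rewrite -mulrA -expr2 -exprMn ler_sqr// nnegrE.
    by rewrite mulr_ge0 ?divr_ge0// ltW.
  by apply: le_trans co; rewrite mulr_ge0 ?divr_ge0// ltW.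
have q2 := Q_le Vs; have q3 := Q_ge Vf.
rewrite -[M f - _]/(shifted f (K f)) mulrAC ler_pdivlMr ?(mulr_gt0 be2 eps_gt0)//.
move: q1; rewrite expr_div_n real_normK ?num_real// => q1.
have q4 : be ^+ 2 * (eps * dot f f) <= be ^+ 2 * Q f f by rewrite ler_pM2l.
lra.
Qed.

Lemma zonal_resolvent_eps :
  (forall g, V g ->
    exists2 f, V f & dot (M f - lam *: f - g) (M f - lam *: f - g) = 0) /\
  (forall f, V f ->
    dot f f <= 16 / (be ^+ 2 * eps) * dot (M f - lam *: f) (M f - lam *: f)).
Proof. by split; [exact: zonal_surj | exact: zonal_bound]. Qed.

End form.

(** The constant eps is chosen so that the defect of symmetry, sqrt (8 eps), does
    not exceed half of the imaginary part of lam in absolute value. *)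
Lemma zonal_resolvent (Om : R) (lam : R[i]) : complex.Im lam != 0 ->
  (forall g, V g -> exists2 f, V f &
     dot (zonal_op Om f - lam *: f - g) (zonal_op Om f - lam *: f - g) = 0) /\
  exists2 C, 0 <= C & forall f, V f ->
    dot f f <= C * dot (zonal_op Om f - lam *: f) (zonal_op Om f - lam *: f).
Proof.
move=> be0; set be := complex.Im lam in be0.
have be2 : 0 < be ^+ 2 by rewrite -(real_normK (num_real be)) exprn_gt0// normr_gt0.
pose eps := Num.min 2^-1 (be ^+ 2 / 32).
have e0 : 0 < eps <= 2^-1 by rewrite lt_min ge_min lexx divr_gt0// invr_gt0 ltr0n.
have e1 : 32 * eps <= be ^+ 2.
  by rewrite mulrC -ler_pdivlMr// ge_min lexx orbT.
have [h1 h2] := zonal_resolvent_eps e0 Om be0 e1; split => //.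
exists (16 / (be ^+ 2 * eps)) => //.
by have /andP[e00 _] := e0; rewrite divr_ge0// ltW// mulr_gt0.
Qed.

End zonal_operator.

(** * Square integrable functions *)

Section square_integrable.
Context {d : measure_display} {T : measurableType d} {R : realType}.
Variable mu : {measure set T -> \bar R}.
Implicit Types f g h : T -> R.

Lemma Lfun2P f : f \in Lfun mu 2%:E <->
  measurable_fun setT f /\ (\int[mu]_x (f x ^+ 2)%:E < +oo)%E.
Proof.
have sqE : (\int[mu]_x (`|(EFin \o f) x| `^ 2) = \int[mu]_x (f x ^+ 2)%:E)%E.
  apply: eq_integral => x _ /=; congr EFin.
  by rewrite powR_mulrn// real_normK// num_real.
split=> [fL|[mf fi]].
  split; first by move: fL; rewrite inE => /andP[/[!inE]].
  have /integrableP[_] := Lfun2_integrable_sqr fL.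
  rewrite (eq_integral (EFin \o (fun x => f x ^+ 2)))// => x _ /=.
  by rewrite ger0_norm// sqr_ge0.
rewrite inE; apply/andP; split; rewrite inE//=.
by rewrite /finite_norm unlock /Lnorm sqE; apply: poweR_lty.
Qed.

Lemma Lfun2_measurable f : f \in Lfun mu 2%:E -> measurable_fun setT f.
Proof. by case/Lfun2P. Qed.

Lemma Lfun2_le f (g : T -> R) : measurable_fun setT f ->
  mu.-integrable setT (EFin \o g) -> (forall x, f x ^+ 2 <= g x) ->
  f \in Lfun mu 2%:E.
Proof.
move=> mf /integrableP[mg ig] fg; apply/Lfun2P; split => //.
apply: le_lt_trans ig; apply: ge0_le_integral => //.
- by move=> x _; rewrite lee_fin sqr_ge0.
- by apply/measurable_EFinP; exact: measurable_funX.
- exact: measurableT_comp.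
- by move=> x _; rewrite lee_fin (le_trans (fg x))// ler_norm.
Qed.

Lemma integrable_mulr f g : f \in Lfun mu 2%:E -> g \in Lfun mu 2%:E ->
  mu.-integrable setT (EFin \o (fun x => f x * g x)).
Proof. by move=> Lf Lg; exact/Lfun1_integrable/(Lfun2_mul_Lfun1 Lf Lg). Qed.

Lemma Lfun2D f g : f \in Lfun mu 2%:E -> g \in Lfun mu 2%:E ->
  (fun x => f x + g x) \in Lfun mu 2%:E.
Proof.
move=> Lf Lg; have i1 := integrable_mulr Lf Lf; have i2 := integrable_mulr Lg Lg.
apply: (@Lfun2_le _ (fun x => 2 * (f x * f x) + 2 * (g x * g x))).
- by apply: measurable_funD; exact: Lfun2_measurable.
- apply: (eq_integrable measurableT (fun x => (2%:E * (f x * f x)%:E + 2%:E * (g x * g x)%:E)%E)) => //.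
  by apply: integrableD => //; exact: integrableZl.
- by move=> x; rewrite -subr_ge0 (_ : _ - _ = (f x - g x) ^+ 2) ?sqr_ge0//; ring.
Qed.

Lemma Lfun2_bounded_mul (h f : T -> R) (C : R) : measurable_fun setT h ->
  (forall x, `|h x| <= C) -> f \in Lfun mu 2%:E ->
  (fun x => h x * f x) \in Lfun mu 2%:E.
Proof.
move=> mh hC Lf; have i1 := integrable_mulr Lf Lf.
apply: (@Lfun2_le _ (fun x => C ^+ 2 * (f x * f x))).
- by apply: measurable_funM => //; exact: Lfun2_measurable.
- by apply: (eq_integrable measurableT (fun x => ((C ^+ 2)%:E * (f x * f x)%:E)%E)) => //;
    exact: integrableZl.
- move=> x; rewrite exprMn -expr2 ler_wpM2r ?sqr_ge0//.
  by rewrite -(real_normK (num_real (h x))) ler_sqr ?nnegrE// (le_trans _ (hC x)).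
Qed.

Lemma Lfun2Z (a : R) f : f \in Lfun mu 2%:E -> (fun x => a * f x) \in Lfun mu 2%:E.
Proof. exact: (@Lfun2_bounded_mul (cst a) _ `|a|). Qed.

Lemma Lfun2N f : f \in Lfun mu 2%:E -> (fun x => - f x) \in Lfun mu 2%:E.
Proof. by move=> /(Lfun2Z (-1)); under eq_fun do rewrite mulN1r. Qed.

Lemma Lfun2B f g : f \in Lfun mu 2%:E -> g \in Lfun mu 2%:E ->
  (fun x => f x - g x) \in Lfun mu 2%:E.
Proof. by move=> Lf Lg; apply: Lfun2D => //; exact: Lfun2N. Qed.

Lemma Lfun2_eq0 f : f \in Lfun mu 2%:E -> \int[mu]_x (f x * f x) = 0 ->
  {ae mu, forall x, f x = 0}.
Proof.
move=> Lf f0; have mf := Lfun2_measurable Lf.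
pose sq := EFin \o (fun x => f x * f x).
have msq : measurable_fun setT sq.
  by apply/measurable_EFinP; exact: measurable_funM.
have : (\int[mu]_x `|sq x| = 0)%E.
  have -> : (\int[mu]_x `|sq x| = \int[mu]_x sq x)%E.
    by apply: eq_integral => x _ /=; rewrite ger0_norm// -expr2 sqr_ge0.
  by rewrite -[LHS]fineK ?integrable_fin_num//; [congr EFin | exact: integrable_mulr].
move=> /(ae_eq_integral_abs mu measurableT msq).
by apply: filterS => x /(_ I) /= [] /eqP; rewrite mulf_eq0 orbb => /eqP.
Qed.

End square_integrable.

Section L2_complete.
Context {d : measure_display} {T : measurableType d} {R : realType}.
Variable mu : {measure set T -> \bar R}.
Hypothesis muT : (mu setT < +oo)%E.

(** By 2 |D| <= 2^k D^2 + 2^-k, the increments D of a sequence that converges fast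
    in mean square have integrable sums. *)
Lemma fast_cauchy_ae_cvg (v : nat -> T -> R) : (forall k, measurable_fun setT (v k)) ->
  (forall k, (\int[mu]_x ((v k.+1 x - v k x) ^+ 2)%:E <= (4^-1 ^+ k)%:E)%E) ->
  {ae mu, forall x, cvgn (fun k => v k x)}.
Proof.
move=> mv vc; pose D k x := v k.+1 x - v k x.
have mD k : measurable_fun setT (D k) by apply: measurable_funB.
pose S x := (\sum_(0 <= k <oo) `|D k x|%:E)%E.
have mabs k : measurable_fun setT (fun x => `|D k x|%:E).
  by apply/measurable_EFinP; exact: measurableT_comp.
have mS : measurable_fun setT S by apply: ge0_emeasurable_sum => // k x _ _; rewrite lee_fin.
have S0 x : (0 <= S x)%E by apply: nneseries_ge0 => k _ _; rewrite lee_fin.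
have bound k : (\int[mu]_x `|D k x|%:E <= ((1 + fine (mu setT)) * 2^-1 ^+ k)%:E)%E.
  have muE : mu setT = (fine (mu setT))%:E by rewrite fineK// ge0_fin_numE.
  apply: (@le_trans _ _ (\int[mu]_x ((2 ^+ k)%:E * (D k x ^+ 2)%:E + (2^-1 ^+ k)%:E))%E).
    apply: ge0_le_integral => //.
    - apply: emeasurable_funD; last exact: measurable_cst.
      apply: emeasurable_funM => //; apply/measurable_EFinP; exact: measurable_funX.
    - move=> x _; rewrite -EFinM -EFinD lee_fin.
      have p2 : 0 < (2 ^+ k : R) by rewrite exprn_gt0.
      have -> : (2^-1 ^+ k : R) = (2 ^+ k)^-1 by rewrite exprVn.
      rewrite -(ler_pM2l p2) mulrDr mulfV ?gt_eqF// -(real_normK (num_real (D k x))).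
      set y := `|D k x|; set p := 2 ^+ k; have y0 : 0 <= y by rewrite /y.
      by have := sqr_ge0 (p * y - 1); nra.
  rewrite ge0_integralD; [|exact: measurableT|..]; last 4 first.
  - by move=> x _; rewrite -EFinM lee_fin mulr_ge0 ?sqr_ge0// exprn_ge0.
  - apply: emeasurable_funM => //; apply/measurable_EFinP; exact: measurable_funX.
  - by move=> x _; rewrite lee_fin exprn_ge0// invr_ge0.
  - exact: measurable_cst.
  rewrite ge0_integralZl; [|exact: measurableT|..]; last 3 first.
  - by apply/measurable_EFinP; exact: measurable_funX.
  - by move=> x _; rewrite lee_fin sqr_ge0.
  - by rewrite lee_fin exprn_ge0.
  rewrite integral_cst// muE mulrDl EFinD mul1r [X in (_ <= _ + X)%E]EFinM [X in (_ <= _ + X)%E]muleC leeD2r//.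
  apply: (@le_trans _ _ ((2 ^+ k)%:E * (4^-1 ^+ k)%:E)%E).
    by apply: lee_wpmul2l; rewrite ?lee_fin ?exprn_ge0//; exact: vc.
  rewrite -EFinM lee_fin -exprMn (_ : 2 * 4^-1 = 2^-1)//; by field.
have Sint : (\int[mu]_x S x < +oo)%E.
  rewrite integral_nneseries//.
  apply: (@le_lt_trans _ _ (\sum_(0 <= k <oo) ((1 + fine (mu setT)) * 2^-1 ^+ k)%:E)%E).
    by apply: lee_nneseries => // k _ _; apply: integral_ge0 => x _; rewrite lee_fin.
  have : (fun n => (series (geometric (1 + fine (mu setT)) 2^-1) n)%:E) @ \oo -->
      ((1 + fine (mu setT)) * (1 - 2^-1)^-1)%:E.
    apply: cvg_EFin; first exact: nearW.
    apply: cvg_geometric_series; rewrite ger0_norm ?invr_ge0//.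
    by rewrite invf_lt1// ltr1n.
  under eq_fun do rewrite /series /= -sumEFin.
  by move=> /cvg_lim -> //; rewrite ltry.
have iS : mu.-integrable setT S.
  apply/integrableP; split => //.
  by rewrite (eq_integral S)// => x _; rewrite gee0_abs.
apply: filterS (integrable_ae measurableT iS) => x /(_ I) Sx.
have cs : cvgn (series (fun k => D k x)).
  apply: normed_cvg; apply: nondecreasing_is_cvgn.
    by apply: nondecreasing_series => k _ _ /=.
  exists (fine (S x)) => _ [n _ <-]; rewrite -lee_fin fineK// /series /= -sumEFin.
  by apply: nneseries_lim_ge => k _ _; rewrite lee_fin.
have -> : (fun k => v k x) = (fun k => series (fun k => D k x) k + v 0 x).
  by apply/funext => k; rewrite /series /= /D telescope_sumr// subrK.
by apply: is_cvgD => //; exact: is_cvg_cst.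
Qed.

(** A fast subsequence converges almost everywhere, and Fatou's lemma shows that
    its limit is the limit in mean square. *)
Lemma L2_complete (u : nat -> T -> R) : (forall n, u n \in Lfun mu 2%:E) ->
  (forall e : R, 0 < e -> exists N, forall m n, (N <= m)%N -> (N <= n)%N ->
     \int[mu]_x ((u m x - u n x) * (u m x - u n x)) <= e) ->
  exists2 l, l \in Lfun mu 2%:E & forall e : R, 0 < e -> exists N, forall n, (N <= n)%N ->
     \int[mu]_x ((u n x - l x) * (u n x - l x)) <= e.
Proof.
move=> Lu cu.
have intE (f : T -> R) : f \in Lfun mu 2%:E ->
    (\int[mu]_x (f x ^+ 2)%:E = (\int[mu]_x (f x * f x))%:E)%E.
  move=> Lf; rewrite /Rintegral fineK; last first.
    by apply: integrable_fin_num => //; exact: integrable_mulr.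
  by apply: eq_integral => x _; rewrite expr2.
have /choice [N hN] : forall k : nat, exists N, forall m n, (N <= m)%N -> (N <= n)%N ->
    \int[mu]_x ((u m x - u n x) * (u m x - u n x)) <= 4^-1 ^+ k.
  by move=> k; apply: cu; rewrite exprn_gt0// invr_gt0.
pose s k := (\sum_(0 <= i < k.+1) N i + k)%N.
have sN k : (N k <= s k)%N.
  by rewrite /s big_nat_recr//= -addnA addnCA leq_addr.
have sS k : (s k <= s k.+1)%N.
  by rewrite /s [X in (_ <= X + _)%N]big_nat_recr//= leq_add// leq_addr.
pose v k := u (s k).
have Lv k : v k \in Lfun mu 2%:E by exact: Lu.
have mv k : measurable_fun setT (v k) by exact: Lfun2_measurable (Lv k).
have /fast_cauchy_ae_cvg [//|A [mA A0 hA]] : forall k,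
    (\int[mu]_x ((v k.+1 x - v k x) ^+ 2)%:E <= (4^-1 ^+ k)%:E)%E.
  move=> k; rewrite intE; last exact: Lfun2B.
  rewrite lee_fin; apply: hN; last exact: sN.
  exact: leq_trans (sN k) (sS k).
pose w k x := v k x * \1_(~` A) x.
have wcvg x : cvgn (fun k => w k x).
  have [xA|xA] := boolP (x \in A).
    rewrite /w; under eq_fun do rewrite indicE in_setC xA mulr0.
    exact: is_cvg_cst.
  rewrite /w; under eq_fun do rewrite indicE in_setC xA mulr1.
  by apply: contrapT => nc; move/negP : xA; apply; rewrite inE; exact: hA.
pose l x := limn (fun k => w k x).
have ml : measurable_fun setT l.
  apply: (@measurable_fun_cvg _ _ _ _ w) => //.
    move=> k; apply: measurable_funM => //.
    by apply: measurable_indic; exact: measurableC.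
have vl : {ae mu, forall x, (fun k => v k x) @ \oo --> l x}.
  exists A; split => // x; apply: contra_notP => xA.
  have : w ^~ x @ \oo --> l x by exact: wcvg.
  by rewrite /w; under eq_fun do rewrite indicE mem_set// mulr1.
have key e : 0 < e -> exists N, forall n, (N <= n)%N ->
    (\int[mu]_x ((u n x - l x) ^+ 2)%:E <= e%:E)%E.
  move=> e0; have [M hM] := cu e e0; exists M => n Mn.
  pose h k x := ((u n x - v k x) ^+ 2)%:E.
  have mh k : measurable_fun setT (h k).
    apply/measurable_EFinP; apply: measurable_funX; apply: measurable_funB => //.
    exact: Lfun2_measurable (Lu n).
  have -> : (\int[mu]_x ((u n x - l x) ^+ 2)%:E = \int[mu]_x limn_einf (h ^~ x))%E.
    apply: ge0_ae_eq_integral => //.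
    - apply/measurable_EFinP; apply: measurable_funX; apply: measurable_funB => //.
      exact: Lfun2_measurable (Lu n).
    - rewrite (_ : (fun x => _) = (fun x => - limn_esup (fun k => - h k x))%E).
        apply: measurableT_comp => //; apply: measurable_fun_limn_esup => k.
        exact: measurableT_comp.
      by apply/funext => x; rewrite (limn_esupN (h ^~ x)) oppeK.
    - by move=> x _; rewrite lee_fin sqr_ge0.
    - move=> x _; rewrite limn_einf_lim; apply: lime_ge.
        exact: is_cvg_einfs.
      by apply: nearW => k; apply: le_ereal_inf_tmp => _ [j _ <-]; rewrite lee_fin sqr_ge0.
    - apply: filterS vl => x vx _.
      have hx : h ^~ x @ \oo --> ((u n x - l x) ^+ 2)%:E.
        apply: cvg_EFin; first exact: nearW.
        by rewrite /h /=; apply: cvgM; apply: cvgB => //; exact: cvg_cst.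
      by rewrite is_cvg_limn_einfE ?(cvg_lim _ hx)//; apply/cvg_ex; eexists; exact: hx.
  apply: le_trans (fatou _ _ _ _) _ => //.
    by move=> k x _; rewrite lee_fin sqr_ge0.
  rewrite limn_einf_lim; apply: lime_le; first exact: is_cvg_einfs.
  near=> k; apply: le_trans (_ : (\int[mu]_x h k x <= _)%E).
    by apply: ge_ereal_inf; eexists; [exists k => //= | exact: lexx].
  rewrite intE; last exact: Lfun2B.
  rewrite lee_fin; apply: hM => //.
  apply: (@leq_trans k); last by rewrite leq_addl.
  by near: k; exact: nbhs_infty_ge.
have Ll : l \in Lfun mu 2%:E.
  have [M hM] := key 1 ltr01.
  have Lul : (fun x => u M x - l x) \in Lfun mu 2%:E.
    apply/Lfun2P; split; first by apply: measurable_funB => //; exact: Lfun2_measurable (Lu M).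
    by apply: le_lt_trans (hM M (leqnn _)) _; rewrite ltry.
  have := Lfun2B (Lu M) Lul.
  by under eq_fun do rewrite opprB addrCA subrr addr0.
exists l => // e e0; have [M hM] := key e e0; exists M => n Mn.
by have := hM n Mn; rewrite intE ?lee_fin//; exact: Lfun2B.
Unshelve. all: by end_near.
Qed.

End L2_complete.

(** * Densities with vanishing moments *)

Section dense_moments.
Context {d : measure_display} {T : measurableType d} {R : realType}.
Variable mu : {measure set T -> \bar R}.
Implicit Types v : T -> R.
Local Notation integ v := (mu.-integrable setT (EFin \o v)).

Lemma integrable_bounded_mul v (h : T -> R) (C : R) : integ v -> measurable_fun setT h ->
  (forall x, v x = 0 \/ `|h x| <= C) -> integ (fun x => v x * h x).
Proof.
move=> iv mh hC.
have mv : measurable_fun setT v by apply/measurable_EFinP; exact: (measurable_int mu).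
have iC : integ (fun x => C * v x).
  by apply: (eq_integrable measurableT (fun x => (C%:E * (v x)%:E)%E)) => //; exact: integrableZl.
apply: (le_integrable measurableT _ _ iC).
  by apply/measurable_EFinP; exact: measurable_funM.
move=> x _ /=; rewrite lee_fin !normrM.
case: (hC x) => [->|hx]; first by rewrite normr0 mul0r mulr0.
by rewrite mulrC ler_wpM2r// (le_trans hx)// ler_norm.
Qed.

Lemma integral_indic_mul v (B : set T) : measurable B ->
  (\int[mu]_(x in B) (v x)%:E = \int[mu]_x (v x * \1_B x)%:E)%E.
Proof.
move=> mB; rewrite integral_mkcond; apply: eq_integral => x _.
rewrite /patch indicE; case: ifPn => _; first by rewrite mulr1.
by rewrite mulr0.
Qed.

Lemma integral_poly_eq0 v (t : T -> R) (p : {poly R}) : integ v ->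
  measurable_fun setT t -> (forall x, v x = 0 \/ `|t x| <= 1) ->
  (forall k, \int[mu]_x (v x * t x ^+ k) = 0) -> \int[mu]_x (v x * p.[t x]) = 0.
Proof.
move=> iv mt t1 mom.
have it k : integ (fun x => v x * t x ^+ k).
  apply: (@integrable_bounded_mul _ _ 1) => //; first exact: measurable_funX.
  move=> x; case: (t1 x) => h; [by left | right].
  by rewrite normrX exprn_ile1.
have -> : (fun x => v x * p.[t x]) = (fun x => \sum_(i < size p) (p`_i * (v x * t x ^+ i))).
  by apply/funext => x; rewrite horner_coef mulr_sumr; apply: eq_bigr => i _; rewrite mulrCA.
elim: (size p) => [|n ih].
  by under eq_Rintegral do rewrite big_ord0; rewrite Rintegral_cst// mul0r.
under eq_Rintegral do rewrite big_ord_recr /=.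
have iS m : integ (fun x => \sum_(i < m) (p`_i * (v x * t x ^+ i))).
  apply: (eq_integrable measurableT (fun x => \sum_(i < m) (p`_i * (v x * t x ^+ i))%:E)%E).
    by move=> x _ /=; rewrite sumEFin.
  apply: integrable_sum => // i _.
  apply: (eq_integrable measurableT (fun x => ((p`_i)%:E * (v x * t x ^+ i)%:E)%E)) => //.
  by apply: integrableZl => //; exact: it.
have iZ : integ (fun x => p`_n * (v x * t x ^+ n)).
  apply: (eq_integrable measurableT (fun x => ((p`_n)%:E * (v x * t x ^+ n)%:E)%E)) => //.
  by apply: integrableZl => //; exact: it.
rewrite (RintegralD measurableT (iS n) iZ) ih add0r.
by rewrite (RintegralZl _ measurableT (it n)) mom mulr0.
Qed.

End dense_moments.

Section step_polynomials.
Context {R : realType}.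

Lemma bernoulli_ge (y : R) n : 0 <= y <= 1 -> 1 - n%:R * y <= (1 - y) ^+ n.
Proof.
move=> /andP[y0 y1]; elim: n => [|n ih]; first by rewrite mul0r subr0 expr0.
rewrite exprS; apply: (@le_trans _ _ ((1 - y) * (1 - n%:R * y))); last first.
  by rewrite ler_wpM2l// subr_ge0.
rewrite -natr1; have n0 : 0 <= n%:R :> R by []; nra.
Qed.

Lemma bernoulli_le (y : R) n : 0 <= y <= 1 -> (1 - y) ^+ n * (1 + n%:R * y) <= 1.
Proof.
move=> /andP[y0 y1]; elim: n => [|n ih]; first by rewrite mul0r addr0 expr0 mulr1.
have e0 : 0 <= (1 - y) ^+ n by rewrite exprn_ge0// subr_ge0.
apply: le_trans ih; rewrite exprSr -mulrA; apply: ler_wpM2l => //.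
rewrite -natr1; have n0 : 0 <= n%:R :> R by []; nra.
Qed.

Lemma cvg_natr_expr (r : R) : 0 <= r < 1 -> (fun n => n%:R * r ^+ n) @ \oo --> 0.
Proof.
move=> /andP[r0 r1]; have [->|rn0] := eqVneq r 0.
  apply/cvgrPdist_le => e e0; exists 1 => // n /= n0.
  by rewrite expr0n gtn_eqF// mulr0 subrr normr0 ltW.
have rp : 0 < r by rewrite lt_def rn0.
pose q := Num.sqrt r.
have q0 : 0 < q by rewrite sqrtr_gt0.
have q1 : q < 1 by rewrite -sqrtr1 ltr_sqrt.
have qq : r = q * q by rewrite -expr2 sqr_sqrtr.
pose D := q^-1 - 1.
have D0 : 0 < D by rewrite subr_gt0 invf_gt1.
have nq n : n%:R * q ^+ n <= D^-1.
  have : 1 + n%:R * D <= (1 + D) ^+ n.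
    elim: n => [|n ih]; first by rewrite mul0r addr0 expr0.
    rewrite exprS; apply: (@le_trans _ _ ((1 + D) * (1 + n%:R * D))).
      by rewrite -natr1; have n0 : 0 <= n%:R :> R by []; nra.
    by rewrite ler_wpM2l// addr_ge0// ltW.
  have -> : 1 + D = q^-1 by rewrite /D addrC subrK.
  rewrite exprVn => h.
  have qn : 0 < q ^+ n by rewrite exprn_gt0.
  rewrite -(ler_pM2r D0) mulVf ?gt_eqF// mulrAC.
  rewrite -ler_pdivlMr// mul1r; apply: le_trans h; lra.
apply: (@squeeze_cvgr _ _ _ _ (cst 0) (fun n => D^-1 * q ^+ n)).
- apply: nearW => n; rewrite mulr_ge0// ?exprn_ge0//=.
  by rewrite qq exprMn mulrA ler_wpM2r ?nq// exprn_ge0// ltW.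
- exact: cvg_cst.
- rewrite -[X in _ --> X](mulr0 D^-1); apply: cvgMr.
  by apply: cvg_expr; rewrite gtr0_norm.
Qed.

(** Polynomials in s that converge boundedly on [0, 1] to the indicator of
    s < 1/2: by Bernoulli's inequality the value is close to 1 or to 0 according
    to the size of n 2^n s^n = n (2 s)^n. *)
Definition step (n : nat) (s : R) : R := (1 - s ^+ n) ^+ (n * 2 ^ n).

Lemma step_ge0_le1 n s : 0 <= s <= 1 -> 0 <= step n s <= 1.
Proof.
move=> /andP[s0 s1]; have h : 0 <= s ^+ n <= 1 by rewrite exprn_ge0// exprn_ile1.
move/andP : h => [h0 h1].
by rewrite /step exprn_ge0 ?subr_ge0// exprn_ile1 ?subr_ge0// gerBl.
Qed.

Lemma cvg_step s : 0 <= s <= 1 -> (fun n => step n s) @ \oo --> ((s < 2^-1)%R%:R : R).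
Proof.
move=> s01; have /andP[s0 s1] := s01.
have sn n : 0 <= s ^+ n <= 1 by rewrite exprn_ge0// exprn_ile1.
have e n : (n * 2 ^ n)%:R * s ^+ n = n%:R * (2 * s) ^+ n.
  by rewrite natrM natrX exprMn mulrA.
have [sh|sh] := ltP s 2^-1.
  apply: (@squeeze_cvgr _ _ _ _ (fun n => 1 - n%:R * (2 * s) ^+ n) (cst 1)).
  - apply: nearW => n; have /andP[_ ->] := step_ge0_le1 n s01; rewrite andbT.
    by rewrite -e; exact: bernoulli_ge.
  - rewrite -[X in _ --> X]subr0; apply: cvgB; first exact: cvg_cst.
    apply: cvg_natr_expr; rewrite mulr_ge0//=.
    by lra.
  - exact: cvg_cst.
apply: (@squeeze_cvgr _ _ _ _ (cst 0) (fun n => harmonic n)).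
- apply: nearW => n; have /andP[-> _] := step_ge0_le1 n s01 => /=.
  rewrite /harmonic -div1r ler_pdivlMr//.
  apply: le_trans (bernoulli_le (n * 2 ^ n) (sn n)).
  apply: ler_wpM2l; first by have /andP[] := step_ge0_le1 n s01.
  rewrite -nat1r lerD2l e ler_peMr// exprn_ege1//.
  lra.
- exact: cvg_cst.
- exact: cvg_harmonic.
Qed.

End step_polynomials.

Section moment_problem.
Context {d : measure_display} {T : measurableType d} {R : realType}.
Variable mu : {measure set T -> \bar R}.
Implicit Types v : T -> R.
Local Notation integ v := (mu.-integrable setT (EFin \o v)).

(** An affine change of variable brings t to [0, 1] and the threshold c to 1/2,
    where the step polynomials converge dominatedly. *)
Lemma moments_halfline v (t : T -> R) (c : R) : integ v -> measurable_fun setT t ->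
  (forall x, v x = 0 \/ `|t x| <= 1) ->
  (forall k, \int[mu]_x (v x * t x ^+ k) = 0) ->
  (\int[mu]_(x in [set x | (t x < c)%R]) (v x)%:E = 0)%E.
Proof.
move=> iv mt t1 mom.
have mv : measurable_fun setT v by apply/measurable_EFinP; exact: (measurable_int mu).
pose L := 2 * (1 + `|c|).
have L0 : 0 < L by rewrite mulr_gt0// ltr_pwDl.
pose s x := (t x - c) / L + 2^-1.
have s01 x : `|t x| <= 1 -> 0 <= s x <= 1.
  move=> tx; have : `|(t x - c) / L| <= 2^-1.
    rewrite normrM normfV (gtr0_norm L0) ler_pdivrMr// /L mulrA mulVf// mul1r.
    by apply: le_trans (ler_normB _ _) _; rewrite lerD2r.
  by rewrite ler_norml /s => /andP[h1 h2]; apply/andP; split; lra.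
have sE x : (s x < 2^-1) = (t x < c).
  rewrite /s -[X in _ < X]add0r ltrD2r pmulr_llt0 ?invr_gt0//.
  by rewrite subr_lt0.
pose P n : {poly R} := (1%:P - (L^-1 *: 'X + (2^-1 - c / L)%:P) ^+ n) ^+ (n * 2 ^ n).
have PE n x : (P n).[t x] = step n (s x).
  rewrite /P /step horner_exp hornerD hornerN hornerC horner_exp.
  rewrite hornerD hornerZ hornerX hornerC /s; congr ((1 - _ ^+ _) ^+ _).
  by rewrite mulrBl [_ * t x]mulrC; ring.
have P0 n : \int[mu]_x (v x * step n (s x)) = 0.
  rewrite -(integral_poly_eq0 (P n) iv mt t1 mom).
  by apply: eq_Rintegral => x _; rewrite PE.
have mc : measurable [set x | t x < c].
  rewrite (_ : [set x | t x < c] = setT `&` t @^-1` `]-oo, c[).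
    by apply: mt => //; exact: measurable_itv.
  by rewrite setTI; apply/seteqP; split => x /=; rewrite in_itv.
have mst n : measurable_fun setT (fun x => v x * step n (s x)).
  apply: measurable_funM => //; rewrite /step; apply: measurable_funX.
  apply: measurable_funB => //; apply: measurable_funX.
  apply: measurable_funD => //; apply: measurable_funM => //.
  exact: measurable_funB.
rewrite integral_indic_mul//.
have [|||||_ _] := @dominated_convergence _ _ _ mu setT measurableT
   (fun n x => (v x * step n (s x))%:E)
   (fun x => (v x * \1_[set x | t x < c] x)%:E) (fun x => `|v x|%:E).
- by move=> n; apply/measurable_EFinP; exact: mst.
- by apply/measurable_EFinP; apply: measurable_funM => //; exact: measurable_indic.
- apply/aeW => x _; apply: cvg_EFin; first exact: nearW.
  case: (t1 x) => [->|tx]; first by under eq_fun do rewrite mul0r; rewrite mul0r; exact: cvg_cst.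
  apply: cvgMr; rewrite indicE.
  have -> : (x \in [set x | t x < c]) = (s x < 2^-1).
    by rewrite sE; apply/idP/idP; rewrite inE.
  by apply: cvg_step; exact: s01.
- exact: (integrable_abse iv).
- apply/aeW => x n _ /=; rewrite lee_fin normrM.
  case: (t1 x) => [->|tx]; first by rewrite normr0 mul0r.
  rewrite ler_piMr//; have /andP[h0 h1] := step_ge0_le1 n (s01 _ tx).
  by rewrite ger0_norm.
move=> /cvg_lim <- //; apply: lim_near_cst => //; apply: nearW => n /=.
rewrite -[LHS]fineK ?[fine _]P0//.
apply: integrable_fin_num => //.
apply: (le_integrable measurableT _ _ iv); first by apply/measurable_EFinP; exact: mst.
move=> x _ /=; rewrite lee_fin normrM.
case: (t1 x) => [->|tx]; first by rewrite normr0 mul0r.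
rewrite ler_piMr//; have /andP[h0 h1] := step_ge0_le1 n (s01 _ tx).
by rewrite ger0_norm.
Qed.

(** The sets over which the integral vanishes form a Dynkin system. *)
Lemma vanishing_density_dynkin d' (T' : measurableType d') (s : T -> T')
    (G : set (set T')) v : integ v -> measurable_fun setT s ->
  @measurable d' T' = <<s G >> -> setI_closed G ->
  (\int[mu]_x (v x)%:E = 0)%E ->
  (forall A, G A -> (\int[mu]_(x in s @^-1` A) (v x)%:E = 0)%E) ->
  forall A, measurable A -> (\int[mu]_(x in s @^-1` A) (v x)%:E = 0)%E.
Proof.
move=> iv ms GE GI v0 vG A; rewrite {1}GE.
have mpre B : measurable B -> measurable (s @^-1` B).
  by move=> mB; rewrite -[X in measurable X]setTI; exact: ms.
have iv' B : mu.-integrable B (EFin \o v) \/ ~ measurable B.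
  by case: (pselect (measurable B)) => mB; [left; apply: integrableS iv | right].
apply: (dynkin_induction (P := [set A | (\int[mu]_(x in s @^-1` A) (v x)%:E = 0)%E]) GE GI).
- by rewrite /= preimage_setT.
- exact: vG.
- move=> B mB /= B0; rewrite preimage_setC.
  have := @integral_setU _ _ _ mu (s @^-1` B) (~` (s @^-1` B)) (EFin \o v).
  rewrite setUv v0 B0 add0e => -> //; [exact: mpre|exact/measurableC/mpre| |].
  + exact: (measurable_int mu).
  + by apply/disj_setPS; rewrite setICr.
- move=> F mF tF F0 /=; rewrite preimage_bigcup integral_bigcup.
  + by apply: eseries0 => k _ _; exact: F0.
  + by move=> i j _ _ [x [Fi Fj]]; apply: tF => //; exists (s x).
  + by move=> k; exact: mpre.
  + apply: integrableS iv => //; apply: bigcup_measurable => k _; exact: mpre.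
Qed.

Lemma moments_measurable v (t : T -> R) : integ v -> measurable_fun setT t ->
  (forall x, v x = 0 \/ `|t x| <= 1) ->
  (forall k, \int[mu]_x (v x * t x ^+ k) = 0) ->
  forall A : set R, measurable A -> \int[mu]_x (v x * \1_A (t x)) = 0.
Proof.
move=> iv mt t1 mom A mA.
suff : (\int[mu]_(x in t @^-1` A) (v x)%:E = 0)%E.
  rewrite integral_indic_mul; last by rewrite -[X in measurable X]setTI; exact: mt.
  by rewrite /Rintegral => ->.
apply: (@vanishing_density_dynkin _ _ t (@RGenInftyO.G R)) => //.
- exact: RGenInftyO.measurableE.
- move=> _ _ [x ->] [y ->]; exists (Num.min x y).
  by apply/seteqP; split => z /=; rewrite !in_itv /= lt_min; [move=> [-> ->]|move=> /andP].
- have := mom 0; under eq_Rintegral do rewrite expr0 mulr1.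
  by rewrite /Rintegral => v0; rewrite -[LHS]fineK ?v0//; exact: integrable_fin_num.
- move=> _ [c ->]; have := moments_halfline c iv mt t1 mom.
  congr (_ = _); congr (integral _ _ _); apply/seteqP; split => x /=; by rewrite in_itv.
Qed.

End moment_problem.

Section moment_problem3.
Context {R : realType}.
Notation R3 := (R * R * R)%type.
Variable mu : {measure set R3 -> \bar R}.
Local Notation integ v := (mu.-integrable setT (EFin \o v)).

(** One coordinate at a time, powers are traded for indicators of Borel sets; the
    integral of v then vanishes over boxes, hence over all measurable sets. *)
Lemma moments_null (v : R3 -> R) : integ v ->
  {ae mu, forall p, [/\ `|x1 p| <= 1, `|x2 p| <= 1 & `|x3 p| <= 1]} ->
  (forall a b c, \int[mu]_p (v p * (x1 p ^+ a * x2 p ^+ b * x3 p ^+ c)) = 0) ->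
  {ae mu, forall p, v p = 0}.
Proof.
move=> iv cube mom.
have m1 : measurable_fun setT (@x1 R) by apply: (measurableT_comp measurable_fst); exact: measurable_fst.
have m2 : measurable_fun setT (@x2 R) by apply: (measurableT_comp measurable_snd); exact: measurable_fst.
have m3 : measurable_fun setT (@x3 R) by exact: measurable_snd.
have mabs (t : R3 -> R) : measurable_fun setT t -> measurable [set p | `|t p| <= 1].
  move=> mt; rewrite (_ : mkset _ = setT `&` (fun p => `|t p|) @^-1` `]-oo, 1]).
    by apply: (measurableT_comp _ mt) => //; exact: measurable_itv.
  by rewrite setTI; apply/seteqP; split => x /=; rewrite in_itv.
pose S := [set p : R3 | `|x1 p| <= 1] `&` [set p | `|x2 p| <= 1] `&` [set p | `|x3 p| <= 1].
have mS : measurable S by apply: measurableI; [apply: measurableI|]; exact: mabs.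
have S1 (B : set R3) p : `|\1_B p : R| <= 1.
  by rewrite indicE; case: (_ \in _); rewrite ?normr1 ?normr0.
have imul (w : R3 -> R) (B : set R3) : integ w -> measurable B -> integ (fun p => w p * \1_B p).
  move=> iw mB; apply: (@integrable_bounded_mul _ _ _ mu w \1_B 1 iw).
    exact: measurable_indic.
  by move=> p; right.
pose u p := v p * \1_S p.
have iu : integ u by exact: imul.
have uv : {ae mu, forall p, u p = v p}.
  apply: filterS cube => p [h1 h2 h3].
  by rewrite /u indicE mem_set ?mulr1.
have u0 p : u p = 0 \/ [/\ `|x1 p| <= 1, `|x2 p| <= 1 & `|x3 p| <= 1].
  rewrite /u indicE; have [|_] := boolP (p \in S); last by left; rewrite mulr0.
  by rewrite inE => -[[h1 h2] h3]; right.
have ipow (w t : R3 -> R) k : integ w -> measurable_fun setT t ->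
    (forall p, w p = 0 \/ `|t p| <= 1) -> integ (fun p => w p * t p ^+ k).
  move=> iw mt wt; apply: (@integrable_bounded_mul _ _ _ mu w (fun p => t p ^+ k) 1 iw).
    exact: measurable_funX.
  by move=> p; case: (wt p) => h; [left | right; rewrite normrX exprn_ile1].
have mul0 (w h t : R3 -> R) : (forall p, w p = 0 \/ `|t p| <= 1) ->
    forall p, w p * h p = 0 \/ `|t p| <= 1.
  by move=> wt p; case: (wt p) => [->|]; [left; rewrite mul0r | right].
have u1 p : u p = 0 \/ `|x1 p| <= 1 by case: (u0 p) => [|[? ? ?]]; [left|right].
have u2 p : u p = 0 \/ `|x2 p| <= 1 by case: (u0 p) => [|[? ? ?]]; [left|right].
have u3 p : u p = 0 \/ `|x3 p| <= 1 by case: (u0 p) => [|[? ? ?]]; [left|right].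
have mpre (t : R3 -> R) A : measurable_fun setT t -> measurable A -> measurable (t @^-1` A).
  by move=> mt mA; rewrite -[X in measurable X]setTI; exact: mt.
have momu a b c : \int[mu]_p (u p * x2 p ^+ b * x3 p ^+ c * x1 p ^+ a) = 0.
  rewrite -(mom a b c) /Rintegral; congr fine.
  have iw : integ (fun p => u p * x2 p ^+ b * x3 p ^+ c * x1 p ^+ a).
    apply: (ipow _ _ a) => //; last by do 2 apply: (mul0).
    apply: (ipow _ _ c) => //; last by apply: mul0.
    exact: ipow.
  apply: ae_eq_integral => //.
  - exact: (measurable_int mu).
  - apply/measurable_EFinP; apply: measurable_funM.
      by apply/measurable_EFinP; exact: (measurable_int mu).
    by apply: measurable_funM; [apply: measurable_funM|]; exact: measurable_funX.
  - by apply: filterS uv => p /= -> _; congr EFin; ring.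
have step1 A b c : measurable A ->
    \int[mu]_p (u p * \1_A (x1 p) * x3 p ^+ c * x2 p ^+ b) = 0.
  move=> mA; rewrite -(@moments_measurable _ _ _ mu (fun p => u p * x2 p ^+ b * x3 p ^+ c) (@x1 R) _ m1 _ _ A)//.
  - by apply: eq_Rintegral => p _; ring.
  - by apply: (ipow _ _ c) => //; [exact: ipow | exact: mul0].
  - by do 2 apply: (mul0).
have iA A : measurable A -> integ (fun p => u p * \1_A (x1 p)).
  by move=> mA; apply: (imul u (@x1 R @^-1` A)) => //; exact: mpre.
have step2 A B c : measurable A -> measurable B ->
    \int[mu]_p (u p * \1_A (x1 p) * \1_B (x2 p) * x3 p ^+ c) = 0.
  move=> mA mB; rewrite -(@moments_measurable _ _ _ mu (fun p => u p * \1_A (x1 p) * x3 p ^+ c) (@x2 R) _ m2 _ _ B)//.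
  - by apply: eq_Rintegral => p _; ring.
  - by apply: (ipow _ _ c) => //; [exact: iA | exact: mul0].
  - by do 2 apply: (mul0).
  - by move=> k; exact: step1.
have iAB A B : measurable A -> measurable B ->
    integ (fun p => u p * \1_A (x1 p) * \1_B (x2 p)).
  by move=> mA mB; apply: (imul _ (@x2 R @^-1` B)); [exact: iA | exact: mpre].
have step3 A B C : measurable A -> measurable B -> measurable C ->
    \int[mu]_p (u p * \1_A (x1 p) * \1_B (x2 p) * \1_C (x3 p)) = 0.
  move=> mA mB mC; apply: moments_measurable => //; first exact: iAB.
  - by do 2 apply: (mul0).
  - by move=> k; exact: step2.
have e0 (w : R3 -> R) : integ w -> \int[mu]_p w p = 0 -> (\int[mu]_p (w p)%:E = 0)%E.
  by move=> iw w0; rewrite -[LHS]fineK ?[fine _]w0//; exact: integrable_fin_num.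
have recI (T1 T2 : Type) (P1 : set (set T1)) (P2 : set (set T2)) :
    setI_closed P1 -> setI_closed P2 ->
    setI_closed [set A `*` B | A in P1 & B in P2].
  move=> h1 h2 _ _ [A1 PA1 [B1 PB1 <-]] [A2 PA2 [B2 PB2 <-]].
  exists (A1 `&` A2); first exact: h1.
  by exists (B1 `&` B2); [exact: h2 | rewrite setXI].
have mI d' (T' : measurableType d') : setI_closed (@measurable d' T').
  by move=> ? ? ? ?; exact: measurableI.
have step4 (D : set (R * R)) C : measurable D -> measurable C ->
    (\int[mu]_p (u p * \1_D p.1 * \1_C (x3 p))%:E = 0)%E.
  move=> mD mC.
  have iC : integ (fun p => u p * \1_C (x3 p)).
    by apply: (imul u (@x3 R @^-1` C)) => //; exact: mpre.
  have mf : measurable_fun setT (@fst (R * R) R : R3 -> R * R) by exact: measurable_fst.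
  have mD' : measurable (@fst (R * R) R @^-1` D).
    by rewrite -[X in measurable X]setTI; exact: mf.
  transitivity (\int[mu]_(p in @fst (R * R) R @^-1` D) (u p * \1_C (x3 p))%:E)%E.
    rewrite [RHS]integral_indic_mul//.
    by apply: eq_integral => p _; rewrite -mulrA [\1_D _ * _]mulrC mulrA.
  apply: (@vanishing_density_dynkin _ _ _ mu _ _ _ _ (fun p => u p * \1_C (x3 p))
    iC mf (measurable_prod_measurableType _ _) (recI _ _ _ _ (@mI _ _) (@mI _ _))) => //.
  - apply: e0 => //; rewrite -(step3 setT setT C)//.
    by apply: eq_Rintegral => p _; rewrite !indicT !mulr1.
  - move=> _ [A mA [B mB <-]]; rewrite integral_indic_mul; last first.
      by rewrite -[X in measurable X]setTI; apply: mf => //; exact: measurableX.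
    apply: etrans (e0 _ _ (step3 A B C mA mB mC)).
      apply: eq_integral => p _; congr EFin; rewrite !indicE.
      rewrite (_ : (p \in _) = (x1 p \in A) && (x2 p \in B)).
        by case: (_ \in A); case: (_ \in B) => /=; rewrite ?(mulr0, mulr1, mul0r).
      by apply/idP/andP; rewrite !inE.
    by apply: (imul _ (@x3 R @^-1` C)); [exact: iAB | exact: mpre].
have u_null : ae_eq mu setT (EFin \o u) (cst 0%E).
  apply: integral_ae_eq => // D _ mD; rewrite integral0.
  have mid : measurable_fun setT (@id R3) by exact: measurable_id.
  apply: (@vanishing_density_dynkin _ _ _ mu _ _ _ _ u
    iu mid (measurable_prod_measurableType _ _) (recI _ _ _ _ (@mI _ _) (@mI _ _))) => //.
  - apply: etrans (step4 setT setT measurableT measurableT).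
    by apply: eq_integral => p _; rewrite !indicT !mulr1.
  - move=> _ [A mA [B mB <-]]; rewrite integral_indic_mul; last first.
      by rewrite preimage_id; exact: measurableX.
    apply: etrans (step4 A B mA mB).
    apply: eq_integral => p _; congr EFin; rewrite !indicE.
    rewrite (_ : (p \in _) = (p.1 \in A) && (x3 p \in B)).
      by case: (_ \in A); case: (_ \in B) => /=; rewrite ?(mulr0, mulr1, mul0r).
    by apply/idP/andP; rewrite !inE.
near=> p.
have <- : u p = v p by near: p.
suff [->] : EFin (u p) = 0%E by [].
by near: p; apply: filterS u_null => q /(_ I).
Unshelve. all: by end_near.
Qed.

End moment_problem3.

(** * Integrands that agree off a null set *)

Section null_set_integral.
Context {d : measure_display} {T : measurableType d} {R : realType}.
Variable mu : {measure set T -> \bar R}.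
Variable S : set T.
Hypotheses (mS : measurable S) (S0 : mu (~` S) = 0%E).
Import HBNNSimple.

Lemma sintegral_proj (h : {nnsfun T >-> R}) :
  sintegral mu (proj_nnsfun h mS) = sintegral mu h.
Proof.
apply: eq_fsbigr => x _.
have [->|x0] := eqVneq x 0; first by rewrite !mul0e.
congr (_ * _)%E.
have mh : measurable (h @^-1` [set x]) by [].
have -> : proj_nnsfun h mS @^-1` [set x] = h @^-1` [set x] `&` S.
  apply/seteqP; split => t /=; rewrite mindicE.
    have [tS|_] := boolP (t \in S); first by rewrite mulr1 => ->; split => //; rewrite inE in tS.
    by rewrite mulr0 => /esym/eqP; rewrite (negbTE x0).
  by move=> [-> tS]; rewrite mem_set ?mulr1.
rewrite -[in RHS](setIT (h @^-1` [set x])) -(setUv S) setIUr measureU//.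
- rewrite [X in (_ + X)%E](_ : _ = 0%E) ?adde0//; apply/eqP.
  rewrite eq_le measure_ge0 andbT -S0; apply: le_measure; rewrite ?inE//.
    by apply: measurableI => //; exact: measurableC.
  exact: measurableC.
- exact: measurableI.
- by apply: measurableI => //; exact: measurableC.
- by rewrite setIACA setICr setI0.
Qed.

Let nnint_le (f g : T -> \bar R) : (forall x, (0 <= g x)%E) ->
  (forall x, S x -> f x = g x) ->
  (ereal_sup [set sintegral mu h | h in [set h : {nnsfun T >-> R} | forall x, ((h x)%:E <= f x)%E]]
   <= ereal_sup [set sintegral mu h | h in [set h : {nnsfun T >-> R} | forall x, ((h x)%:E <= g x)%E]])%E.
Proof.
move=> g0 fg; apply: ge_ereal_sup => _ [h hf <-].
apply: ereal_sup_ubound; exists (proj_nnsfun h mS); last exact: sintegral_proj.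
move=> x /=; rewrite mindicE; have [xS|_] := boolP (x \in S).
  by rewrite mulr1 -fg ?hf//; rewrite inE in xS.
by rewrite mulr0.
Qed.

(** The integral is a supremum over simple functions, which may be cut off outside
    S; this covers integrands that are not known to be measurable, such as
    spherical Laplacians of radially extended functions. *)
Lemma eq_integral_null (f g : T -> \bar R) : (forall x, S x -> f x = g x) ->
  (\int[mu]_x f x = \int[mu]_x g x)%E.
Proof.
move=> fg.
have restT (h : T -> \bar R) : h \_ setT = h by apply/funext => x; rewrite /patch in_setT.
rewrite /integral !restT.
have pos x : S x -> (f^\+ x = g^\+ x)%E by move=> Sx; rewrite !funeposE fg.
have neg x : S x -> (f^\- x = g^\- x)%E by move=> Sx; rewrite !funenegE fg.
congr (_ - _)%E; apply/eqP; rewrite eq_le !nnint_le// => x Sx; by rewrite ?pos ?neg.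
Qed.

End null_set_integral.

(** * Continuously differentiable functions of three variables *)

Section C1_calculus.
Context {R : realType}.
Notation R3 := (R * R * R)%type.
Implicit Types (phi : R3 -> R) (p q : R3).

Definition d1 phi : R3 -> R := 'D_((1, 0, 0) : R3) phi.
Definition d2 phi : R3 -> R := 'D_((0, 1, 0) : R3) phi.
Definition d3 phi : R3 -> R := 'D_((0, 0, 1) : R3) phi.

Lemma R3_lin (h : R) (v q : R3) :
  h *: v + q = (h * v.1.1 + q.1.1, h * v.1.2 + q.1.2, h * v.2 + q.2).
Proof. by case: v q => [[? ?] ?] [[? ?] ?]. Qed.

Lemma is_derive_of_cvg (V : normedModType R) (f : V -> R) a v (l : R) :
  (fun h : R => h^-1 * (f (h *: v + a) - f a)) @ 0^' --> l -> is_derive a v f l.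
Proof.
move=> cl; split; last exact: cvg_lim.
by apply/cvg_ex; exists l.
Qed.

Lemma derive_cvg (V : normedModType R) (f : V -> R) a v : derivable f a v ->
  (fun h : R => h^-1 * (f (h *: v + a) - f a)) @ 0^' --> ('D_v f a : R).
Proof. by []. Qed.

Lemma d1_line phi p s : derivable phi (s, p.1.2, p.2) ((1, 0, 0) : R3) ->
  is_derive s (1 : R) (fun x => phi (x, p.1.2, p.2)) (d1 phi (s, p.1.2, p.2)).
Proof.
move=> dp; apply: is_derive_of_cvg; apply: cvg_trans (derive_cvg dp).
apply: near_eq_cvg; apply: nearW => h; congr (_ * (phi _ - _)).
by rewrite R3_lin /= !(mulr0, add0r) /GRing.scale /= !mulr1.
Qed.

Lemma d2_line phi p s : derivable phi (p.1.1, s, p.2) ((0, 1, 0) : R3) ->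
  is_derive s (1 : R) (fun x => phi (p.1.1, x, p.2)) (d2 phi (p.1.1, s, p.2)).
Proof.
move=> dp; apply: is_derive_of_cvg; apply: cvg_trans (derive_cvg dp).
apply: near_eq_cvg; apply: nearW => h; congr (_ * (phi _ - _)).
by rewrite R3_lin /= !(mulr0, add0r) /GRing.scale /= !mulr1.
Qed.

Lemma d3_line phi p s : derivable phi (p.1, s) ((0, 0, 1) : R3) ->
  is_derive s (1 : R) (fun x => phi (p.1, x)) (d3 phi (p.1, s)).
Proof.
move=> dp; apply: is_derive_of_cvg; apply: cvg_trans (derive_cvg dp).
apply: near_eq_cvg; apply: nearW => h; congr (_ * (phi _ - _)).
by rewrite R3_lin /= !(mulr0, add0r) /GRing.scale /= !mulr1 -surjective_pairing.
Qed.

Lemma mean_value_between (g g' : R -> R) (a x : R) :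
  (forall s, is_derive s (1 : R) g (g' s)) ->
  exists2 xi, `|xi - a| <= `|x - a| & g x - g a = g' xi * (x - a).
Proof.
move=> dg.
have cg (u w : R) : {within `[u, w], continuous g}.
  apply: derivable_within_continuous => s _; exact: ex_derive.
have [ax|xa] := leP a x.
  have [c] := @MVT_segment _ g g' a x ax (fun s _ => dg s) (cg _ _).
  rewrite in_itv /= => /andP[ac cx] ->; exists c => //.
  by rewrite !ger0_norm ?subr_ge0 ?lerD2r// (le_trans ac).
have [c] := @MVT_segment _ g g' x a (ltW xa) (fun s _ => dg s) (cg _ _).
rewrite in_itv /= => /andP[xc ca] e; exists c.
  rewrite !(distrC _ a) !ger0_norm ?subr_ge0 ?(ltW xa)//.
  by rewrite lerD2l lerN2.
by rewrite -opprB e -mulrN opprB.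
Qed.

(** The increment of phi is split into increments along the axes, to which the mean
    value theorem applies; continuity of the partial derivatives gives the limits.
    This is differentiability of phi in the form that the chain rule needs. *)
Lemma slopes phi p : Ck 1 phi -> exists A1 A2 A3 : R3 -> R,
  [/\ A1 q @[q --> p] --> d1 phi p, A2 q @[q --> p] --> d2 phi p,
      A3 q @[q --> p] --> d3 phi p &
      forall q, phi q - phi p = A1 q * (q.1.1 - p.1.1)
        + A2 q * (q.1.2 - p.1.2) + A3 q * (q.2 - p.2)].
Proof.
move=> [_ C1].
have D (v : R3) q : derivable phi q v by have [h _] := C1 v; exact: h.
have cD (v : R3) : continuous ('D_v phi) by have [_ []] := C1 v.
have /choice[x hx] : forall q : R3, exists xi, `|xi - p.1.1| <= `|q.1.1 - p.1.1| /\
    phi q - phi (p.1.1, q.1.2, q.2) = d1 phi (xi, q.1.2, q.2) * (q.1.1 - p.1.1).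
  move=> q; have [xi h1 h2] := @mean_value_between (fun s => phi (s, q.1.2, q.2)) _ p.1.1 q.1.1
    (fun s => @d1_line phi q s (D _ _)).
  by exists xi; split => //; rewrite -h2; case: q {h1 h2} => -[].
have /choice[y hy] : forall q : R3, exists xi, `|xi - p.1.2| <= `|q.1.2 - p.1.2| /\
    phi (p.1.1, q.1.2, q.2) - phi (p.1.1, p.1.2, q.2) =
    d2 phi (p.1.1, xi, q.2) * (q.1.2 - p.1.2).
  move=> q; have [xi h1 h2] := @mean_value_between (fun s => phi (p.1.1, s, q.2)) _ p.1.2 q.1.2
    (fun s => @d2_line phi (p.1.1, s, q.2) s (D _ _)).
  by exists xi.
have /choice[z hz] : forall q : R3, exists xi, `|xi - p.2| <= `|q.2 - p.2| /\
    phi (p.1.1, p.1.2, q.2) - phi p = d3 phi (p.1, xi) * (q.2 - p.2).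
  move=> q; have [xi h1 h2] := @mean_value_between (fun s => phi (p.1, s)) _ p.2 q.2
    (fun s => @d3_line phi p s (D _ _)).
  by exists xi; split => //; rewrite -h2 -!surjective_pairing.
have c11 : q.1.1 @[q --> p] --> p.1.1.
  by apply: (continuous_comp (f := fst)); [exact: cvg_fst|exact: cvg_fst].
have c12 : q.1.2 @[q --> p] --> p.1.2.
  by apply: (continuous_comp (f := fst)); [exact: cvg_fst|exact: cvg_snd].
have c2 : q.2 @[q --> p] --> p.2 by exact: cvg_snd.
have sq (f : R3 -> R) (u : R3 -> R) l : u q @[q --> p] --> l ->
    (forall q, `|f q - l| <= `|u q - l|) -> f q @[q --> p] --> l.
  move=> ul fu; apply/cvgrPdist_le => e e0; move/cvgrPdist_le : ul => /(_ e e0).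
  by apply: filterS => q h; rewrite distrC (le_trans (fu q))// distrC.
have pE : p = (p.1.1, p.1.2, p.2) by rewrite -!surjective_pairing.
exists (fun q => d1 phi (x q, q.1.2, q.2)), (fun q => d2 phi (p.1.1, y q, q.2)),
  (fun q => d3 phi (p.1, z q)).
split.
- have cx : (fun q => (x q, q.1.2, q.2)) @ p --> (p.1.1, p.1.2, p.2).
    have h : x q @[q --> p] --> p.1.1.
      by apply: (sq _ (fun q => q.1.1)) => // q; have [] := hx q.
    exact: (cvg_pair (cvg_pair h c12) c2).
  by rewrite -pE in cx; apply: (cvg_comp _ _ cx); exact: cD.
- have cy : (fun q => (p.1.1, y q, q.2)) @ p --> (p.1.1, p.1.2, p.2).
    have h : y q @[q --> p] --> p.1.2.
      by apply: (sq _ (fun q => q.1.2)) => // q; have [] := hy q.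
    exact: (cvg_pair (cvg_pair (cvg_cst p.1.1) h) c2).
  by rewrite -pE in cy; apply: (cvg_comp _ _ cy); exact: cD.
- have cz : (fun q => (p.1, z q)) @ p --> (p.1, p.2).
    have h : z q @[q --> p] --> p.2.
      by apply: (sq _ (fun q => q.2)) => // q; have [] := hz q.
    exact: (cvg_pair (cvg_cst p.1) h).
  by rewrite -surjective_pairing in cz; apply: (cvg_comp _ _ cz); exact: cD.
- move=> q; have [_ <-] := hx q; have [_ <-] := hy q; have [_ <-] := hz q.
  ring.
Qed.

Lemma chain_rule phi (g1 g2 g3 : R -> R) (t l1 l2 l3 : R) : Ck 1 phi ->
  is_derive t (1 : R) g1 l1 -> is_derive t (1 : R) g2 l2 -> is_derive t (1 : R) g3 l3 ->
  let p := (g1 t, g2 t, g3 t) in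
  is_derive t (1 : R) (fun s => phi (g1 s, g2 s, g3 s))
    (d1 phi p * l1 + d2 phi p * l2 + d3 phi p * l3).
Proof.
move=> C1 dg1 dg2 dg3 p.
have [A1 [A2 [A3 [h1 h2 h3 hA]]]] := slopes p C1.
have quo (g : R -> R) l : is_derive t (1 : R) g l ->
    h^-1 * (g (h *: (1 : R) + t) - g t) @[h --> 0^'] --> l.
  by move=> [dg <-]; exact: derive_cvg.
have cg (g : R -> R) l : is_derive t (1 : R) g l ->
    g (h *: (1 : R) + t) @[h --> (0 : R)^'] --> g t.
  move=> [dg _]; have /differentiable_continuous cgt : differentiable g t by exact/derivable1_diffP.
  apply: (@cvg_comp _ _ _ (fun h : R => h *: (1 : R) + t) g _ (nbhs t)) => //.
  have : (fun h : R => h *: (1 : R) + t) @ (0 : R) --> (0 : R) *: (1 : R) + t.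
    by apply: cvgD; [apply: cvgZl; exact: cvg_id | exact: cvg_cst].
  rewrite scale0r add0r; apply: cvg_trans; apply: cvg_app; exact: cvg_within.
have cgam : (g1 (h *: (1 : R) + t), g2 (h *: (1 : R) + t), g3 (h *: (1 : R) + t)) @[h --> (0 : R)^'] --> p.
  exact: (cvg_pair (cvg_pair (cg _ _ dg1) (cg _ _ dg2)) (cg _ _ dg3)).
apply: is_derive_of_cvg.
have F0 : Filter ((0 : R)^') by exact: dnbhs_filter.
have k1 := @cvgM _ _ _ F0 _ _ _ _ (cvg_comp _ _ cgam h1) (quo _ _ dg1).
have k2 := @cvgM _ _ _ F0 _ _ _ _ (cvg_comp _ _ cgam h2) (quo _ _ dg2).
have k3 := @cvgM _ _ _ F0 _ _ _ _ (cvg_comp _ _ cgam h3) (quo _ _ dg3).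
have k := @cvgD _ _ _ _ F0 _ _ _ _ (@cvgD _ _ _ _ F0 _ _ _ _ k1 k2) k3.
apply: cvg_trans k; apply: near_eq_cvg; apply: nearW => h.
by rewrite hA /= !fctE /=; ring.
Qed.

Lemma is_derive_affine (a c t : R) : is_derive t (1 : R) (fun s => a + s * c) c.
Proof.
apply: is_derive_of_cvg; apply: cvg_near_cst; apply: filterS (nbhs_dnbhs_neq (0 : R)).
move=> h h0; rewrite /GRing.scale /=; field; exact: h0.
Qed.

End C1_calculus.

(** * Rotation fields *)

Section smooth_functions.
Context {R : realType}.
Notation R3 := (R * R * R)%type.
Implicit Types (f g phi : R3 -> R) (p q v : R3).

Lemma Ck_continuous k phi : Ck k phi -> continuous phi.
Proof. by case: k => [|k] []. Qed.

Lemma Ck_derivable k phi p v : Ck k.+1 phi -> derivable phi p v.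
Proof. by move=> [_ /(_ v) []]. Qed.

Lemma Ck_derive k phi v : Ck k.+1 phi -> Ck k ('D_v phi).
Proof. by move=> [_ /(_ v) []]. Qed.

Lemma Ck_pred k phi : Ck k.+1 phi -> Ck k phi.
Proof.
elim: k phi => [|k ih] phi; first by case.
by move=> [c h]; split => // v; have [h1 h2] := h v; split => //; exact: ih.
Qed.

Lemma eq_Ck k f g : f = g -> Ck k f -> Ck k g. Proof. by move=> ->. Qed.

Lemma derive_cst_fun v (c : R) : 'D_v (fun=> c : R) = (fun=> 0) :> (R3 -> R).
Proof. by apply/funext => p; exact: derive_cst. Qed.

Lemma Ck_cst k (c : R) : Ck k ((fun=> c) : R3 -> R).
Proof.
elim: k c => [|k ih] c; first by split => // p; exact: cvg_cst.
split; first by move=> p; exact: cvg_cst.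
by move=> v; split; [move=> p; exact: derivable_cst | rewrite derive_cst_fun].
Qed.

Lemma derive_add v f g : (forall p, derivable f p v) -> (forall p, derivable g p v) ->
  'D_v (fun p => f p + g p) = (fun p => 'D_v f p + 'D_v g p).
Proof. by move=> df dg; apply/funext => p; exact: deriveD. Qed.

Lemma derive_mul v f g : (forall p, derivable f p v) -> (forall p, derivable g p v) ->
  'D_v (fun p => f p * g p) = (fun p => 'D_v f p * g p + f p * 'D_v g p).
Proof.
move=> df dg; apply/funext => p.
rewrite (@deriveM _ _ f g p v (df p) (dg p)) /GRing.scale /=; ring.
Qed.

Lemma CkD k f g : Ck k f -> Ck k g -> Ck k (fun p => f p + g p).
Proof.
elim: k f g => [|k ih] f g.
  by move=> [cf _] [cg _]; split => // p; apply: cvgD; [exact: cf|exact: cg].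
move=> [cf hf] [cg hg]; split; first by move=> p; apply: cvgD; [exact: cf|exact: cg].
move=> v; have [df Cf] := hf v; have [dg Cg] := hg v.
by split; [move=> p; exact: derivableD | rewrite derive_add//; exact: ih].
Qed.

Lemma CkM k f g : Ck k f -> Ck k g -> Ck k (fun p => f p * g p).
Proof.
elim: k f g => [|k ih] f g.
  by move=> [cf _] [cg _]; split => // p; apply: cvgM; [exact: cf|exact: cg].
move=> Hf Hg; have [cf hf] := Hf; have [cg hg] := Hg.
split; first by move=> p; apply: cvgM; [exact: cf|exact: cg].
move=> v; have [df Cf] := hf v; have [dg Cg] := hg v.
split; first by move=> p; exact: derivableM.
by rewrite derive_mul//; apply: CkD; apply: ih => //; exact: Ck_pred.
Qed.

Lemma is_derive_coord (c : R3 -> R) p v (l : R) :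
  (forall (h : R) (w q : R3), c (h *: w + q) = h * c w + c q) -> is_derive p v c (c v).
Proof.
move=> cl; apply: is_derive_of_cvg; apply: cvg_near_cst.
apply: filterS (nbhs_dnbhs_neq (0 : R)) => h h0.
by rewrite cl addrK mulKf.
Qed.

Lemma Ck_linear k (c : R3 -> R) : continuous c ->
  (forall (h : R) (w q : R3), c (h *: w + q) = h * c w + c q) -> Ck k c.
Proof.
move=> cc cl; case: k => [|k]; first by split.
split => // v; split.
  by move=> p; have [] := is_derive_coord p v (c v) cl.
rewrite (_ : 'D_v c = (fun=> c v)); first exact: Ck_cst.
by apply/funext => p; have [] := is_derive_coord p v (c v) cl.
Qed.

Lemma derive_linear v (c : R3 -> R) :
  (forall (h : R) (w q : R3), c (h *: w + q) = h * c w + c q) -> 'D_v c = (fun=> c v).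
Proof. by move=> cl; apply/funext => p; have [] := is_derive_coord p v (c v) cl. Qed.

Lemma x1_linear (h : R) (w q : R3) : x1 (h *: w + q) = h * x1 w + x1 q. Proof. by []. Qed.
Lemma x2_linear (h : R) (w q : R3) : x2 (h *: w + q) = h * x2 w + x2 q. Proof. by []. Qed.
Lemma x3_linear (h : R) (w q : R3) : x3 (h *: w + q) = h * x3 w + x3 q. Proof. by []. Qed.

Lemma continuous_x1 : continuous (@x1 R).
Proof. by move=> p; apply: (continuous_comp (f := fst)); exact: cvg_fst. Qed.
Lemma continuous_x2 : continuous (@x2 R).
Proof. by move=> p; apply: (continuous_comp (f := fst)); [exact: cvg_fst|exact: cvg_snd]. Qed.
Lemma continuous_x3 : continuous (@x3 R).
Proof. by move=> p; exact: cvg_snd. Qed.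

Lemma Ck_x1 k : Ck k (@x1 R). Proof. exact: (Ck_linear k continuous_x1 x1_linear). Qed.
Lemma Ck_x2 k : Ck k (@x2 R). Proof. exact: (Ck_linear k continuous_x2 x2_linear). Qed.
Lemma Ck_x3 k : Ck k (@x3 R). Proof. exact: (Ck_linear k continuous_x3 x3_linear). Qed.

Lemma CkZ k (a : R) f : Ck k f -> Ck k (fun p => a * f p).
Proof. by move=> Cf; apply: CkM => //; exact: Ck_cst. Qed.

Lemma CkN k f : Ck k f -> Ck k (fun p => - f p).
Proof. by move=> /(CkZ (-1)); apply: eq_Ck; apply/funext => p; rewrite mulN1r. Qed.

Lemma CkB k f g : Ck k f -> Ck k g -> Ck k (fun p => f p - g p).
Proof. by move=> Cf Cg; apply: CkD => //; exact: CkN. Qed.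

Lemma CkX k n f : Ck k f -> Ck k (fun p => f p ^+ n).
Proof.
move=> Cf; elim: n => [|n ih]; first exact: (Ck_cst k 1).
by apply: eq_Ck (CkM Cf ih); apply/funext => p; rewrite exprS.
Qed.

(** Generators of the rotations about the three axes. *)
Definition rotX phi p : R := x2 p * d3 phi p - x3 p * d2 phi p.
Definition rotY phi p : R := x3 p * d1 phi p - x1 p * d3 phi p.
Definition rotZ phi p : R := x1 p * d2 phi p - x2 p * d1 phi p.

Lemma Ck_rotX k phi : Ck k.+1 phi -> Ck k (rotX phi).
Proof.
by move=> C; apply: CkB; apply: CkM; (exact: Ck_x2 || exact: Ck_x3 || exact: Ck_derive).
Qed.
Lemma Ck_rotY k phi : Ck k.+1 phi -> Ck k (rotY phi).
Proof.
by move=> C; apply: CkB; apply: CkM; (exact: Ck_x1 || exact: Ck_x3 || exact: Ck_derive).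
Qed.
Lemma Ck_rotZ k phi : Ck k.+1 phi -> Ck k (rotZ phi).
Proof.
by move=> C; apply: CkB; apply: CkM; (exact: Ck_x1 || exact: Ck_x2 || exact: Ck_derive).
Qed.

Lemma derive_rot v (c c' f g : R3 -> R) p :
  (forall (h : R) (w q : R3), c (h *: w + q) = h * c w + c q) ->
  (forall (h : R) (w q : R3), c' (h *: w + q) = h * c' w + c' q) ->
  continuous c -> continuous c' -> Ck 1 f -> Ck 1 g ->
  'D_v (fun q => c q * f q - c' q * g q) p =
  c v * f p + c p * 'D_v f p - (c' v * g p + c' p * 'D_v g p).
Proof.
move=> cl cl' cc cc' Cf Cg.
have D (h : R3 -> R) : Ck 1 h -> forall q, derivable h q v by move=> Ch q; exact: Ck_derivable Ch.
have Cc := Ck_linear 1 cc cl; have Cc' := Ck_linear 1 cc' cl'.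
have D1 := D _ (CkM Cc Cf); have D2 := D _ (CkM Cc' Cg).
have -> : 'D_v (fun q => c q * f q - c' q * g q) p =
    'D_v (fun q => c q * f q) p - 'D_v (fun q => c' q * g q) p by exact: deriveB.
have mulE (u w : R3 -> R) : Ck 1 u -> Ck 1 w -> 'D_v (fun q => u q * w q) p =
    'D_v u p * w p + u p * 'D_v w p.
  by move=> Cu Cw; have /(congr1 (@^~ p)) := derive_mul (D _ Cu) (D _ Cw).
rewrite !mulE//.
by have /(congr1 (@^~ p)) -> := derive_linear v cl; have /(congr1 (@^~ p)) -> := derive_linear v cl'.
Qed.

(** On the sphere, the trace of the Hessian over tangent directions minus twice the
    radial derivative. *)
Definition lapS phi p : R :=
    d1 (d1 phi) p + d2 (d2 phi) p + d3 (d3 phi) p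
  - (x1 p * (x1 p * d1 (d1 phi) p + x2 p * d2 (d1 phi) p + x3 p * d3 (d1 phi) p)
   + x2 p * (x1 p * d1 (d2 phi) p + x2 p * d2 (d2 phi) p + x3 p * d3 (d2 phi) p)
   + x3 p * (x1 p * d1 (d3 phi) p + x2 p * d2 (d3 phi) p + x3 p * d3 (d3 phi) p))
  - 2 * (x1 p * d1 phi p + x2 p * d2 phi p + x3 p * d3 phi p).

Definition on_sphere p := x1 p ^+ 2 + x2 p ^+ 2 + x3 p ^+ 2 = 1.

(** The terms of the sum of squares involve the position only through
    |p|^2 Laplacian - (p . grad)^2 - p . grad, and |p| = 1. *)
Lemma rot_sum phi p : Ck 2 phi -> on_sphere p ->
  rotX (rotX phi) p + rotY (rotY phi) p + rotZ (rotZ phi) p = lapS phi p.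
Proof.
move=> C2 sp.
have C v : Ck 1 ('D_v phi) by exact: Ck_derive.
have Cd1 := C ((1, 0, 0) : R3); have Cd2 := C ((0, 1, 0) : R3); have Cd3 := C ((0, 0, 1) : R3).
have l1 := x1_linear; have l2 := x2_linear; have l3 := x3_linear.
have k1 := continuous_x1; have k2 := continuous_x2; have k3 := continuous_x3.
have EX v : 'D_v (rotX phi) p = x2 v * d3 phi p + x2 p * 'D_v (d3 phi) p
    - (x3 v * d2 phi p + x3 p * 'D_v (d2 phi) p).
  exact: (@derive_rot v (@x2 R) (@x3 R) (d3 phi) (d2 phi) p l2 l3 k2 k3 Cd3 Cd2).
have EY v : 'D_v (rotY phi) p = x3 v * d1 phi p + x3 p * 'D_v (d1 phi) p
    - (x1 v * d3 phi p + x1 p * 'D_v (d3 phi) p).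
  exact: (@derive_rot v (@x3 R) (@x1 R) (d1 phi) (d3 phi) p l3 l1 k3 k1 Cd1 Cd3).
have EZ v : 'D_v (rotZ phi) p = x1 v * d2 phi p + x1 p * 'D_v (d2 phi) p
    - (x2 v * d1 phi p + x2 p * 'D_v (d1 phi) p).
  exact: (@derive_rot v (@x1 R) (@x2 R) (d2 phi) (d1 phi) p l1 l2 k1 k2 Cd2 Cd1).
have e1X : d2 (rotX phi) p = 1 * d3 phi p + x2 p * d2 (d3 phi) p
    - (0 * d2 phi p + x3 p * d2 (d2 phi) p) := EX (0, 1, 0).
have e2X : d3 (rotX phi) p = 0 * d3 phi p + x2 p * d3 (d3 phi) p
    - (1 * d2 phi p + x3 p * d3 (d2 phi) p) := EX (0, 0, 1).
have e1Y : d1 (rotY phi) p = 0 * d1 phi p + x3 p * d1 (d1 phi) p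
    - (1 * d3 phi p + x1 p * d1 (d3 phi) p) := EY (1, 0, 0).
have e2Y : d3 (rotY phi) p = 1 * d1 phi p + x3 p * d3 (d1 phi) p
    - (0 * d3 phi p + x1 p * d3 (d3 phi) p) := EY (0, 0, 1).
have e1Z : d1 (rotZ phi) p = 1 * d2 phi p + x1 p * d1 (d2 phi) p
    - (0 * d1 phi p + x2 p * d1 (d1 phi) p) := EZ (1, 0, 0).
have e2Z : d2 (rotZ phi) p = 0 * d2 phi p + x1 p * d2 (d2 phi) p
    - (1 * d1 phi p + x2 p * d2 (d1 phi) p) := EZ (0, 1, 0).
have EXX := congr2 (fun a b => x2 p * a - x3 p * b) e2X e1X.
have EYY := congr2 (fun a b => x3 p * a - x1 p * b) e1Y e2Y.
have EZZ := congr2 (fun a b => x1 p * a - x2 p * b) e2Z e1Z.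
apply: etrans (congr2 +%R (congr2 +%R EXX EYY) EZZ) _.
rewrite /lapS {EXX EYY EZZ e1X e2X e1Y e2Y e1Z e2Z EX EY EZ}.
cbv beta; move: sp; rewrite /on_sphere.
(* opaque atoms keep the normalization from unfolding derivatives *)
generalize (d1 (d1 phi) p), (d2 (d1 phi) p), (d3 (d1 phi) p).
generalize (d1 (d2 phi) p), (d2 (d2 phi) p), (d3 (d2 phi) p).
generalize (d1 (d3 phi) p), (d2 (d3 phi) p), (d3 (d3 phi) p).
generalize (d1 phi p), (d2 phi p), (d3 phi p), (x1 p), (x2 p), (x3 p).
move=> f1 f2 f3 x y z f13 f23 f33 f12 f22 f32 f11 f21 f31 sp.
have x2E : x ^+ 2 = 1 - y ^+ 2 - z ^+ 2 by rewrite -sp; ring.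
ring: x2E.
Qed.

End smooth_functions.

(** * The spherical Laplacian in Euclidean derivatives *)

Section sphere_operators.
Context {R : realType}.
Notation R3 := (R * R * R)%type.
Implicit Types (phi : R3 -> R) (p q v : R3).

Lemma is_derive_prod (f g : R -> R) (t df dg : R) : is_derive t (1 : R) f df ->
  is_derive t (1 : R) g dg -> is_derive t (1 : R) (fun s => f s * g s) (df * g t + f t * dg).
Proof.
move=> hf hg; apply: (@is_derive_eq _ _ _ _ _ _ _ _ (is_deriveM hf hg)).
by rewrite /GRing.scale /=; ring.
Qed.

Lemma is_derive_add (f g : R -> R) (t df dg : R) : is_derive t (1 : R) f df ->
  is_derive t (1 : R) g dg -> is_derive t (1 : R) (fun s => f s + g s) (df + dg).
Proof. exact: is_deriveD. Qed.

Lemma is_derive_sub (f g : R -> R) (t df dg : R) : is_derive t (1 : R) f df ->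
  is_derive t (1 : R) g dg -> is_derive t (1 : R) (fun s => f s - g s) (df - dg).
Proof. exact: is_deriveB. Qed.

Lemma is_derive_const (c t : R) : is_derive t (1 : R) (fun=> c) 0.
Proof. exact: is_derive_cst. Qed.

Lemma is_derive_value (f : R -> R) (t l l' : R) : l = l' ->
  is_derive t (1 : R) f l -> is_derive t (1 : R) f l'.
Proof. by move=> ->. Qed.

Lemma is_derive_rot (t a b : R) :
  is_derive t (1 : R) (fun s => cos s * a - sin s * b) (- sin t * a - cos t * b).
Proof.
apply: is_derive_value (is_derive_sub
  (is_derive_prod (is_derive_cos t) (is_derive_const a t))
  (is_derive_prod (is_derive_sin t) (is_derive_const b t))).
by rewrite /= !mulr0 !addr0.
Qed.

Lemma is_derive_rot' (t a b : R) :
  is_derive t (1 : R) (fun s => sin s * a + cos s * b) (cos t * a - sin t * b).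
Proof.
apply: is_derive_value (is_derive_add
  (is_derive_prod (is_derive_sin t) (is_derive_const a t))
  (is_derive_prod (is_derive_cos t) (is_derive_const b t))).
by rewrite /= !mulr0 !addr0 mulNr.
Qed.

Lemma X3_rotZ phi p : Ck 1 phi -> X3 phi p = rotZ phi p.
Proof.
move=> C1; rewrite /X3 derive1E /rot3.
have := chain_rule C1 (is_derive_rot 0 (x1 p) (x2 p)) (is_derive_rot' 0 (x1 p) (x2 p))
  (is_derive_const (x3 p) 0).
rewrite /= cos0 sin0 !mul0r !mul1r !subr0 !add0r oppr0 mul0r -!surjective_pairing => -[_ ->].
by rewrite /rotZ; ring.
Qed.

Definition nsq p : R := x1 p ^+ 2 + x2 p ^+ 2 + x3 p ^+ 2.

(* the inverse norm along the line p + s v *)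
Let rho p v (s : R) : R := (Num.sqrt (nsq (p + s *: v)))^-1.
(* half of the derivative of the squared norm along that line *)
Let mu p v (s : R) : R := x1 (p + s *: v) * x1 v + x2 (p + s *: v) * x2 v + x3 (p + s *: v) * x3 v.

Let is_derive_rho p v s : 0 < nsq (p + s *: v) ->
  is_derive s (1 : R) (rho p v) (- (mu p v s * rho p v s ^+ 3)).
Proof.
move=> n0.
have aff (a c : R) : is_derive s (1 : R) (fun s => (a + s * c) ^+ 2) (2 * (a + s * c) * c).
  apply: is_derive_value (is_derive_prod (is_derive_affine a c s) (is_derive_affine a c s)).
  by ring.
have dn : is_derive s (1 : R) (fun s => nsq (p + s *: v)) (2 * mu p v s).
  apply: is_derive_value (is_derive_add (is_derive_add
    (aff (x1 p) (x1 v)) (aff (x2 p) (x2 v))) (aff (x3 p) (x3 v))).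
  by rewrite /mu /x1 /x2 /x3 /= /GRing.scale /=; ring.
have ds : is_derive s (1 : R) (fun s => Num.sqrt (nsq (p + s *: v)))
    ((2 * Num.sqrt (nsq (p + s *: v)))^-1 * (2 * mu p v s)).
  exact: (@is_derive1_comp R Num.sqrt (fun s => nsq (p + s *: v)) s _ _ (is_derive1_sqrt n0) dn).
have q0 : Num.sqrt (nsq (p + s *: v)) != 0 by rewrite sqrtr_eq0 -ltNge.
have dv := @is_deriveV R (fun s => Num.sqrt (nsq (p + s *: v))) s _ 1 q0 ds.
apply: (is_derive_value _ dv).
rewrite /GRing.scale /= /rho -exprVn.
set r := Num.sqrt _; field; exact: q0.
Qed.

(* nn and ww are the coordinate i of the normalized point of the line and its
   derivative. *)
Let nn p v (i : R3 -> R) (s : R) : R := i (p + s *: v) * rho p v s.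
Let ww p v (i : R3 -> R) (s : R) : R := i v * rho p v s - i (p + s *: v) * (mu p v s * rho p v s ^+ 3).

Let is_derive_lin (i : R3 -> R) p v s :
  (forall (h : R) (w q : R3), i (h *: w + q) = h * i w + i q) ->
  is_derive s (1 : R) (fun s => i (p + s *: v)) (i v).
Proof.
move=> il; have -> : (fun s => i (p + s *: v)) = (fun s => i p + s * i v).
  by apply/funext => t; rewrite addrC il addrC.
exact: is_derive_affine.
Qed.

Let is_derive_nn (i : R3 -> R) p v s :
  (forall (h : R) (w q : R3), i (h *: w + q) = h * i w + i q) -> 0 < nsq (p + s *: v) ->
  is_derive s (1 : R) (nn p v i) (ww p v i s).
Proof.
move=> il n0.
apply: is_derive_value (is_derive_prod (is_derive_lin p v s il) (is_derive_rho n0)).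
by rewrite /ww; ring.
Qed.

Let is_derive_mu p v s : is_derive s (1 : R) (mu p v) (nsq v).
Proof.
have c (i : R3 -> R) : (forall (h : R) (w q : R3), i (h *: w + q) = h * i w + i q) ->
    is_derive s (1 : R) (fun s => i (p + s *: v) * i v) (i v ^+ 2).
  move=> il; apply: is_derive_value (is_derive_prod (is_derive_lin p v s il) (is_derive_const (i v) s)).
  by ring.
apply: is_derive_value (is_derive_add (is_derive_add (c _ x1_linear) (c _ x2_linear)) (c _ x3_linear)).
by [].
Qed.

Let is_derive_ww (i : R3 -> R) p v : (forall (h : R) (w q : R3), i (h *: w + q) = h * i w + i q) ->
  nsq p = 1 -> let m := x1 p * x1 v + x2 p * x2 v + x3 p * x3 v in
  is_derive (0 : R) (1 : R) (ww p v i)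
    (- 2 * i v * m - i p * nsq v + 3 * i p * m ^+ 2).
Proof.
move=> il p1 m.
have p0 : p + (0 : R) *: v = p by rewrite scale0r addr0.
have n0 : 0 < nsq (p + (0 : R) *: v) by rewrite p0 p1.
have dr := is_derive_rho n0.
have d3' := is_derive_prod (is_derive_prod dr dr) dr.
have := is_derive_sub (is_derive_prod (is_derive_const (i v) 0) dr)
  (is_derive_prod (is_derive_lin p v 0 il) (is_derive_prod (is_derive_mu p v 0) d3')).
have r0 : rho p v 0 = 1 by rewrite /rho p0 p1 sqrtr1 invr1.
have m0 : mu p v 0 = m by rewrite /mu p0.
rewrite r0 m0 p0 => h.
have -> : ww p v i = (fun s => i v * rho p v s - i (p + s *: v) *
    (mu p v s * (rho p v s * rho p v s * rho p v s))).
  by apply/funext => s; rewrite /ww; congr (_ - _ * (_ * _)); ring.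
by apply: is_derive_value h; ring.
Qed.

Let radial_line phi p v s : radial_ext phi (p + s *: v) =
  phi (nn p v (@x1 R) s, nn p v (@x2 R) s, nn p v (@x3 R) s).
Proof. by []. Qed.

Let derive_radial phi p v s : Ck 1 phi -> 0 < nsq (p + s *: v) ->
  let n := (nn p v (@x1 R) s, nn p v (@x2 R) s, nn p v (@x3 R) s) in
  'D_v (radial_ext phi) (p + s *: v) =
  d1 phi n * ww p v (@x1 R) s + d2 phi n * ww p v (@x2 R) s + d3 phi n * ww p v (@x3 R) s.
Proof.
move=> C1 n0 n.
have [_ <-] := chain_rule C1 (is_derive_nn x1_linear n0) (is_derive_nn x2_linear n0)
  (is_derive_nn x3_linear n0).
rewrite /derive.
suff -> : (fun h : R => h^-1 *: ((radial_ext phi \o shift (p + s *: v)) (h *: v)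
    - radial_ext phi (p + s *: v))) =
  (fun h : R => h^-1 *: (((fun s => phi (nn p v (@x1 R) s, nn p v (@x2 R) s, nn p v (@x3 R) s))
    \o shift s) (h *: (1 : R)) - phi (nn p v (@x1 R) s, nn p v (@x2 R) s, nn p v (@x3 R) s))) by [].
apply/funext => h /=; rewrite -!radial_line.
congr (_ *: (radial_ext phi _ - _)).
by rewrite addrCA -scalerDl /GRing.scale /= mulr1.
Qed.

(** Along the line p + s v the radial extension is phi at the normalized point, a
    curve with velocity t, the tangential part of v, and acceleration w at s = 0. *)
Lemma derive2_radial phi p v : Ck 2 phi -> nsq p = 1 ->
  let m := x1 p * x1 v + x2 p * x2 v + x3 p * x3 v in
  let t i := i v - i p * m in let w i := - 2 * i v * m - i p * nsq v + 3 * i p * m ^+ 2 in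
  'D_v ('D_v (radial_ext phi)) p =
    (d1 (d1 phi) p * t (@x1 R) + d2 (d1 phi) p * t (@x2 R) + d3 (d1 phi) p * t (@x3 R)) * t (@x1 R)
  + (d1 (d2 phi) p * t (@x1 R) + d2 (d2 phi) p * t (@x2 R) + d3 (d2 phi) p * t (@x3 R)) * t (@x2 R)
  + (d1 (d3 phi) p * t (@x1 R) + d2 (d3 phi) p * t (@x2 R) + d3 (d3 phi) p * t (@x3 R)) * t (@x3 R)
  + d1 phi p * w (@x1 R) + d2 phi p * w (@x2 R) + d3 phi p * w (@x3 R).
Proof.
move=> C2 p1 m t w.
have C1 := Ck_pred C2.
have p0 : p + (0 : R) *: v = p by rewrite scale0r addr0.
have n0 : 0 < nsq (p + (0 : R) *: v) by rewrite p0 p1.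
have rho0 : rho p v 0 = 1 by rewrite /rho p0 p1 sqrtr1 invr1.
have mu0 : mu p v 0 = m by rewrite /mu p0.
have nn0 i : nn p v i 0 = i p by rewrite /nn p0 rho0 mulr1.
have ww0 i : ww p v i 0 = t i by rewrite /ww p0 rho0 mu0 expr1n !mulr1.
pose n s := (nn p v (@x1 R) s, nn p v (@x2 R) s, nn p v (@x3 R) s).
have np : n 0 = p by rewrite /n !nn0 /x1 /x2 /x3 -!surjective_pairing.
pose F s := d1 phi (n s) * ww p v (@x1 R) s + d2 phi (n s) * ww p v (@x2 R) s
  + d3 phi (n s) * ww p v (@x3 R) s.
have near_F : \forall s \near (0 : R), 'D_v (radial_ext phi) (p + s *: v) = F s.
  have dn : is_derive (0 : R) (1 : R) (fun s => nsq (p + s *: v)) (2 * mu p v 0).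
    have sq (i : R3 -> R) : (forall (h : R) (w q : R3), i (h *: w + q) = h * i w + i q) ->
        is_derive (0 : R) (1 : R) (fun s => i (p + s *: v) ^+ 2) (2 * (i (p + (0 : R) *: v) * i v)).
      move=> il; apply: is_derive_value (is_derive_prod (is_derive_lin p v 0 il) (is_derive_lin p v 0 il)).
      by ring.
    apply: is_derive_value (is_derive_add (is_derive_add (sq _ x1_linear) (sq _ x2_linear)) (sq _ x3_linear)).
    by rewrite /mu; ring.
  have cn : nsq (p + s *: v) @[s --> (0 : R)] --> nsq (p + (0 : R) *: v).
    have /differentiable_continuous : differentiable (fun s : R => nsq (p + s *: v)) 0.
      by apply/derivable1_diffP; exact: ex_derive.
    exact.
  have : \forall s \near (0 : R), 0 < nsq (p + s *: v) by exact: (cvgr_gt _ cn).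
  by apply: filterS => s ns; exact: derive_radial.
have chain (f : R3 -> R) : Ck 1 f -> is_derive (0 : R) (1 : R) (fun s => f (n s))
    (d1 f p * t (@x1 R) + d2 f p * t (@x2 R) + d3 f p * t (@x3 R)).
  move=> Cf; have := chain_rule Cf (is_derive_nn x1_linear n0) (is_derive_nn x2_linear n0)
    (is_derive_nn x3_linear n0).
  by rewrite /= -/(n 0) np !ww0.
have Cd u : Ck 1 ('D_u phi) by exact: Ck_derive.
have dF := is_derive_add (is_derive_add
  (is_derive_prod (chain _ (Cd (1, 0, 0))) (is_derive_ww v x1_linear p1))
  (is_derive_prod (chain _ (Cd (0, 1, 0))) (is_derive_ww v x2_linear p1)))
  (is_derive_prod (chain _ (Cd (0, 0, 1))) (is_derive_ww v x3_linear p1)).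
rewrite np !ww0 in dF.
have [dF1 dF2] := dF.
have Fcvg := derive_cvg dF1; rewrite dF2 in Fcvg.
have gcvg : (fun h : R => h^-1 * ('D_v (radial_ext phi) (h *: v + p) - 'D_v (radial_ext phi) p)) @ 0^' -->
   (d1 (d1 phi) p * t (@x1 R) + d2 (d1 phi) p * t (@x2 R) + d3 (d1 phi) p * t (@x3 R)) * t (@x1 R)
   + d1 phi p * w (@x1 R) +
   ((d1 (d2 phi) p * t (@x1 R) + d2 (d2 phi) p * t (@x2 R) + d3 (d2 phi) p * t (@x3 R)) * t (@x2 R)
   + d2 phi p * w (@x2 R)) +
   ((d1 (d3 phi) p * t (@x1 R) + d2 (d3 phi) p * t (@x2 R) + d3 (d3 phi) p * t (@x3 R)) * t (@x3 R)
   + d3 phi p * w (@x3 R)).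
  apply: cvg_trans Fcvg; apply: near_eq_cvg.
  have near_F' : \forall s \near (0 : R)^', 'D_v (radial_ext phi) (p + s *: v) = F s.
    exact: cvg_within near_F.
  apply: filterS near_F' => h hF.
  have F0 : 'D_v (radial_ext phi) p = F 0 by rewrite -(nbhs_singleton near_F) p0.
  rewrite F0 [h *: v + p]addrC hF.
  by rewrite [h *: (1 : R) + 0]addr0 /GRing.scale /= mulr1.
have [_ gval] := @is_derive_of_cvg R _ ('D_v (radial_ext phi)) p v _ gcvg.
apply: (etrans gval); clear.
generalize (d1 (d1 phi) p), (d2 (d1 phi) p), (d3 (d1 phi) p).
generalize (d1 (d2 phi) p), (d2 (d2 phi) p), (d3 (d2 phi) p).
generalize (d1 (d3 phi) p), (d2 (d3 phi) p), (d3 (d3 phi) p).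
generalize (d1 phi p), (d2 phi p), (d3 phi p), (t (@x1 R)), (t (@x2 R)), (t (@x3 R)).
generalize (w (@x1 R)), (w (@x2 R)), (w (@x3 R)).
by move=> *; ring.
Qed.

Let derive2_radial_coord phi p (a b c : R) : Ck 2 phi -> nsq p = 1 ->
  let m := x1 p * a + x2 p * b + x3 p * c in
  let t1 := a - x1 p * m in let t2 := b - x2 p * m in let t3 := c - x3 p * m in
  let w (i j : R) := - 2 * i * m - j * (a ^+ 2 + b ^+ 2 + c ^+ 2) + 3 * j * m ^+ 2 in
  'D_((a, b, c) : R3) ('D_((a, b, c) : R3) (radial_ext phi)) p =
    (d1 (d1 phi) p * t1 + d2 (d1 phi) p * t2 + d3 (d1 phi) p * t3) * t1
  + (d1 (d2 phi) p * t1 + d2 (d2 phi) p * t2 + d3 (d2 phi) p * t3) * t2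
  + (d1 (d3 phi) p * t1 + d2 (d3 phi) p * t2 + d3 (d3 phi) p * t3) * t3
  + d1 phi p * w a (x1 p) + d2 phi p * w b (x2 p) + d3 phi p * w c (x3 p).
Proof. exact: (@derive2_radial phi p ((a, b, c) : R3)). Qed.

Lemma sphere_laplacianE phi p : Ck 2 phi -> on_sphere p -> sphere_laplacian phi p = lapS phi p.
Proof.
move=> C2 sp.
apply: (etrans (congr2 +%R (congr2 +%R (derive2_radial_coord 1 0 0 C2 sp)
  (derive2_radial_coord 0 1 0 C2 sp)) (derive2_radial_coord 0 0 1 C2 sp))).
rewrite /lapS; cbv zeta beta; move: sp; rewrite /on_sphere.
generalize (d1 (d1 phi) p), (d2 (d1 phi) p), (d3 (d1 phi) p).
generalize (d1 (d2 phi) p), (d2 (d2 phi) p), (d3 (d2 phi) p).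
generalize (d1 (d3 phi) p), (d2 (d3 phi) p), (d3 (d3 phi) p).
generalize (d1 phi p), (d2 phi p), (d3 phi p), (x1 p), (x2 p), (x3 p).
move=> f1 f2 f3 x y z f13 f23 f33 f12 f22 f32 f11 f21 f31 sp.
have x2E : x ^+ 2 = 1 - y ^+ 2 - z ^+ 2 by rewrite -sp; ring.
ring: x2E.
Qed.

End sphere_operators.

(** * Integration over a rectangle *)

Section borel_continuous.
Context {R : realType}.
Notation R3 := (R * R * R)%type.

Let grid (n : nat) (x : R) : R := (Num.floor (n.+1%:R * x))%:~R / n.+1%:R.

Let grid_dist n x : `|x - grid n x| <= n.+1%:R^-1.
Proof.
have n0 : 0 < n.+1%:R :> R by [].
have -> : x - grid n x = (n.+1%:R * x - (Num.floor (n.+1%:R * x))%:~R) / n.+1%:R.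
  by rewrite /grid mulrBl mulrAC mulfV ?mul1r// gt_eqF.
rewrite normrM normfV (ger0_norm (ltW n0)) ler_pdivrMr// mulVf ?gt_eqF//.
have /andP[h1 h2] := floor_itv (n.+1%:R * x).
rewrite ger0_norm ?subr_ge0//; move: h2; rewrite intrD => h2; lra.
Qed.

Let cvg_grid x : grid n x @[n --> \oo] --> x.
Proof.
apply/cvgrPdist_le => e e0.
have := @cvg_harmonic R => /cvgrPdist_le /(_ e e0).
apply: filterS => n; rewrite sub0r normrN => h.
apply: le_trans (grid_dist n x) _; apply: le_trans h.
by rewrite /harmonic ler_norm.
Qed.

Let measurable_floor_fiber n (i : int) :
  measurable [set x : R | Num.floor (n.+1%:R * x) = i].
Proof.
have n0 : 0 < n.+1%:R :> R by [].
rewrite (_ : mkset _ = `[i%:~R / n.+1%:R, (i + 1)%:~R / n.+1%:R[%classic); first exact: measurable_itv.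
apply/seteqP; split => x /=; rewrite in_itv /= ler_pdivrMr// ltr_pdivlMr// ![x * _]mulrC.
  by move=> <-; exact: floor_itv.
exact: floor_def.
Qed.

(** The Borel structure of R^3 is a product sigma-algebra; f is the pointwise limit
    of functions that are constant on the countably many cells of a grid. *)
Lemma continuous_measurable_fun3 (f : R3 -> R) : continuous f -> measurable_fun setT f.
Proof.
move=> cf.
pose g n (p : R3) : int * int * int := (Num.floor (n.+1%:R * x1 p),
  Num.floor (n.+1%:R * x2 p), Num.floor (n.+1%:R * x3 p)).
pose h n (i : int * int * int) : R := f (i.1.1%:~R / n.+1%:R, i.1.2%:~R / n.+1%:R, i.2%:~R / n.+1%:R).
have m1 : measurable_fun setT (@x1 R) by apply: (measurableT_comp measurable_fst); exact: measurable_fst.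
have m2 : measurable_fun setT (@x2 R) by apply: (measurableT_comp measurable_snd); exact: measurable_fst.
have m3 : measurable_fun setT (@x3 R) by exact: measurable_snd.
have mpre (t : R3 -> R) A : measurable_fun setT t -> measurable A -> measurable (t @^-1` A).
  by move=> mt mA; rewrite -[X in measurable X]setTI; exact: mt.
apply: (@measurable_fun_cvg _ _ _ _ (fun n p => h n (g n p))) => //.
- move=> n _ Y mY; rewrite setTI.
  rewrite (_ : _ @^-1` _ = \bigcup_i [set p | g n p = i /\ Y (h n i)]); last first.
    by apply/seteqP; split => [p Yp|p [i _ [<-]]//]; exists (g n p).
  apply: countable_bigcupT_measurable; first exact: countableP.
  move=> [[i j] k]; have [Yi|nYi] := pselect (Y (h n (i, j, k))); last first.
    by rewrite (_ : mkset _ = set0)//; apply/seteqP; split => // p [].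
  rewrite (_ : mkset _ = @x1 R @^-1` [set x | Num.floor (n.+1%:R * x) = i] `&`
     (@x2 R @^-1` [set x | Num.floor (n.+1%:R * x) = j]) `&`
     (@x3 R @^-1` [set x | Num.floor (n.+1%:R * x) = k])).
    by apply: measurableI; [apply: measurableI|]; apply: mpre => //; exact: measurable_floor_fiber.
  apply/seteqP; split => p /=; first by move=> [[<- <- <-] _].
  by move=> [[q1 q2] q3]; split => //; rewrite /g q1 q2 q3.
- move=> p _; rewrite /h /g /=.
  have cp : (grid n (x1 p), grid n (x2 p), grid n (x3 p)) @[n --> \oo] --> (x1 p, x2 p, x3 p).
    exact: (cvg_pair (cvg_pair (@cvg_grid (x1 p)) (@cvg_grid (x2 p))) (@cvg_grid (x3 p))).
  rewrite /x1 /x2 /x3 -!surjective_pairing in cp.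
  by apply: (cvg_comp _ _ cp); exact: cf.
Qed.

End borel_continuous.

Section restricted_integral.

Lemma integral_mrestr d (T : measurableType d) (R : realType)
    (mu : {measure set T -> \bar R}) (D : set T) (mD : measurable D) (f : T -> \bar R) :
  (\int[mrestr mu mD]_x f x = \int[mu]_(x in D) f x)%E.
Proof.
transitivity (\int[mrestr mu mD]_x (f \_ D) x)%E.
  apply: (@eq_integral_null _ _ _ _ D mD); first by rewrite /= /mrestr setICl measure0.
  by move=> x Dx; rewrite /patch mem_set.
rewrite -integral_mkcond; apply: eq_measure_integral => A mA AD.
by rewrite /= /mrestr setIidl.
Qed.

End restricted_integral.

Section bounded_integrable.
Context d (T : measurableType d) (R : realType) (mu : {measure set T -> \bar R}).

Lemma bounded_integrable (D : set T) (f : T -> R) (C : R) : measurable D ->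
  (mu D < +oo)%E -> measurable_fun D f -> (forall x, D x -> `|f x| <= C) ->
  mu.-integrable D (EFin \o f).
Proof.
move=> mD muD mf fC; apply/integrableP; split; first exact/measurable_EFinP.
apply: (@le_lt_trans _ _ (\int[mu]_(x in D) (`|C|)%:E)%E).
  apply: ge0_le_integral => //; first by apply: measurableT_comp => //; exact/measurable_EFinP.
  by move=> x Dx; rewrite lee_fin (le_trans (fC x Dx))// ler_norm.
by rewrite integral_cst// lte_mul_pinfty.
Qed.

Lemma Rintegral_bound (D : set T) (f : T -> R) (C : R) : measurable D ->
  (mu D < +oo)%E -> measurable_fun D f -> (forall x, D x -> `|f x| <= C) ->
  `|\int[mu]_(x in D) f x| <= C * fine (mu D).
Proof.
move=> mD muD mf fC; have iF := bounded_integrable mD muD mf fC.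
apply: le_trans (le_normr_Rintegral mD iF) _.
rewrite -Rintegral_cst//; apply: le_Rintegral => //.
  exact: (integrable_norm iF).
by apply: (@bounded_integrable _ _ `|C|).
Qed.

End bounded_integrable.

Section rectangle.
Context {R : realType}.
Local Notation lam := (@lebesgue_measure R).
Notation T2 := (measurableTypeR R * measurableTypeR R)%type.

Variables (a b c d : R).
Let I : set (measurableTypeR R) := `[a, b]%classic.
Let J : set (measurableTypeR R) := `[c, d]%classic.

Let mI : measurable I. Proof. exact: measurable_itv. Qed.
Let mJ : measurable J. Proof. exact: measurable_itv. Qed.
Let mIJ : measurable (I `*` J). Proof. exact: measurableX. Qed.

Lemma lebesgue_itv_lty (x y : R) : (lam `[x, y]%classic < +oo)%E.
Proof. by rewrite lebesgue_measure_itv /=; case: ifP => _; rewrite -?EFinB ?ltry. Qed.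

Lemma rectangle_lty : ((lam \x lam)%E (I `*` J) < +oo)%E.
Proof. by rewrite product_measure1E// lte_mul_pinfty//; [rewrite ge0_fin_numE|]; rewrite ?lebesgue_itv_lty. Qed.

Variables (F : T2 -> R) (C : R).
Hypotheses (mF : measurable_fun setT F).
Hypothesis FC : forall x y, I x -> J y -> `|F (x, y)| <= C.

Lemma rectangle_integrable : (lam \x lam)%E.-integrable (I `*` J) (EFin \o F).
Proof.
apply: (bounded_integrable mIJ rectangle_lty (C := C)); first exact: measurable_funTS.
by move=> [x y] [/= Ix Jy]; exact: FC.
Qed.

Let G := (EFin \o F) \_ (I `*` J).

Let iG : (lam \x lam)%E.-integrable setT G.
Proof. exact/(integrable_mkcond _ mIJ)/rectangle_integrable. Qed.

Let mF1 x : measurable_fun setT (fun y => F (x, y)).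
Proof. by apply: measurableT_comp => //; exact: pair1_measurable. Qed.

Let mF2 y : measurable_fun setT (fun x => F (x, y)).
Proof. by apply: measurableT_comp => //; exact: pair2_measurable. Qed.

Let innerF x : I x -> (fubini_F lam G x = (\int[lam]_(y in J) F (x, y))%:E)%E.
Proof.
move=> Ix; rewrite /fubini_F /Rintegral fineK.
  rewrite [RHS]integral_mkcond; apply: eq_integral => y _.
  by rewrite /G /patch /=; congr (if _ then _ else _); apply/idP/idP; rewrite !inE //= => -[].
apply: integrable_fin_num => //; apply: (@bounded_integrable _ _ _ _ _ _ C) => //.
- exact: lebesgue_itv_lty.
- exact: measurable_funTS.
- by move=> y Jy; exact: FC.
Qed.

Let innerG y : J y -> (fubini_G lam G y = (\int[lam]_(x in I) F (x, y))%:E)%E.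
Proof.
move=> Jy; rewrite /fubini_G /Rintegral fineK.
  rewrite [RHS]integral_mkcond; apply: eq_integral => x _.
  by rewrite /G /patch /=; congr (if _ then _ else _); apply/idP/idP; rewrite !inE //= => -[].
apply: integrable_fin_num => //; apply: (@bounded_integrable _ _ _ _ _ _ C) => //.
- exact: lebesgue_itv_lty.
- exact: measurable_funTS.
- by move=> x Ix; exact: FC.
Qed.

Lemma rectangle_integral1 : \int[(lam \x lam)%E]_(q in I `*` J) F q =
  \int[lam]_(x in I) \int[lam]_(y in J) F (x, y).
Proof.
rewrite /Rintegral integral_mkcond -(integral12_prod_meas1 iG); congr fine.
rewrite [RHS]integral_mkcond; apply: eq_integral => x _; rewrite /patch.
case: ifPn => [/[!inE] Ix|]; first by rewrite innerF.
rewrite notin_setE => nIx; rewrite /fubini_F; apply: integral0_eq => y _.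
by rewrite /G /patch; case: ifPn => // /[!inE] -[].
Qed.

Lemma rectangle_integral2 : \int[(lam \x lam)%E]_(q in I `*` J) F q =
  \int[lam]_(y in J) \int[lam]_(x in I) F (x, y).
Proof.
rewrite /Rintegral integral_mkcond -(integral21_prod_meas1 iG); congr fine.
rewrite [RHS]integral_mkcond; apply: eq_integral => y _; rewrite /patch.
case: ifPn => [/[!inE] Jy|]; first by rewrite innerG.
rewrite notin_setE => nJy; rewrite /fubini_G; apply: integral0_eq => x _.
by rewrite /G /patch; case: ifPn => // /[!inE] -[].
Qed.

End rectangle.

(** * The surface measure *)

Section surface.
Context {R : realType}.
Notation R3 := (R * R * R)%type.
Local Notation lam := (@lebesgue_measure R).
Local Notation lam2 := (lam \x lam)%E.
Local Notation dS := (@surface_measure R).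
Implicit Types (f g : R3 -> R) (p : R3).

Lemma continuous_sphere_param : continuous (fun q : R * R => @sphere_param R q).
Proof.
move=> q.
have c1 : r.1 @[r --> q] --> q.1 by exact: cvg_fst.
have c2 : r.2 @[r --> q] --> q.2 by exact: cvg_snd.
have cs : Num.sqrt (1 - r.2 ^+ 2) @[r --> q] --> Num.sqrt (1 - q.2 ^+ 2).
  apply: continuous_cvg; first exact: sqrt_continuous.
  by apply: cvgB; [exact: cvg_cst | exact: cvgM].
have cc : cos r.1 @[r --> q] --> cos q.1 by apply: continuous_cvg => //; exact: continuous_cos.
have ci : sin r.1 @[r --> q] --> sin q.1 by apply: continuous_cvg => //; exact: continuous_sin.
exact: (cvg_pair (cvg_pair (cvgM cs cc) (cvgM cs ci)) c2).
Qed.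

Lemma bounded_on_chart f : continuous f ->
  exists C, forall q, sphere_chart q -> `|f (sphere_param q)| <= C.
Proof.
move=> cf.
have cK : compact (`[0, 2 * pi]%classic `*` `[-1, 1]%classic : set (R * R)).
  by apply: compact_setX; exact: segment_compact.
have cg : continuous (fun q : R * R => f (sphere_param q)).
  by move=> q; apply: (continuous_comp (@continuous_sphere_param q)); exact: cf.
have /compact_bounded [C [_ hC]] : compact ((fun q : R * R => f (sphere_param q)) @`
    (`[0, 2 * pi]%classic `*` `[-1, 1]%classic)).
  by apply: continuous_compact => //; exact: continuous_subspaceT.
exists (C + 1) => q cq; apply: (hC (C + 1)); first by rewrite ltrDl.
by exists q.
Qed.

Lemma sphere_param_on_sphere q : sphere_chart q -> on_sphere (@sphere_param R q).
Proof.
move=> [_]; rewrite /= in_itv /= => /andP[h1 h2].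
have r0 : 0 <= 1 - q.2 ^+ 2 by nra.
rewrite /on_sphere /x1 /x2 /x3 /= !exprMn sqr_sqrtr// -mulrDr cos2Dsin2; ring.
Qed.

Lemma surfaceE (A : set R3) : dS A = (lam2 ((@sphere_param R @^-1` A) `&` @sphere_chart R)).
Proof. by []. Qed.

Lemma measurable_on_sphere : measurable [set p : R3 | on_sphere p].
Proof.
have m : measurable_fun setT (fun p : R3 => x1 p ^+ 2 + x2 p ^+ 2 + x3 p ^+ 2).
  apply: continuous_measurable_fun3; apply: (@Ck_continuous _ 0).
  by apply: CkD; [apply: CkD|]; apply: CkX; [exact: Ck_x1|exact: Ck_x2|exact: Ck_x3].
rewrite (_ : mkset _ = setT `&` (fun p : R3 => x1 p ^+ 2 + x2 p ^+ 2 + x3 p ^+ 2) @^-1` [set 1]).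
  by apply: m => //; exact: measurable_set1.
by rewrite setTI.
Qed.

Lemma off_sphere_null : dS (~` [set p : R3 | on_sphere p]) = 0%E.
Proof.
rewrite surfaceE (_ : _ `&` _ = set0) ?measure0//.
by apply/seteqP; split => // q [/= nq /sphere_param_on_sphere].
Qed.

Lemma chart_lty : (lam2 (@sphere_chart R) < +oo)%E.
Proof. exact: rectangle_lty. Qed.

Lemma surface_lty : (dS setT < +oo)%E.
Proof. by rewrite surfaceE preimage_setT setTI; exact: chart_lty. Qed.

Lemma measurable_poles : measurable [set p : R3 | 1 <= `|x3 p| ].
Proof.
have m : measurable_fun setT (fun p : R3 => `|x3 p|).
  by apply: measurableT_comp => //; exact: measurable_snd.
rewrite (_ : mkset _ = setT `&` (fun p : R3 => `|x3 p|) @^-1` `[1, +oo[%classic).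
  by apply: m => //; exact: measurable_itv.
by rewrite setTI; apply/seteqP; split => p /=; rewrite in_itv /= andbT.
Qed.

Lemma poles_null : dS [set p : R3 | 1 <= `|x3 p| ] = 0%E.
Proof.
rewrite surfaceE.
have mI : measurable (`[0, 2 * pi]%classic : set (measurableTypeR R)) by exact: measurable_itv.
have mP : measurable ([set -1; 1] : set (measurableTypeR R)) by apply: measurableU; exact: measurable_set1.
rewrite (_ : _ `&` _ = `[0, 2 * pi]%classic `*` [set -1; 1]).
  rewrite product_measure1E// [X in (_ * X)%E](_ : _ = 0%E) ?mule0//.
  apply/eqP; rewrite eq_le measure_ge0 andbT.
  have l0 (x : R) : lam [set x] = 0%E by exact: lebesgue_measure_set1.
  apply: (@le_trans _ _ (lam [set (-1)%R] + lam [set 1%R])%E).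
    by apply: measureU2; exact: measurable_set1.
  by rewrite !l0 adde0.
apply/seteqP; split => -[t z] /=.
  rewrite in_itv /= => -[z1 [ht]]; rewrite /= in_itv /= => /andP[h1 h2]; split => //.
  move: z1; rewrite /x3 /= ler_normr => /orP[h|h].
    by right; apply/eqP; rewrite eq_le h2 h.
  by left; apply/eqP; rewrite eq_le h1 andbT -lerNr.
move=> [ht [->|->]]; rewrite /x3 /= ?normrN normr1 lexx; split => //; split => //=; rewrite in_itv /= ?lexx //=; lra.
Qed.

Lemma ae_on_sphere : {ae dS, forall p, on_sphere p}.
Proof.
exists (~` [set p : R3 | on_sphere p]); split => //.
  by apply: measurableC; exact: measurable_on_sphere.
exact: off_sphere_null.
Qed.

(** The measure is carried by the sphere, so that identities valid on the sphere
    only may be used under the integral without measurability conditions. *)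
Lemma surface_Rintegral_ext f g : (forall p, on_sphere p -> f p = g p) ->
  \int[dS]_p f p = \int[dS]_p g p.
Proof.
move=> fg; congr fine.
apply: (@eq_integral_null _ _ _ _ _ measurable_on_sphere off_sphere_null) => p sp.
by rewrite fg.
Qed.

Section bounded.
Variables (f : R3 -> R) (C : R).
Hypotheses (mf : measurable_fun setT f).
Hypothesis fC : forall q, sphere_chart q -> `|f (sphere_param q)| <= C.

Let mfp : measurable_fun setT (fun q => f (@sphere_param R q)).
Proof. by apply: measurableT_comp => //; exact: measurable_sphere_param. Qed.

Let i2 : lam2.-integrable (@sphere_chart R) (EFin \o (fun q => f (sphere_param q))).
Proof.
apply: (@bounded_integrable _ _ _ _ (@sphere_chart R) (fun q => f (sphere_param q)) C) => //.
- exact: measurable_sphere_chart.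
- exact: chart_lty.
- exact: measurable_funTS.
Qed.

Let i3 : (mrestr lam2 (@measurable_sphere_chart R)).-integrable setT
  (EFin \o (fun q => f (sphere_param q))).
Proof.
apply/integrableP; split; first exact/measurable_EFinP.
by rewrite integral_mrestr; case/integrableP : i2.
Qed.

Lemma surface_integrable : dS.-integrable setT (EFin \o f).
Proof.
have mef : measurable_fun setT (EFin \o f) by exact/measurable_EFinP.
exact: (@integrable_pushforward _ _ _ _ _ _ (@measurable_sphere_param R)
  (mrestr lam2 (@measurable_sphere_chart R)) setT (EFin \o f) mef i3 measurableT).
Qed.

Lemma surface_RintegralE :
  \int[dS]_p f p = \int[lam2]_(q in @sphere_chart R) f (sphere_param q).
Proof.
congr fine.
have mef : measurable_fun setT (EFin \o f) by exact/measurable_EFinP.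
apply: etrans (@integral_pushforward _ _ _ _ _ _ (@measurable_sphere_param R)
  (mrestr lam2 (@measurable_sphere_chart R)) setT (EFin \o f) mef i3 measurableT) _.
exact: integral_mrestr.
Qed.

End bounded.

Lemma surface_integrable_cont f : continuous f -> dS.-integrable setT (EFin \o f).
Proof.
move=> cf; have [C fC] := bounded_on_chart cf.
by apply: (surface_integrable (C := C)) => //; exact: continuous_measurable_fun3.
Qed.

Lemma continuous_Lfun2 f : continuous f -> f \in Lfun dS 2%:E.
Proof.
move=> cf; apply: (@Lfun2_le _ _ _ _ _ (fun p => f p ^+ 2)) => //.
  exact: continuous_measurable_fun3.
by apply: surface_integrable_cont => p; apply: cvgM; exact: cf.
Qed.

End surface.

(** * Rotation fields have integral zero *)

Section divergence.
Context {R : realType}.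
Notation R3 := (R * R * R)%type.
Local Notation lam := (@lebesgue_measure R).
Local Notation dS := (@surface_measure R).
Implicit Types (f g psi : R3 -> R) (p : R3).

Lemma FTC_C1 (F f : R -> R) (a b : R) : a < b ->
  (forall x, a <= x <= b -> is_derive x (1 : R) F (f x)) ->
  (forall x, a <= x <= b -> f y @[y --> x] --> f x) ->
  \int[lam]_(x in `[a, b]%classic) f x = F b - F a.
Proof.
move=> ab dF cf; rewrite /Rintegral (@continuous_FTC2 _ f F)//.
- by apply: continuous_in_subspaceT => x; rewrite inE /= in_itv /= => xab; exact: cf.
- have cF x : a <= x <= b -> F y @[y --> x] --> F x.
    move=> xab; have [dFx _] := dF x xab.
    have /differentiable_continuous : differentiable F x by exact/derivable1_diffP.
    exact.
  split.
  + by move=> x; rewrite in_itv /= => /andP[ax xb]; have [] := dF x; rewrite ?(ltW ax) ?(ltW xb).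
  + by apply: cvg_at_right_filter; apply: cF; rewrite lexx ltW.
  + by apply: cvg_at_left_filter; apply: cF; rewrite lexx ltW.
- move=> x; rewrite in_itv /= => /andP[ax xb]; rewrite derive1E.
  by have [] := dF x; rewrite ?(ltW ax) ?(ltW xb).
Qed.

Lemma longitude_derive psi (t z : R) : Ck 1 psi ->
  is_derive t (1 : R) (fun s => psi (sphere_param (s, z))) (rotZ psi (sphere_param (t, z))).
Proof.
move=> C1; set r := Num.sqrt (1 - z ^+ 2).
have dc : is_derive t (1 : R) (fun s => r * cos s) (- (r * sin t)).
  by apply: is_derive_value (is_derive_prod (is_derive_const r t) (is_derive_cos t)); ring.
have ds : is_derive t (1 : R) (fun s => r * sin s) (r * cos t).
  by apply: is_derive_value (is_derive_prod (is_derive_const r t) (is_derive_sin t)); ring.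
apply: is_derive_value (chain_rule C1 dc ds (is_derive_const z t)).
by rewrite /rotZ /x1 /x2 /sphere_param /= -/r; ring.
Qed.

(* minus the logarithmic derivative of the radius of the parallel at height z *)
Let k (z : R) : R := z / (1 - z ^+ 2).

Lemma latitude_radius (c z : R) : -1 < z < 1 ->
  is_derive z (1 : R) (fun s => Num.sqrt (1 - s ^+ 2) * c) (- k z * (Num.sqrt (1 - z ^+ 2) * c)).
Proof.
move=> /andP[z1 z2].
have q0 : 0 < 1 - z ^+ 2 by nra.
have dq : is_derive z (1 : R) (fun s => 1 - s * s) (- (2 * z)).
  have di : is_derive z (1 : R) (fun s : R => s) 1 by exact: is_derive_id.
  apply: is_derive_value (is_derive_sub (is_derive_const 1 z) (is_derive_prod di di)).
  by ring.
have dr : is_derive z (1 : R) (fun s => Num.sqrt (1 - s ^+ 2))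
    ((2 * Num.sqrt (1 - z ^+ 2))^-1 * (- (2 * z))).
  exact: (@is_derive1_comp R Num.sqrt (fun s => 1 - s ^+ 2) z _ _ (is_derive1_sqrt q0) dq).
apply: is_derive_value (is_derive_prod dr (is_derive_const c z)).
have rr : Num.sqrt (1 - z ^+ 2) != 0 by rewrite sqrtr_eq0 -ltNge.
have e : 1 - z ^+ 2 = Num.sqrt (1 - z ^+ 2) ^+ 2 by rewrite sqr_sqrtr// ltW.
rewrite /k [X in z / X]e; field; exact: rr.
Qed.

Lemma latitude_derive psi (t z : R) : Ck 1 psi -> -1 < z < 1 -> let p := sphere_param (t, z) in
  is_derive z (1 : R) (fun s => psi (sphere_param (t, s)))
    (- k z * (x1 p * d1 psi p + x2 p * d2 psi p) + d3 psi p).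
Proof.
move=> C1 zz p.
have di : is_derive z (1 : R) (fun s : R => s) 1 by exact: is_derive_id.
apply: is_derive_value (chain_rule C1 (latitude_radius (cos t) zz) (latitude_radius (sin t) zz) di).
by rewrite /p /x1 /x2 /sphere_param /=; ring.
Qed.

Lemma sphere_param_2pi z : @sphere_param R (2 * pi, z) = sphere_param (0, z).
Proof. by rewrite /sphere_param /= cos0 sin0 mulr_natl cos2pi sin2pi. Qed.

Lemma continuous_longitude f z : continuous f -> continuous (fun t => f (sphere_param (t, z))).
Proof.
move=> cf t; have ct : (s, z) @[s --> t] --> (t, z) by exact: (cvg_pair cvg_id (cvg_cst z)).
have cp := cvg_comp _ _ ct (@continuous_sphere_param R (t, z)).
exact: (cvg_comp _ _ cp (cf _)).
Qed.

Lemma continuous_latitude f t : continuous f -> continuous (fun z => f (sphere_param (t, z))).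
Proof.
move=> cf z; have ct : (t, s) @[s --> z] --> (t, z) by exact: (cvg_pair (cvg_cst t) cvg_id).
have cp := cvg_comp _ _ ct (@continuous_sphere_param R (t, z)).
exact: (cvg_comp _ _ cp (cf _)).
Qed.

Let pi0 : 0 < 2 * pi :> R. Proof. by rewrite mulr_gt0// pi_gt0. Qed.

(** The rotation about the axis is the derivative along the longitude, and the
    parallels are closed. *)
Lemma integral_rotZ psi : Ck 1 psi -> \int[dS]_p rotZ psi p = 0.
Proof.
move=> C1; have cZ : continuous (rotZ psi) by exact: (Ck_continuous (Ck_rotZ C1)).
have [C hC] := bounded_on_chart cZ.
have mZ : measurable_fun setT (rotZ psi) by exact: continuous_measurable_fun3.
rewrite (surface_RintegralE mZ hC).
have mP : measurable_fun setT (fun q => rotZ psi (@sphere_param R q)).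
  by apply: measurableT_comp => //; exact: measurable_sphere_param.
rewrite (rectangle_integral2 mP (C := C)); last by move=> x y Ix Jy; apply: hC; split.
rewrite (@eq_Rintegral _ _ _ _ _ (cst 0)); first by rewrite Rintegral_cst// mul0r.
move=> z _; apply: etrans (@FTC_C1 (fun t => psi (sphere_param (t, z))) _ 0 (2 * pi) pi0 _ _) _.
- by move=> t _; exact: longitude_derive.
- by move=> t _; exact: continuous_longitude.
- by rewrite sphere_param_2pi subrr.
Qed.

(** In the chart, al rotX + be rotY is the divergence of a flux whose latitude
    component h psi vanishes at the poles, while its longitude component has a
    factor z / (1 - z^2) that is singular there.  The field is therefore
    integrated over the bands |z| <= a: the longitude derivative integrates to
    zero, and the latitude component leaves boundary terms of size
    sqrt (1 - a^2). *)
Section horizontal.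
Variables (al be : R) (psi : R3 -> R).
Hypothesis C1 : Ck 1 psi.

Let X p := al * rotX psi p + be * rotY psi p.
Let h p := al * x2 p - be * x1 p.
Let g p := al * x1 p + be * x2 p.

Let Ch : Ck 1 h. Proof. by apply: CkB; apply: CkZ; [exact: Ck_x2|exact: Ck_x1]. Qed.
Let Cg : Ck 1 g. Proof. by apply: CkD; apply: CkZ; [exact: Ck_x1|exact: Ck_x2]. Qed.

Let A p := - (h p * psi p) - h p * (x1 p * d1 psi p + x2 p * d2 psi p).
Let B p := h p * d3 psi p.

Let Cd1 : Ck 0 (d1 psi). Proof. exact: Ck_derive. Qed.
Let Cd2 : Ck 0 (d2 psi). Proof. exact: Ck_derive. Qed.
Let Cd3 : Ck 0 (d3 psi). Proof. exact: Ck_derive. Qed.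

Let cX : continuous X.
Proof.
apply: (@Ck_continuous _ 0); apply: CkD; apply: CkZ.
  exact: Ck_rotX.
exact: Ck_rotY.
Qed.

Let cA : continuous A.
Proof.
apply: (@Ck_continuous _ 0); apply: CkB; [apply: CkN|]; apply: CkM; try exact: Ck_pred.
by apply: CkD; apply: CkM => //; [exact: Ck_x1|exact: Ck_x2].
Qed.

Let cB : continuous B.
Proof. by apply: (@Ck_continuous _ 0); apply: CkM => //; exact: Ck_pred. Qed.

(* the latitude derivative of h psi *)
Let G (q : measurableTypeR R * measurableTypeR R) : R :=
  k q.2 * A (sphere_param q) + B (sphere_param q).

Let latitude_hpsi (t z : R) : -1 < z < 1 ->
  is_derive z (1 : R) (fun s => h (sphere_param (t, s)) * psi (sphere_param (t, s))) (G (t, z)).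
Proof.
move=> zz.
have dh : is_derive z (1 : R) (fun s => h (sphere_param (t, s))) (- k z * h (sphere_param (t, z))).
  apply: is_derive_value (is_derive_sub
    (is_derive_prod (is_derive_const al z) (latitude_radius (sin t) zz))
    (is_derive_prod (is_derive_const be z) (latitude_radius (cos t) zz))).
  by rewrite /h /x1 /x2 /sphere_param /=; ring.
apply: is_derive_value (is_derive_prod dh (latitude_derive t C1 zz)).
by rewrite /G /A /B; ring.
Qed.

(* the longitude component of the flux *)
Let flux (t z : R) : R := - k z * (g (sphere_param (t, z)) * psi (sphere_param (t, z))).

Let longitude_flux (t z : R) : -1 < z < 1 -> is_derive t (1 : R) (fun s => flux s z)
  (X (sphere_param (t, z)) - G (t, z)).
Proof.
move=> /andP[z1 z2].
have q0 : 1 - z ^+ 2 != 0 by apply/lt0r_neq0; nra.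
have dg := is_derive_prod (longitude_derive t z Cg) (longitude_derive t z C1).
apply: is_derive_value (is_derive_prod (is_derive_const (- k z) t) dg).
have -> : rotZ g (sphere_param (t, z)) = - h (sphere_param (t, z)).
  have [_ <-] := longitude_derive t z Cg.
  set r := Num.sqrt (1 - z ^+ 2).
  have dc : is_derive t (1 : R) (fun s => r * cos s) (- (r * sin t)).
    by apply: is_derive_value (is_derive_prod (is_derive_const r t) (is_derive_cos t)); ring.
  have ds : is_derive t (1 : R) (fun s => r * sin s) (r * cos t).
    by apply: is_derive_value (is_derive_prod (is_derive_const r t) (is_derive_sin t)); ring.
  have [_] := is_derive_add (is_derive_prod (is_derive_const al t) dc)
    (is_derive_prod (is_derive_const be t) ds).
  rewrite /g /x1 /x2 /sphere_param /= -/r => ->.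
  by rewrite /h /x1 /x2 /= -/r; ring.
set p := sphere_param (t, z).
have pz : x3 p = z by [].
have rr : x1 p ^+ 2 = 1 - z ^+ 2 - x2 p ^+ 2.
  rewrite /x1 /x2 /p /sphere_param /= !exprMn sqr_sqrtr; last by nra.
  by rewrite cos2sin2; ring.
have -> : G (t, z) = k z * A p + B p by [].
rewrite /X /A /B /rotX /rotY /rotZ /g /h pz /k.
generalize (d1 psi p), (d2 psi p), (d3 psi p), (psi p) => e1 e2 e3 e4.
move: rr; generalize (x1 p), (x2 p) => x y rr.
by field: rr.
Qed.

Section band.
Variable a : R.
Hypothesis a01 : 0 < a < 1.

Let a0 : 0 < a. Proof. by case/andP: a01. Qed.
Let a1 : a < 1. Proof. by case/andP: a01. Qed.

(* the factor k, with its denominator replaced by max (1 - z^2) (1 - a^2) so as to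
   be continuous everywhere *)
Let ka (z : R) : R :=
  z / ((1 - z ^+ 2 + (1 - a ^+ 2) + `|1 - z ^+ 2 - (1 - a ^+ 2)|) / 2).

Let kaE z : `|z| <= a -> ka z = k z.
Proof.
rewrite ler_norml => /andP[z1 z2].
have h0 : 0 <= 1 - z ^+ 2 - (1 - a ^+ 2) by nra.
by rewrite /ka /k ger0_norm//; congr (_ / _); field.
Qed.

Let cka : continuous ka.
Proof.
move=> z; apply: cvgM; first exact: cvg_id.
have den : (1 - z ^+ 2 + (1 - a ^+ 2) + `|1 - z ^+ 2 - (1 - a ^+ 2)|) / 2 != 0.
  apply: lt0r_neq0; have := ler_norm (- (1 - z ^+ 2 - (1 - a ^+ 2))).
  by rewrite normrN; have := a0; have := a1; nra.
apply: cvgV => //; apply: cvgM; last exact: cvg_cst.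
have c2 : 1 - y ^+ 2 @[y --> z] --> 1 - z ^+ 2.
  by apply: cvgB; [exact: cvg_cst | apply: cvgM; exact: cvg_id].
apply: cvgD; first by apply: cvgD => //; exact: cvg_cst.
by apply: cvg_norm; apply: cvgB => //; exact: cvg_cst.
Qed.

Let Ga (q : measurableTypeR R * measurableTypeR R) : R :=
  ka q.2 * A (sphere_param q) + B (sphere_param q).

Let P := [set z : R | `|z| <= a].

Let mP : measurable P.
Proof.
rewrite (_ : P = `[- a, a]%classic); first exact: measurable_itv.
by apply/seteqP; split => z; rewrite /P /= in_itv /= ler_norml.
Qed.

Let mcomp (f : R3 -> R) : continuous f -> measurable_fun setT (fun q => f (@sphere_param R q)).
Proof.
move=> cf; apply: (measurableT_comp (continuous_measurable_fun3 cf)).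
exact: measurable_sphere_param.
Qed.

Let m1P : measurable_fun setT (fun q : measurableTypeR R * measurableTypeR R => \1_P q.2 : R).
Proof. by apply: (measurableT_comp (measurable_indic mP)); exact: measurable_snd. Qed.

Let mGa : measurable_fun setT Ga.
Proof.
apply: measurable_funD; last exact: mcomp.
apply: measurable_funM; last exact: mcomp.
by apply: (measurableT_comp (continuous_measurable_fun cka)); exact: measurable_snd.
Qed.

Let Ga_bounded : exists C, forall q, sphere_chart q -> `|Ga q| <= C.
Proof.
have [CA hA] := bounded_on_chart cA; have [CB hB] := bounded_on_chart cB.
have /compact_bounded [C [_ hC]] : compact (ka @` `[-1, 1]%classic).
  by apply: continuous_compact; [exact: continuous_subspaceT | exact: segment_compact].
exists ((C + 1) * CA + CB) => q cq; apply: le_trans (ler_normD _ _) _.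
apply: lerD; last exact: hB.
rewrite normrM ler_pM//; last exact: hA.
apply: (hC (C + 1)); first by rewrite ltrDl.
by case: cq => _ q2; exists q.2.
Qed.

Let indic_le1 (z : R) : `|\1_P z : R| <= 1.
Proof. by rewrite indicE; case: (_ \in _); rewrite ?normr1 ?normr0. Qed.

Lemma integral_rotXY_band :
  \int[dS]_p (X p * \1_P (x3 p)) =
  \int[lam]_(t in `[0, 2 * pi]%classic)
     (h (sphere_param (t, a)) * psi (sphere_param (t, a))
      - h (sphere_param (t, - a)) * psi (sphere_param (t, - a))).
Proof.
have [CX hX] := bounded_on_chart cX; have [CG hG] := Ga_bounded.
have mX1 : measurable_fun setT (fun p => X p * \1_P (x3 p)).
  apply: measurable_funM; first exact: continuous_measurable_fun3.
  by apply: (measurableT_comp (measurable_indic mP)); exact: measurable_snd.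
have bound1 (u C z : R) : `|u| <= C -> `|u * \1_P z| <= C.
  by move=> uC; rewrite normrM; apply: le_trans uC; rewrite ler_piMr.
rewrite (surface_RintegralE mX1 (C := CX)); last by move=> q cq; apply: bound1; exact: hX.
have mX2 : measurable_fun setT (fun q => X (@sphere_param R q) * \1_P q.2).
  by apply: measurable_funM => //; exact: mcomp.
have mG2 : measurable_fun setT (fun q => Ga q * \1_P q.2) by exact: measurable_funM.
have bX x y : x \in `[0, 2 * pi] -> y \in `[-1, 1] -> `|X (@sphere_param R (x, y)) * \1_P y| <= CX.
  by move=> Ix Jy; apply: bound1; apply: hX; split.
have bG x y : x \in `[0, 2 * pi] -> y \in `[-1, 1] -> `|Ga (x, y) * \1_P y| <= CG.
  by move=> Ix Jy; apply: bound1; apply: hG; split.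
rewrite (rectangle_integral2 mX2 (C := CX)); last by move=> x y Ix Jy; exact: bX.
transitivity (\int[lam]_(z in `[-1, 1]%classic)
    \int[lam]_(t in `[0, 2 * pi]%classic) (Ga (t, z) * \1_P z)).
  apply: eq_Rintegral => z _; rewrite indicE.
  have [|_] := boolP (z \in P); last first.
    by apply: eq_Rintegral => t _; rewrite /= !mulr0.
  rewrite inE /P /= => za; rewrite /=.
  have zz : -1 < z < 1 by move: za; rewrite ler_norml; have := a1; lra.
  apply/eqP; rewrite -subr_eq0.
  have ci (f : R -> R) : continuous f ->
      lam.-integrable `[0, 2 * pi]%classic (EFin \o f).
    by move=> cf; apply: continuous_compact_integrable; [exact: segment_compact | exact: continuous_subspaceT].
  have c1 : continuous (fun t => X (sphere_param (t, z))) by exact: continuous_longitude.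
  have c2 : continuous (fun t => Ga (t, z)).
    move=> t; apply: cvgD; last exact: continuous_longitude.
    by apply: cvgM; [exact: (cvg_cst (ka z)) | exact: continuous_longitude].
  rewrite (eq_Rintegral _ (g := fun t => X (sphere_param (t, z)))); last by move=> t _; rewrite mulr1.
  rewrite [X in _ - X](eq_Rintegral _ (g := fun t => Ga (t, z))); last by move=> t _; rewrite mulr1.
  rewrite -RintegralB//; [|exact: ci|exact: ci].
  apply/eqP.
  apply: etrans (@FTC_C1 (fun t => flux t z)
    (fun t => X (sphere_param (t, z)) - Ga (t, z)) 0 (2 * pi) pi0 _ _) _.
  - move=> t _; apply: is_derive_value (longitude_flux t zz).
    by rewrite /Ga kaE.
  - by move=> t _; apply: cvgB; [exact: c1 | exact: c2].
  - by rewrite /flux sphere_param_2pi subrr.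
rewrite -(rectangle_integral2 mG2 (C := CG)); last by move=> x y Ix Jy; exact: bG.
rewrite (rectangle_integral1 mG2 (C := CG)); last by move=> x y Ix Jy; exact: bG.
apply: eq_Rintegral => t _.
transitivity (\int[lam]_(z in `[- a, a]%classic) Ga (t, z)).
  rewrite [RHS](_ : _ = \int[lam]_(z in `[-1, 1]%classic `&` P) Ga (t, z)); last first.
    congr (Rintegral _ _ _); apply/seteqP; split => z; rewrite /P /= !in_itv /= ler_norml.
      by move=> /andP[h1 h2]; have := a1; split; apply/andP; split => //; lra.
    by case.
  rewrite Rintegral_mkcondr; apply: eq_Rintegral => z _.
  by rewrite /patch indicE; case: (_ \in P); rewrite ?mulr1 ?mulr0.
apply: etrans (@FTC_C1 (fun z => h (sphere_param (t, z)) * psi (sphere_param (t, z)))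
  (fun z => Ga (t, z)) (- a) a _ _ _) _.
- by have := a0; lra.
- move=> z za; have za' : `|z| <= a by rewrite ler_norml.
  rewrite /Ga kaE//; apply: latitude_hpsi; have := a1; move: za => /andP[]; lra.
- move=> z _; apply: cvgD; last exact: continuous_latitude.
  by apply: cvgM; [exact: cka | exact: continuous_latitude].
- by [].
Qed.

End band.

Lemma integral_rotXY : \int[dS]_p X p = 0.
Proof.
have [CX hX] := bounded_on_chart cX.
have [M hM] := bounded_on_chart (Ck_continuous C1).
have M0 : 0 <= M.
  apply: le_trans (hM (0, 0) _) => //; split; rewrite /= in_itv /=; have := pi0; lra.
(* the bands exhaust the sphere without the poles *)
pose a (n : nat) : R := 1 - n.+2%:R^-1.
have a01 n : 0 < a n < 1.
  rewrite /a subr_gt0 invf_lt1// ltr1n /= ltrBlDr ltrDl invr_gt0//.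
have iX : dS.-integrable setT (EFin \o X) by exact: surface_integrable_cont.
have mX : measurable_fun setT X by exact: continuous_measurable_fun3.
have mI (Q : set R) : measurable Q -> measurable_fun setT (fun p : R3 => \1_Q (x3 p) : R).
  by move=> mQ; apply: (measurableT_comp (measurable_indic mQ)); exact: measurable_snd.
have mP (c : R) : measurable [set z : R | `|z| <= c].
  rewrite (_ : mkset _ = `[- c, c]%classic); first exact: measurable_itv.
  by apply/seteqP; split => z /=; rewrite in_itv /= ler_norml.
have mP1 : measurable [set z : R | `|z| < 1].
  rewrite (_ : mkset _ = `]-1, 1[%classic); first exact: measurable_itv.
  by apply/seteqP; split => z /=; rewrite in_itv /= ltr_norml.
have ind1 (Q : set R) z : `|\1_Q z : R| <= 1.
  by rewrite indicE; case: (_ \in _); rewrite ?normr1 ?normr0.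
have -> : \int[dS]_p X p = \int[dS]_p (X p * \1_[set z : R | `|z| < 1] (x3 p)).
  congr fine; apply: (@eq_integral_null _ _ _ _ (~` [set p : R3 | 1 <= `|x3 p| ])).
  - by apply: measurableC; exact: measurable_poles.
  - by rewrite setCK; exact: poles_null.
  - by move=> p /= /negP; rewrite -ltNge => zp; rewrite indicE mem_set ?mulr1.
have [|||||_ _ lim] := @dominated_convergence _ _ _ dS setT measurableT
   (fun n p => (X p * \1_[set z : R | `|z| <= a n] (x3 p))%:E)
   (fun p => (X p * \1_[set z : R | `|z| < 1] (x3 p))%:E) (fun p => `|X p|%:E).
- by move=> n; apply/measurable_EFinP; apply: measurable_funM => //; exact: mI.
- by apply/measurable_EFinP; apply: measurable_funM => //; exact: mI.
- apply/aeW => p _; apply: cvg_EFin; first exact: nearW.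
  apply: cvgMr; rewrite !indicE.
  have [p1|p1] := ltP `|x3 p| 1.
    rewrite (mem_set (A := [set z : R | `|z| < 1])) //.
    apply: cvg_near_cst.
    have d0 : 0 < 1 - `|x3 p| by rewrite subr_gt0.
    have := near_infty_natSinv_lt (PosNum d0); apply: filterS => n /= hn.
    rewrite indicE mem_set//= /a lerBrDr -lerBrDl; apply: le_trans (ltW hn).
    by rewrite lef_pV2 ?posrE// ler_nat.
  rewrite (memNset (A := [set z : R | `|z| < 1])); last by move=> /=; apply/negP; rewrite -leNgt.
  apply: cvg_near_cst; apply: nearW => n.
  rewrite indicE memNset//= => pa; have /andP[_ an] := a01 n.
  by have := lt_le_trans an p1; rewrite ltNge pa.
- exact: (integrable_norm iX).
- by apply/aeW => p n _ /=; rewrite lee_fin normrM ler_piMr.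
have bound n : `|\int[dS]_p (X p * \1_[set z : R | `|z| <= a n] (x3 p))| <=
    2 * (Num.sqrt (1 - a n ^+ 2) * (`|al| + `|be|) * M) * fine (lam `[0, 2 * pi]%classic).
  have /andP[an0 an1] := a01 n.
  rewrite integral_rotXY_band//.
  have mh (z : R) : continuous (fun t => h (sphere_param (t, z)) * psi (sphere_param (t, z))).
    by move=> t; apply: cvgM; apply: continuous_longitude; [exact: (Ck_continuous Ch)|exact: (Ck_continuous C1)].
  have bh t z : - 1 <= z <= 1 -> 0 <= t <= 2 * pi ->
      `|h (sphere_param (t, z)) * psi (sphere_param (t, z))| <=
      Num.sqrt (1 - z ^+ 2) * (`|al| + `|be|) * M.
    move=> zz tt; rewrite normrM ler_pM//; last by apply: hM; split; rewrite /= in_itv.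
    rewrite /h /x1 /x2 /sphere_param /=.
    set r := Num.sqrt _; have r0 : 0 <= r by exact: sqrtr_ge0.
    have -> : al * (r * sin t) - be * (r * cos t) = r * (al * sin t - be * cos t) by ring.
    rewrite normrM (ger0_norm r0) ler_wpM2l//.
    apply: le_trans (ler_normB _ _) _; rewrite !normrM.
    by apply: lerD; rewrite ler_piMr// ?sin_norm_le1 ?cos_norm_le1//; rewrite ler_norml ?sin_geN1 ?sin_le1 ?cos_geN1 ?cos_le1.
  apply: Rintegral_bound.
  - exact: measurable_itv.
  - exact: lebesgue_itv_lty.
  - by apply: measurable_funTS; apply: continuous_measurable_fun => t; apply: cvgB; exact: mh.
  - move=> t; rewrite /= in_itv /= => tt; apply: le_trans (ler_normB _ _) _.
    rewrite mulr_natl mulr2n; apply: lerD; first by apply: bh => //; lra.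
    by rewrite -(sqrrN (a n)); apply: bh => //; lra.
have lim0 : \int[dS]_p (X p * \1_[set z : R | `|z| <= a n] (x3 p)) @[n --> \oo] --> (0 : R).
  apply: norm_cvg0.
  apply: (@squeeze_cvgr _ _ _ _ (cst 0)
    (fun n => 2 * (Num.sqrt (1 - a n ^+ 2) * (`|al| + `|be|) * M) * fine (lam `[0, 2 * pi]%classic))).
  - by apply: nearW => n /=; rewrite normr_ge0 bound.
  - exact: cvg_cst.
  - rewrite [X in _ --> X](_ : 0 = 2 * (0 * (`|al| + `|be|) * M) * fine (lam `[0, 2 * pi]%classic)); last by ring.
    apply: cvgMl; apply: cvgMr; apply: cvgMl; apply: cvgMl.
    rewrite -(@sqrtr0 R); apply: continuous_cvg; first exact: sqrt_continuous.
    have ca : a n @[n --> \oo] --> (1 : R).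
      rewrite -[X in _ --> X]subr0; apply: cvgB; first exact: cvg_cst.
      have := @cvg_harmonic R; by rewrite -(@cvg_shiftS _ (@harmonic R)).
    rewrite [X in _ --> X](_ : 0 = 1 - 1 * 1); last by ring.
    by apply: cvgB; [exact: cvg_cst | exact: cvgM].
have limF : (fine (\int[dS]_p (X p * \1_[set z : R | `|z| <= a n] (x3 p))%:E)%E @[n --> \oo] -->
     \int[dS]_p (X p * \1_[set z : R | `|z| < 1] (x3 p))).
  apply: fine_cvg; rewrite /Rintegral fineK; first exact: lim.
  apply: integrable_fin_num => //.
  apply: (le_integrable measurableT _ _ iX).
    by apply/measurable_EFinP; apply: measurable_funM => //; exact: mI.
  by move=> p _ /=; rewrite lee_fin normrM ler_piMr.
exact: (cvg_unique _ limF lim0).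
Qed.

End horizontal.

Lemma integral_rotX psi : Ck 1 psi -> \int[dS]_p rotX psi p = 0.
Proof.
move=> C1; rewrite -(integral_rotXY 1 0 C1); apply: eq_Rintegral => p _.
by rewrite mul1r mul0r addr0.
Qed.

Lemma integral_rotY psi : Ck 1 psi -> \int[dS]_p rotY psi p = 0.
Proof.
move=> C1; rewrite -(integral_rotXY 0 1 C1); apply: eq_Rintegral => p _.
by rewrite mul1r mul0r add0r.
Qed.

End divergence.

(** * Green's formula *)

Section green_formula.
Context {R : realType}.
Notation R3 := (R * R * R)%type.
Local Notation dS := (@surface_measure R).
Implicit Types (f g phi : R3 -> R) (p : R3).

Definition leibniz (D : (R3 -> R) -> R3 -> R) := forall f g, Ck 1 f -> Ck 1 g -> forall p,
  D (fun p => f p * g p) p = D f p * g p + f p * D g p.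

Lemma derive_leibniz (v : R3) f g p : Ck 1 f -> Ck 1 g ->
  'D_v (fun p => f p * g p) p = 'D_v f p * g p + f p * 'D_v g p.
Proof.
move=> Cf Cg.
by apply: (congr1 (@^~ p) (derive_mul _ _)) => q; [exact: Ck_derivable Cf | exact: Ck_derivable Cg].
Qed.

Lemma d1_leibniz : leibniz d1.
Proof. by move=> f g Cf Cg p; exact: derive_leibniz. Qed.

Lemma d2_leibniz : leibniz d2.
Proof. by move=> f g Cf Cg p; exact: derive_leibniz. Qed.

Lemma d3_leibniz : leibniz d3.
Proof. by move=> f g Cf Cg p; exact: derive_leibniz. Qed.

Lemma rotX_leibniz : leibniz rotX.
Proof.
move=> f g Cf Cg p; rewrite /rotX.
rewrite (d3_leibniz Cf Cg).
rewrite (d2_leibniz Cf Cg).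
by generalize (d3 f p), (d3 g p), (d2 f p), (d2 g p) => *; ring.
Qed.

Lemma rotY_leibniz : leibniz rotY.
Proof.
move=> f g Cf Cg p; rewrite /rotY.
rewrite (d3_leibniz Cf Cg).
rewrite (d1_leibniz Cf Cg).
by generalize (d3 f p), (d3 g p), (d1 f p), (d1 g p) => *; ring.
Qed.

Lemma rotZ_leibniz : leibniz rotZ.
Proof.
move=> f g Cf Cg p; rewrite /rotZ.
rewrite (d2_leibniz Cf Cg).
rewrite (d1_leibniz Cf Cg).
by generalize (d2 f p), (d2 g p), (d1 f p), (d1 g p) => *; ring.
Qed.

Lemma surface_RintegralD f g : continuous f -> continuous g ->
  \int[dS]_p (f p + g p) = \int[dS]_p f p + \int[dS]_p g p.
Proof. by move=> cf cg; rewrite RintegralD//; exact: surface_integrable_cont. Qed.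

(** Integration by parts twice: the integral of D (f * D g) vanishes. *)
Lemma green_field (D : (R3 -> R) -> R3 -> R) : leibniz D ->
  (forall k f, Ck k.+1 f -> Ck k (D f)) -> (forall f, Ck 1 f -> \int[dS]_p D f p = 0) ->
  forall f g, Ck 2 f -> Ck 2 g ->
  \int[dS]_p (f p * D (D g) p) = \int[dS]_p (g p * D (D f) p).
Proof.
move=> LD CD ID.
have parts f g : Ck 1 f -> Ck 2 g ->
    \int[dS]_p (f p * D (D g) p) = - \int[dS]_p (D f p * D g p).
  move=> Cf Cg; have CDg : Ck 1 (D g) by exact: CD.
  apply/eqP; rewrite -addr_eq0 addrC; apply/eqP.
  have c1 : continuous (fun p => D f p * D g p).
    by apply: (@Ck_continuous _ 0); apply: CkM; [exact: CD | exact: Ck_pred].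
  have c2 : continuous (fun p => f p * D (D g) p).
    by apply: (@Ck_continuous _ 0); apply: CkM; [exact: Ck_pred | exact: CD].
  rewrite -(surface_RintegralD c1 c2) -(ID (fun p => f p * D g p)); last exact: CkM.
  by apply: eq_Rintegral => p _; rewrite (LD _ _ Cf CDg).
move=> f g Cf Cg; rewrite parts//; last exact: Ck_pred.
rewrite parts//; last exact: Ck_pred.
by congr (- _); apply: eq_Rintegral => p _; rewrite mulrC.
Qed.

(** On the sphere the Laplacian is the sum of the squares of the three rotation
    fields, each of which is divergence free. *)
Lemma green f g : Ck 2 f -> Ck 2 g ->
  \int[dS]_p (f p * lapS g p) = \int[dS]_p (g p * lapS f p).
Proof.
have split_sum u v : Ck 2 u -> Ck 2 v -> \int[dS]_p (u p * lapS v p) =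
    \int[dS]_p (u p * rotX (rotX v) p) + \int[dS]_p (u p * rotY (rotY v) p) +
    \int[dS]_p (u p * rotZ (rotZ v) p).
  move=> Cu Cv; have Cu0 : Ck 0 u by do 2 apply: Ck_pred.
  have cX : continuous (fun p => u p * rotX (rotX v) p).
    by apply: (@Ck_continuous _ 0); apply: CkM => //; do 2 apply: Ck_rotX.
  have cY : continuous (fun p => u p * rotY (rotY v) p).
    by apply: (@Ck_continuous _ 0); apply: CkM => //; do 2 apply: Ck_rotY.
  have cZ : continuous (fun p => u p * rotZ (rotZ v) p).
    by apply: (@Ck_continuous _ 0); apply: CkM => //; do 2 apply: Ck_rotZ.
  have cXY : continuous (fun p => u p * rotX (rotX v) p + u p * rotY (rotY v) p).
    by move=> p; apply: cvgD; [exact: cX | exact: cY].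
  rewrite -(surface_RintegralD cX cY) -(surface_RintegralD cXY cZ).
  apply: surface_Rintegral_ext => p sp.
  apply: etrans (congr1 (fun t => u p * t) (esym (rot_sum Cv sp))) _.
  by generalize (rotX (rotX v) p), (rotY (rotY v) p), (rotZ (rotZ v) p) => X Y Z; ring.
move=> Cf Cg; apply: etrans (split_sum f g Cf Cg) _.
apply: etrans (esym (split_sum g f Cg Cf)).
apply: congr2; first apply: congr2.
- exact: (green_field rotX_leibniz (@Ck_rotX R) (@integral_rotX R) Cf Cg).
- exact: (green_field rotY_leibniz (@Ck_rotY R) (@integral_rotY R) Cf Cg).
- exact: (green_field rotZ_leibniz (@Ck_rotZ R) (@integral_rotZ R) Cf Cg).
Qed.

End green_formula.

(** * Polynomials restricted to the sphere *)

Section zonal_monomials.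
Context {R : realType}.
Notation R3 := (R * R * R)%type.
Implicit Types (f g phi : R3 -> R) (u : R3) (p q : {poly R}) (a b c : nat).

(** Keeping a whole polynomial in x3 lets the same computation serve monomials and
    eigenfunctions. *)
Definition zmono a b p u : R := x1 u ^+ a * x2 u ^+ b * p.[x3 u].

Lemma Ck_horner k p : Ck k (fun u => p.[x3 u]).
Proof.
elim/poly_ind: p => [|p c ih].
  by apply: eq_Ck (Ck_cst k 0); apply/funext => u; rewrite horner0.
apply: eq_Ck (CkD (CkM ih (Ck_x3 k)) (Ck_cst k c)).
by apply/funext => u; rewrite hornerMXaddC.
Qed.

Lemma Ck_zmono k a b p : Ck k (zmono a b p).
Proof. by apply: CkM (Ck_horner k p); apply: CkM; apply: CkX; [exact: Ck_x1 | exact: Ck_x2]. Qed.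

Lemma smooth_zmono a b p : smooth (zmono a b p).
Proof. by move=> k; exact: Ck_zmono. Qed.

Section derivation.
Variable D : (R3 -> R) -> R3 -> R.
Hypothesis LD : leibniz D.

Hypothesis DC : forall (c : R) u, D (fun=> c) u = 0.

Lemma leibnizX f n u : Ck 1 f -> D (fun v => f v ^+ n) u = n%:R * f u ^+ n.-1 * D f u.
Proof.
move=> Cf; elim: n => [|n ih]; first by rewrite (DC 1) !mul0r.
have -> : (fun v => f v ^+ n.+1) = (fun v => f v * f v ^+ n).
  by apply/funext => v; rewrite exprS.
rewrite (LD Cf (CkX n Cf)) ih /=.
case: n {ih} => [|n] /=; first by rewrite !expr0; ring.
by rewrite !exprS -!natr1; ring.
Qed.

Hypothesis DD : forall f g u, Ck 1 f -> Ck 1 g -> D (fun v => f v + g v) u = D f u + D g u.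

Lemma leibniz_horner p u : D (fun v => p.[x3 v]) u = p^`().[x3 u] * D (@x3 R) u.
Proof.
elim/poly_ind: p => [|p c ih].
  rewrite deriv0 horner0 mul0r -[RHS](DC 0 u); congr (D _ u).
  by apply/funext => v; rewrite horner0.
have -> : (fun v : R3 => (p * 'X + c%:P).[x3 v]) = (fun v => p.[x3 v] * x3 v + c).
  by apply/funext => v; rewrite hornerMXaddC.
rewrite (DD u (CkM (Ck_horner 1 p) (Ck_x3 1)) (Ck_cst 1 c)) DC addr0.
rewrite (LD (Ck_horner 1 p) (Ck_x3 1)) ih derivD derivM derivX derivC addr0 mulr1 hornerD hornerMX.
ring.
Qed.

(** A derivation is determined by its values on the coordinates. *)
Lemma leibniz_zmono a b p u : D (zmono a b p) u =
  a%:R * zmono a.-1 b p u * D (@x1 R) u + b%:R * zmono a b.-1 p u * D (@x2 R) u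
  + zmono a b p^`() u * D (@x3 R) u.
Proof.
have C1 := CkX a (@Ck_x1 R 1); have C2 := CkX b (@Ck_x2 R 1).
rewrite /zmono (LD (CkM C1 C2) (Ck_horner 1 p)) (LD C1 C2).
rewrite (leibnizX a u (@Ck_x1 R 1)) (leibnizX b u (@Ck_x2 R 1)) leibniz_horner.
by generalize (D (@x1 R) u), (D (@x2 R) u), (D (@x3 R) u) => e1 e2 e3; ring.
Qed.

End derivation.

Lemma derive_cst_u (v : R3) (c : R) u : 'D_v (fun=> c : R) u = 0.
Proof. exact: (congr1 (@^~ u) (derive_cst_fun v c)). Qed.

Lemma derive_add_u (v : R3) f g u : Ck 1 f -> Ck 1 g ->
  'D_v (fun w => f w + g w) u = 'D_v f u + 'D_v g u.
Proof.
move=> Cf Cg.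
by apply: (congr1 (@^~ u) (derive_add _ _)) => q; [exact: Ck_derivable Cf | exact: Ck_derivable Cg].
Qed.

Let dx (v : R3) u : 'D_v (@x1 R) u = x1 v /\ 'D_v (@x2 R) u = x2 v /\ 'D_v (@x3 R) u = x3 v.
Proof.
split; first exact: (congr1 (@^~ u) (derive_linear v x1_linear)).
split; first exact: (congr1 (@^~ u) (derive_linear v x2_linear)).
exact: (congr1 (@^~ u) (derive_linear v x3_linear)).
Qed.

Let d_zmono (v : R3) a b p u : 'D_v (zmono a b p) u =
  a%:R * zmono a.-1 b p u * x1 v + b%:R * zmono a b.-1 p u * x2 v + zmono a b p^`() u * x3 v.
Proof.
have [e1 [e2 e3]] := dx v u; rewrite -[in RHS]e1 -[in RHS]e2 -[in RHS]e3.
apply: (@leibniz_zmono (fun f => 'D_v f)).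
- by move=> f g Cf Cg w; exact: derive_leibniz.
- by move=> *; exact: derive_cst_u.
- by move=> *; exact: derive_add_u.
Qed.

Lemma d1_zmono a b p u : d1 (zmono a b p) u = a%:R * zmono a.-1 b p u.
Proof. by apply: etrans (d_zmono _ a b p u) _; rewrite /x1 /x2 /x3 /=; ring. Qed.
Lemma d2_zmono a b p u : d2 (zmono a b p) u = b%:R * zmono a b.-1 p u.
Proof. by apply: etrans (d_zmono _ a b p u) _; rewrite /x1 /x2 /x3 /=; ring. Qed.
Lemma d3_zmono a b p u : d3 (zmono a b p) u = zmono a b p^`() u.
Proof. by apply: etrans (d_zmono _ a b p u) _; rewrite /x1 /x2 /x3 /=; ring. Qed.

Lemma dZ (v : R3) (c : R) f u : Ck 1 f -> 'D_v (fun w => c * f w) u = c * 'D_v f u.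
Proof. by move=> Cf; rewrite (derive_leibniz v u (Ck_cst 1 c) Cf) derive_cst_u mul0r add0r. Qed.

(** The part of the Laplacian that keeps the factor of degree m in x1 and x2; it is
    a Gegenbauer operator. *)
Definition zonal_lap (m : nat) p : {poly R} :=
  (1 - 'X^2) * p^`()^`() - (2 * m.+1%:R) *: ('X * p^`()) - (m * m.+1)%:R *: p.

Lemma lapS_zmono a b p u : lapS (zmono a b p) u =
  (a * a.-1)%:R * zmono a.-2 b p u + (b * b.-1)%:R * zmono a b.-2 p u
  + zmono a b (zonal_lap (a + b) p) u.
Proof.
have f1 : d1 (zmono a b p) = fun w => a%:R * zmono a.-1 b p w.
  by apply/funext => w; exact: d1_zmono.
have f2 : d2 (zmono a b p) = fun w => b%:R * zmono a b.-1 p w.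
  by apply/funext => w; exact: d2_zmono.
have f3 : d3 (zmono a b p) = zmono a b p^`() by apply/funext => w; exact: d3_zmono.
have s1 i j (q : {poly R}) (c : R) : d1 (fun w => c * zmono i j q w) u = c * (i%:R * zmono i.-1 j q u).
  by apply: etrans (dZ _ c u (Ck_zmono 1 i j q)) _; congr (c * _); exact: d1_zmono.
have s2 i j (q : {poly R}) (c : R) : d2 (fun w => c * zmono i j q w) u = c * (j%:R * zmono i j.-1 q u).
  by apply: etrans (dZ _ c u (Ck_zmono 1 i j q)) _; congr (c * _); exact: d2_zmono.
have s3 i j (q : {poly R}) (c : R) : d3 (fun w => c * zmono i j q w) u = c * zmono i j q^`() u.
  by apply: etrans (dZ _ c u (Ck_zmono 1 i j q)) _; congr (c * _); exact: d3_zmono.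
rewrite /lapS f1 f2 f3 !s1 !s2 !s3 d1_zmono d2_zmono d3_zmono.
have zE i j (q : {poly R}) : zmono i j q u = x1 u ^+ i * x2 u ^+ j * q.[x3 u] by [].
rewrite !zE /zonal_lap !(hornerE, hornerXn) /=.
move: (p.[x3 u]) (p^`().[x3 u]) (p^`()^`().[x3 u]) (x1 u) (x2 u) (x3 u) => P P' P'' x y z.
case: a {f1 f2 f3 s1 s2 s3 zE} => [|[|a]]; case: b => [|[|b]]; rewrite /= ?addn0 ?add0n ?addnS ?addSn ?exprS ?expr0 ?mulnS ?mulSn ?natrD ?mul0n ?muln0 -?natr1 ?natrD ?natrM; ring.
Qed.

Lemma rotZ_zmono a b p u : rotZ (zmono a b p) u =
  b%:R * zmono a.+1 b.-1 p u - a%:R * zmono a.-1 b.+1 p u.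
Proof.
rewrite /rotZ d1_zmono d2_zmono /zmono !exprS.
by ring.
Qed.

Lemma rotZ2_zmono a b p u : on_sphere u -> rotZ (rotZ (zmono a b p)) u =
  (a * a.-1)%:R * zmono a.-2 b ((1 - 'X^2) * p) u + (b * b.-1)%:R * zmono a b.-2 ((1 - 'X^2) * p) u
  - ((a + b) ^ 2)%:R * zmono a b p u.
Proof.
move=> su.
have f : rotZ (zmono a b p) =
    fun w => b%:R * zmono a.+1 b.-1 p w + (- a%:R) * zmono a.-1 b.+1 p w.
  by apply/funext => w; rewrite rotZ_zmono mulNr.
have C i j (c : R) : Ck 1 (fun w => c * zmono i j p w) by apply: CkZ; exact: Ck_zmono.
have e1 : d1 (rotZ (zmono a b p)) u = b%:R * (a.+1%:R * zmono a b.-1 p u)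
    + (- a%:R) * (a.-1%:R * zmono a.-2 b.+1 p u).
  rewrite f; apply: etrans (derive_add_u _ u (C _ _ _) (C _ _ _)) _.
  apply: congr2; (apply: etrans (dZ _ _ u (Ck_zmono 1 _ _ _)) _);
    by congr (_ * _); exact: d1_zmono.
have e2 : d2 (rotZ (zmono a b p)) u = b%:R * (b.-1%:R * zmono a.+1 b.-2 p u)
    + (- a%:R) * (b.+1%:R * zmono a.-1 b p u).
  rewrite f; apply: etrans (derive_add_u _ u (C _ _ _) (C _ _ _)) _.
  apply: congr2; (apply: etrans (dZ _ _ u (Ck_zmono 1 _ _ _)) _);
    by congr (_ * _); exact: d2_zmono.
rewrite /rotZ -/(rotZ _) e1 e2 {f e1 e2 C}.
have zE i j (q : {poly R}) : zmono i j q u = x1 u ^+ i * x2 u ^+ j * q.[x3 u] by [].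
rewrite !zE !(hornerE, hornerXn) /=; move: su; rewrite /on_sphere.
move: (p.[x3 u]) (x1 u) (x2 u) (x3 u) => P x y z su.
have -> : 1 - z ^+ 2 = x ^+ 2 + y ^+ 2 by rewrite -su; ring.
rewrite !natrX !natrM !natrD.
case: a {zE} => [|[|a]]; case: b => [|[|b]]; rewrite /= ?exprS ?expr0 -?natr1; ring.
Qed.

End zonal_monomials.

(** * Functions with vanishing moments on the sphere *)

Section null_functions.
Context {R : realType}.
Notation R3 := (R * R * R)%type.
Local Notation dS := (@surface_measure R).
Implicit Types (f g phi : R3 -> R) (u : R3) (p q : {poly R}) (a b c : nat).

Lemma moment_integrable (v g : R3 -> R) : v \in Lfun dS 2%:E -> continuous g ->
  dS.-integrable setT (EFin \o (fun u => v u * g u)).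
Proof. by move=> Lv cg; apply: integrable_mulr => //; exact: continuous_Lfun2. Qed.

Section moments.
Variable v : R3 -> R.
Hypothesis Lv : v \in Lfun dS 2%:E.

Definition moment g : R := \int[dS]_u (v u * g u).

Lemma momentD g h : continuous g -> continuous h ->
  moment (fun u => g u + h u) = moment g + moment h.
Proof.
move=> cg ch; rewrite /moment -RintegralD//; [|exact: moment_integrable|exact: moment_integrable].
by apply: eq_Rintegral => u _; rewrite mulrDr.
Qed.

Lemma momentZ (c : R) g : continuous g -> moment (fun u => c * g u) = c * moment g.
Proof.
move=> cg; rewrite /moment -RintegralZl//; last exact: moment_integrable.
by apply: eq_Rintegral => u _; rewrite mulrCA.
Qed.

Lemma moment_ext g h : (forall u, on_sphere u -> g u = h u) -> moment g = moment h.
Proof. by move=> gh; apply: surface_Rintegral_ext => u su; rewrite gh. Qed.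

Let cz a b p : continuous (zmono a b p).
Proof. exact: (@Ck_continuous _ 0 _ (Ck_zmono 0 a b p)). Qed.

Lemma moment_zmonoD a b p q : moment (zmono a b (p + q)) = moment (zmono a b p) + moment (zmono a b q).
Proof.
rewrite -momentD//; apply: moment_ext => u _; by rewrite /zmono hornerD; ring.
Qed.

Lemma moment_zmonoZ a b (c : R) p : moment (zmono a b (c *: p)) = c * moment (zmono a b p).
Proof.
rewrite -momentZ//; apply: moment_ext => u _; by rewrite /zmono hornerZ; ring.
Qed.

Lemma moment_zmono0 a b : moment (zmono a b 0) = 0.
Proof. by have := moment_zmonoZ a b 0 0; rewrite scale0r mul0r. Qed.

Lemma moment_comb (x y : R) a b p a' b' p' a'' b'' p'' :
  moment (fun u => x * zmono a b p u + y * zmono a' b' p' u + zmono a'' b'' p'' u) =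
  x * moment (zmono a b p) + y * moment (zmono a' b' p') + moment (zmono a'' b'' p'').
Proof.
have cZ (k : R) i j (q : {poly R}) : continuous (fun u => k * zmono i j q u).
  by move=> u; apply: cvgM; [exact: cvg_cst | exact: cz].
have cD : continuous (fun u => x * zmono a b p u + y * zmono a' b' p' u).
  by move=> u; apply: cvgD; exact: cZ.
rewrite (momentD cD (@cz a'' b'' p'')) (momentD (@cZ x a b p) (@cZ y a' b' p')).
by rewrite !momentZ.
Qed.

Lemma zmono_moments_null : (forall a b c, moment (zmono a b 'X^c) = 0) ->
  {ae dS, forall u, v u = 0}.
Proof.
move=> mom; apply: moments_null.
- have c1 : continuous ((fun=> 1) : R3 -> R) by move=> u; exact: cvg_cst.
  rewrite (_ : EFin \o v = EFin \o (fun u => v u * 1)); first exact: (moment_integrable Lv c1).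
  by apply/funext => u /=; rewrite mulr1.
- apply: filterS ae_on_sphere => u su.
  have cube (x y z : R) : x ^+ 2 + y ^+ 2 + z ^+ 2 = 1 -> `|x| <= 1.
    by move=> e; rewrite ler_norml; apply/andP; split; nra.
  move: su; rewrite /on_sphere => su; split; [exact: cube su| |].
    by apply: (cube _ (x1 u) (x3 u)); rewrite -su; ring.
  by apply: (cube _ (x1 u) (x2 u)); rewrite -su; ring.
- move=> a b c; apply: etrans (mom a b c).
  by apply: moment_ext => u _; rewrite /zmono hornerXn.
Qed.

Lemma zonal_lapXn m c : zonal_lap m ('X^c : {poly R}) =
  (c * c.-1)%:R *: 'X^(c.-2) - ((m + c) * (m + c).+1)%:R *: 'X^c.
Proof.
have dX n : ('X^n : {poly R})^`() = n%:R *: 'X^(n.-1) by rewrite derivXn scaler_nat.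
have e2 : 'X^2 * ((c * c.-1)%:R *: 'X^(c.-2)) = (c * c.-1)%:R *: 'X^c :> {poly R}.
  rewrite -scalerAr -exprD.
  by case: c => [|[|c]]; rewrite /= ?muln0 ?mul0n ?scale0r.
have e1 : 'X * (c%:R *: 'X^(c.-1)) = c%:R *: 'X^c :> {poly R}.
  by rewrite -scalerAr -exprS; case: c {e2} => [|c]; rewrite /= ?scale0r.
rewrite /zonal_lap dX derivZ dX scalerA -natrM mulrBl mul1r e1 e2 scalerA -!addrA.
congr (_ + _); rewrite -!opprD -!scalerDl; congr (- (_ *: _)).
by case: c {e1 e2} => [|c] /=; rewrite !natrM -!natr1 ?natrD -?natr1; ring.
Qed.

(** The Laplacian maps a monomial of degree n to monomials of degree n - 2 minus
    n (n + 1) times itself, so that all moments vanish by induction. *)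
Lemma harmonic_null : moment (fun=> 1) = 0 ->
  (forall phi, smooth phi -> moment (lapS phi) = 0) -> {ae dS, forall u, v u = 0}.
Proof.
move=> mean0 weak0; apply: zmono_moments_null.
suff H n : forall a b c, (a + b + c <= n)%N -> moment (zmono a b 'X^c) = 0.
  by move=> a b c; exact: (H (a + b + c)%N).
elim: n => [|n ih] a b c.
  rewrite leqn0 !addn_eq0 => /andP[/andP[/eqP-> /eqP->] /eqP->].
  rewrite -mean0; apply: moment_ext => u _.
  by rewrite /zmono !expr0 hornerC !mulr1.
have [d0|d0] := eqVneq (a + b + c)%N 0%N; first by move=> _; apply: (ih); rewrite d0.
move=> dn.
have h1 : (a * a.-1)%:R * moment (zmono a.-2 b 'X^c) = 0.
  case: a dn {d0} => [|[|a]] dn; rewrite ?muln0 ?mul0n ?mul0r//= ih ?mulr0//; lia.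
have h2 : (b * b.-1)%:R * moment (zmono a b.-2 'X^c) = 0.
  case: b dn {d0 h1} => [|[|b]] dn; rewrite ?muln0 ?mul0n ?mul0r//= ih ?mulr0//; lia.
have h3 : (c * c.-1)%:R * moment (zmono a b 'X^(c.-2)) = 0.
  case: c dn {d0 h1 h2} => [|[|c]] dn; rewrite ?muln0 ?mul0n ?mul0r//= ih ?mulr0//; lia.
have := weak0 _ (smooth_zmono a b 'X^c).
rewrite (moment_ext (fun u _ => lapS_zmono a b 'X^c u)) moment_comb h1 h2 zonal_lapXn.
rewrite moment_zmonoD -scaleNr !moment_zmonoZ h3 !add0r => /eqP.
rewrite mulf_eq0 oppr_eq0 pnatr_eq0 muln_eq0 (negbTE d0) /= => /eqP.
by [].
Qed.

(** The square of the rotation field maps a polynomial of degree d in x1 and x2,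
    with coefficients in x3, to - d^2 times itself plus terms of degree d - 2, and
    - d^2 differs from - 1 except for d = 1: the moments vanish by induction on
    d. *)
Lemma circular_null :
  (forall phi, smooth phi -> moment (rotZ (rotZ phi)) = - moment phi) ->
  (forall p, moment (zmono 1 0 p) = 0) -> (forall p, moment (zmono 0 1 p) = 0) ->
  {ae dS, forall u, v u = 0}.
Proof.
move=> rot m10 m01; apply: zmono_moments_null.
suff H n : forall a b p, (a + b <= n)%N -> moment (zmono a b p) = 0.
  by move=> a b c; exact: (H (a + b)%N).
elim: n => [|n ih] a b p dn.
all: have [/eqP d1|d1] := eqVneq (a + b)%N 1%N.
- by move: dn; rewrite (eqP d1).
- move: dn; rewrite leqn0 addn_eq0 => /andP[/eqP a0 /eqP b0]; subst a b.
  have := rot _ (smooth_zmono 0 0 p).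
  rewrite (moment_ext (h := fun u => 0 * zmono 0 0 0 u + 0 * zmono 0 0 0 u + zmono 0 0 0 u)).
    by rewrite moment_comb !moment_zmono0; lra.
  by move=> u su; rewrite rotZ2_zmono// /zmono horner0; ring.
- move: d1; case: a dn => [|[|a]] dn; case: b dn => [|[|b]] //.
have h1 : (a * a.-1)%:R * moment (zmono a.-2 b ((1 - 'X^2) * p)) = 0.
  case: a dn {d1} => [|[|a]] dn; rewrite ?muln0 ?mul0n ?mul0r//= ih ?mulr0//; lia.
have h2 : (b * b.-1)%:R * moment (zmono a b.-2 ((1 - 'X^2) * p)) = 0.
  case: b dn {d1 h1} => [|[|b]] dn; rewrite ?muln0 ?mul0n ?mul0r//= ih ?mulr0//; lia.
have := rot _ (smooth_zmono a b p).
rewrite (moment_ext (h := fun u => (a * a.-1)%:R * zmono a.-2 b ((1 - 'X^2) * p) u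
  + (b * b.-1)%:R * zmono a b.-2 ((1 - 'X^2) * p) u + zmono a b (- ((a + b) ^ 2)%:R *: p) u)); last first.
  by move=> u su; rewrite rotZ2_zmono// /zmono hornerZ; ring.
rewrite moment_comb h1 h2 moment_zmonoZ !add0r => /eqP.
rewrite -subr_eq0 opprK -{2}(mul1r (moment (zmono a b p))) -mulrDl mulf_eq0 => /orP[|/eqP//].
rewrite addrC subr_eq0 eq_sym (eqr_nat R _ 1) => /eqP dd; case/eqP: d1; nia.
Qed.

End moments.
End null_functions.

(** * Zonal eigenpolynomials *)

Section eigenpolynomials.
Context {R : realType}.
Implicit Types (p q r : {poly R}) (k n : nat).

Lemma zonal_lapD m p q : zonal_lap m (p + q) = zonal_lap m p + zonal_lap m q.
Proof.
rewrite /zonal_lap !derivD !mulrDr !scalerDr !opprD.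
by rewrite !addrA; congr (_ + _); rewrite -!addrA; congr (_ + _); ring.
Qed.

Lemma zonal_lapZ m (c : R) p : zonal_lap m (c *: p) = c *: zonal_lap m p.
Proof. by rewrite /zonal_lap !derivZ -!scalerAr !scalerBr !scalerA ![_ * c]mulrC. Qed.

(** l (l + 1) for the degree l = n + 1 *)
Definition level n : R := (n.+1 * n.+2)%:R.

Lemma level_lt k n : (k < n)%N -> level n - level k != 0.
Proof. by move=> kn; rewrite subr_eq0 eqr_nat; apply/negP => /eqP; nia. Qed.

Lemma size_top k q r : (size q <= k.+1)%N -> r \is monic -> size r = k.+1 ->
  (size (q - q`_k *: r)%R <= k)%N.
Proof.
move=> sq /monicP mr sr; apply/leq_sizeP => j kj; rewrite coefB coefZ.
have [->|jk] := eqVneq j k.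
  by move: mr; rewrite lead_coefE sr /= => ->; rewrite mulr1 subrr.
have kj' : (k < j)%N by rewrite ltn_neqAle eq_sym jk.
have -> : q`_j = 0 by rewrite nth_default//; exact: leq_trans sq kj'.
by rewrite (_ : r`_j = 0) ?mulr0 ?subrr// nth_default// sr.
Qed.

(** The operator maps the power k to - level k times itself plus a lower power, so
    it is triangular, and level n does not occur below degree n. *)
Lemma zonal_lap_solve n k q : (k <= n)%N -> (size q <= k)%N ->
  exists2 r : {poly R}, (size r <= k)%N & zonal_lap 1 r + level n *: r = q.
Proof.
elim: k q => [|k ih] q kn sq.
  exists 0; first by rewrite size_poly0.
  move: sq; rewrite leqn0 size_poly_eq0 => /eqP->.
  by have := zonal_lapZ 1 0 0; rewrite !scale0r scaler0 addr0 => ->.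
set c := q`_k / (level n - level k).
have sX (i : nat) : size ('X^i : {poly R}) = i.+1 by rewrite size_polyXn.
have s1 : (size (q - q`_k *: 'X^k - (c * (k * k.-1)%:R) *: 'X^(k.-2))%R <= k)%N.
  apply: leq_trans (size_polyD _ _) _; rewrite geq_max size_polyN.
  rewrite size_top ?monicXn//=.
  case: k {ih sq} kn @c => [|[|k]] kn c; rewrite ?muln0 ?mulr0 ?scale0r ?size_poly0//=.
  by apply: leq_trans (size_scale_leq _ _) _; rewrite sX.
have [r sr er] := ih _ (ltnW kn) s1.
exists (c *: 'X^k + r).
  apply: leq_trans (size_polyD _ _) _; rewrite geq_max (leq_trans sr)// andbT.
  by apply: leq_trans (size_scale_leq _ _) _; rewrite sX.
rewrite zonal_lapD zonal_lapZ [level n *: _]scalerDr.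
apply: etrans (addrACA (c *: zonal_lap 1 'X^k) (zonal_lap 1 r) (level n *: (c *: 'X^k)) (level n *: r)) _.
rewrite er zonal_lapXn.
rewrite add1n -/(level k) scalerBr !scalerA.
rewrite (_ : q`_k = c * (level n - level k)); last first.
  by rewrite /c divfK// level_lt.
rewrite mulrBr scalerBl [level n * c]mulrC.
have cancel (x y z : {poly R}) : x - z + y + (q - (y - z) - x) = q.
  rewrite (_ : x - z + y = x + (y - z)); last by rewrite -addrA (addrC y).
  by move: (y - z) => w; rewrite (addrC (x + w)) (addrA (q - w - x)) !subrK.
exact: cancel.
Qed.

(** The leading power is corrected by solving for lower terms. *)
Lemma eigenpoly_exists n : exists p : {poly R},
  [/\ p \is monic, size p = n.+1 & zonal_lap 1 p = - level n *: p].
Proof.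
have s0 : (size (- ((n * n.-1)%:R *: 'X^(n.-2)) : {poly R})%R <= n)%N.
  rewrite size_polyN; case: n => [|[|n]]; rewrite ?muln0 ?scale0r ?size_poly0//=.
  by apply: leq_trans (size_scale_leq _ _) _; rewrite size_polyXn.
have [r sr er] := zonal_lap_solve (leqnn n) s0.
exists ('X^n + r); split.
- by rewrite monicE lead_coefDl ?size_polyXn// -monicE monicXn.
- by rewrite size_polyDl ?size_polyXn.
- have e : zonal_lap 1 r = - ((n * n.-1)%:R *: 'X^(n.-2)) - level n *: r.
    by rewrite -er addrK.
  rewrite zonal_lapD e zonal_lapXn add1n -/(level n) [RHS]scalerDr !scaleNr.
  have cancel (x y z : {poly R}) : x - y + (- x - z) = - y - z.
    by rewrite (addrC x) -addrA (addrA x) subrr sub0r.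
  exact: cancel.
Qed.

(** The first two are fixed explicitly: multiplication by the variable maps one to
    the other, which is what makes the lowest coefficient decouple. *)
Definition eigenpoly n : {poly R} :=
  match n with 0 => 1 | 1 => 'X | _ => sval (cid (eigenpoly_exists n)) end.

Lemma eigenpolyP n : [/\ eigenpoly n \is monic, size (eigenpoly n) = n.+1 &
  zonal_lap 1 (eigenpoly n) = - level n *: eigenpoly n].
Proof.
case: n => [|[|n]]; last by rewrite /eigenpoly; case: cid.
  rewrite /eigenpoly monic1 size_poly1; split => //.
  by have := zonal_lapXn (R := R) 1 0; rewrite muln0 scale0r sub0r expr0 scaleNr.
rewrite /eigenpoly monicX size_polyX; split => //.
by have := zonal_lapXn (R := R) 1 1; rewrite muln0 scale0r sub0r expr1 scaleNr.
Qed.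

Lemma eigenpoly_span (P : {poly R} -> Prop) : P 0 ->
  (forall p q, P p -> P q -> P (p + q)) -> (forall (c : R) p, P p -> P (c *: p)) ->
  (forall n, P (eigenpoly n)) -> forall q, P q.
Proof.
move=> P0 PD PZ Pe q; move: (leqnn (size q)); move: {2}(size q) => k.
elim: k q => [|k ih] q sq.
  by move: sq; rewrite leqn0 size_poly_eq0 => /eqP->.
have [mk sk _] := eigenpolyP k.
by rewrite -(subrK (q`_k *: eigenpoly k) q); apply: PD; [apply: ih; exact: size_top | exact: PZ].
Qed.

End eigenpolynomials.

(** * Complex square integrable functions *)

Section complex_L2_space.
Context {d : measure_display} {T : measurableType d} {R : realType}.
Variable mu : {measure set T -> \bar R}.
Local Notation E := (T -> (R[i])^o).
Local Notation W := (@L2 d T R mu : set E).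
Implicit Types (f g h : E).

Definition re f (x : T) : R := complex.Re (f x).
Definition im f (x : T) : R := complex.Im (f x).

(** the real part of the Hermitian product *)
Definition dotL2 f g : R := \int[mu]_x (re f x * re g x + im f x * im g x).

Lemma reD f g : re (f + g) = fun x => re f x + re g x.
Proof. by apply/funext => x; rewrite /re -[(f + g) x]/(f x + g x); case: (f x) (g x) => ? ? []. Qed.
Lemma imD f g : im (f + g) = fun x => im f x + im g x.
Proof. by apply/funext => x; rewrite /im -[(f + g) x]/(f x + g x); case: (f x) (g x) => ? ? []. Qed.

Lemma reZ (a : R[i]) f : re (a *: f) = fun x => complex.Re a * re f x - complex.Im a * im f x.
Proof. by apply/funext => x; rewrite /re /im -[(a *: f) x]/(a * f x); case: (f x) a => ? ? []. Qed.
Lemma imZ (a : R[i]) f : im (a *: f) = fun x => complex.Re a * im f x + complex.Im a * re f x.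
Proof. by apply/funext => x; rewrite /re /im -[(a *: f) x]/(a * f x); case: (f x) a => ? ? []. Qed.

Lemma reB f g : re (f - g) = fun x => re f x - re g x.
Proof. by rewrite reD; apply/funext => x; rewrite -scaleN1r reZ /=; ring. Qed.
Lemma imB f g : im (f - g) = fun x => im f x - im g x.
Proof. by rewrite imD; apply/funext => x; rewrite -scaleN1r imZ /=; ring. Qed.

Lemma L2_re f : W f -> re f \in Lfun mu 2%:E. Proof. by case. Qed.
Lemma L2_im f : W f -> im f \in Lfun mu 2%:E. Proof. by case. Qed.
Lemma L2_intro f : re f \in Lfun mu 2%:E -> im f \in Lfun mu 2%:E -> W f.
Proof. by []. Qed.

Lemma L2_subspace : subspace W.
Proof.
have z : ((fun=> 0) : T -> R) \in Lfun mu 2%:E.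
  apply: (@Lfun2_le _ _ _ mu _ (fun=> 0)) => [||x]; last by rewrite expr0n.
    exact: measurable_cst.
  exact: integrable0.
split.
- by split.
- move=> f g [f1 f2] [g1 g2]; apply: L2_intro; rewrite ?reD ?imD; exact: Lfun2D.
- move=> a f [f1 f2]; apply: L2_intro; rewrite ?reZ ?imZ; [apply: Lfun2B|apply: Lfun2D]; exact: Lfun2Z.
Qed.

Lemma dotL2_integrable f g : W f -> W g ->
  mu.-integrable setT (EFin \o (fun x => re f x * re g x + im f x * im g x)).
Proof.
move=> [f1 f2] [g1 g2].
have := integrableD measurableT (integrable_mulr f1 g1) (integrable_mulr f2 g2).
by [].
Qed.

Lemma dotL2E f g : W f -> W g ->
  dotL2 f g = \int[mu]_x (re f x * re g x) + \int[mu]_x (im f x * im g x).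
Proof. by move=> [f1 f2] [g1 g2]; apply: RintegralD => //; exact: integrable_mulr. Qed.

Lemma dotL2_inner : semi_inner W dotL2.
Proof.
split.
- by move=> f g _ _; apply: eq_Rintegral => x _; ring.
- move=> f g h Wf Wg Wh.
  apply: etrans (RintegralD measurableT (dotL2_integrable Wf Wh) (dotL2_integrable Wg Wh)).
  by apply: eq_Rintegral => x _; rewrite reD imD; ring.
- move=> a f g Wf Wg.
  apply: etrans (RintegralZl a measurableT (dotL2_integrable Wf Wg)).
  by apply: eq_Rintegral => x _; rewrite reZ imZ /=; ring.
- by move=> f _; apply: Rintegral_ge0 => x _; nra.
Qed.

Lemma dotL2J f g : W f -> W g -> dotL2 (imu *: f) g = - dotL2 f (imu *: g).
Proof.
move=> Wf Wg; rewrite -mulN1r.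
have WJg : W (imu *: g) by exact: (subspaceZ L2_subspace).
apply: etrans (RintegralZl (-1) measurableT (dotL2_integrable Wf WJg)).
by apply: eq_Rintegral => x _; rewrite !reZ !imZ /=; ring.
Qed.

Lemma dotL2_null f : W f -> dotL2 f f = 0 -> {ae mu, forall x, f x = 0}.
Proof.
move=> Wf; have [f1 f2] := Wf; rewrite dotL2E// => f0.
have p1 : 0 <= \int[mu]_x (re f x * re f x) by apply: Rintegral_ge0 => x _; nra.
have p2 : 0 <= \int[mu]_x (im f x * im f x) by apply: Rintegral_ge0 => x _; nra.
have a1 := @Lfun2_eq0 _ _ _ mu _ f1 (ltac:(lra)).
have a2 := @Lfun2_eq0 _ _ _ mu _ f2 (ltac:(lra)).
apply: filterS2 a1 a2 => x; rewrite /re /im.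
by case: (f x) => a b /= -> ->.
Qed.

Lemma normL2E f : W f -> normL2 mu f = (Num.sqrt (dotL2 f f))%:E.
Proof.
move=> Wf; rewrite /normL2 unlock /Lnorm.
have e : (\int[mu]_x (`|(EFin \o (fun x => Normc.normc (f x))) x| `^ 2) =
    \int[mu]_x (re f x * re f x + im f x * im f x)%:E)%E.
  apply: eq_integral => x _ /=; congr EFin.
  rewrite powR_mulrn// real_normK ?num_real// /re /im; case: (f x) => a b /=.
  by rewrite sqr_sqrtr; [ring | nra].
have n := dotL2_integrable Wf Wf.
rewrite e -(fineK (integrable_fin_num measurableT n)) poweR_EFin.
by rewrite powR12_sqrt//; exact: (si_ge0 dotL2_inner Wf).
Qed.

Lemma L2_cauchy_complete : (mu setT < +oo)%E -> cauchy_complete W dotL2.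
Proof.
move=> fin u Wu cu.
have WB m n : W (u m - u n) by exact: (subspaceB L2_subspace).
have c1 e : 0 < e -> exists N, forall m n, (N <= m)%N -> (N <= n)%N ->
    \int[mu]_x ((re (u m) x - re (u n) x) * (re (u m) x - re (u n) x)) <= e.
  move=> e0; have [N hN] := cu e e0; exists N => m n mN nN.
  apply: le_trans (hN m n mN nN); rewrite dotL2E// reB lerDl.
  by apply: Rintegral_ge0 => x _; nra.
have c2 e : 0 < e -> exists N, forall m n, (N <= m)%N -> (N <= n)%N ->
    \int[mu]_x ((im (u m) x - im (u n) x) * (im (u m) x - im (u n) x)) <= e.
  move=> e0; have [N hN] := cu e e0; exists N => m n mN nN.
  apply: le_trans (hN m n mN nN); rewrite dotL2E// imB lerDr.
  by apply: Rintegral_ge0 => x _; nra.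
have [lr Lr hr] := L2_complete fin (fun n => L2_re (Wu n)) c1.
have [li Li hi] := L2_complete fin (fun n => L2_im (Wu n)) c2.
pose l : E := fun x => Complex (lr x) (li x).
have Wl : W l by exact: L2_intro.
exists l => // e e0.
have [N1 h1] := hr _ (divr_gt0 e0 (ltr0n _ 2)).
have [N2 h2] := hi _ (divr_gt0 e0 (ltr0n _ 2)).
exists (maxn N1 N2) => n; rewrite geq_max => /andP[n1 n2].
rewrite dotL2E; [|exact: (subspaceB L2_subspace)..].
rewrite reB imB; have := h1 n n1; have := h2 n n2; lra.
Qed.

(** Each condition passes to the limit by the Cauchy-Schwarz inequality. *)
Lemma annihilator_complete (S : set E) : (mu setT < +oo)%E -> S `<=` W ->
  cauchy_complete [set f : E | W f /\ forall t, S t -> dotL2 f t = 0] dotL2.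
Proof.
move=> fin SW u Vu cu.
have sd := dotL2_inner.
have [l Wl hl] := L2_cauchy_complete fin (fun n => proj1 (Vu n)) cu.
exists l => //; split => // t St; have Wt := SW _ St.
apply/eqP/negPn/negP => n0.
have q0 : 0 < dotL2 l t ^+ 2 by rewrite exprn_even_gt0.
have t0 : 0 < 1 + dotL2 t t by have := si_ge0 sd Wt; lra.
have [N hN] := hl (dotL2 l t ^+ 2 / (1 + dotL2 t t) / 2) (divr_gt0 (divr_gt0 q0 t0) (ltr0n _ 2)).
have WuN : W (u N) by case: (Vu N).
have WB : W (u N - l) by exact: (subspaceB L2_subspace).
have e : dotL2 (u N - l) t = - dotL2 l t.
  by rewrite (siB L2_subspace sd WuN Wl Wt) (proj2 (Vu N) t St) sub0r.
have := cauchy_schwarz L2_subspace sd WB Wt; rewrite e sqrrN.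
have := hN N (leqnn N); set D := dotL2 (u N - l) _ => hD hcs.
have D0 : 0 <= D by exact: (si_ge0 sd).
have : D * dotL2 t t <= dotL2 l t ^+ 2 / 2.
  have := ler_wpM2r (ltW t0) hD.
  rewrite (_ : _ / _ / 2 * _ = dotL2 l t ^+ 2 / 2); last by field; rewrite lt0r_neq0.
  by move: (si_ge0 sd Wt); nra.
move: hcs q0; lra.
Qed.

End complex_L2_space.

(** * The mode of order one *)

Section V1_space.
Context {R : realType}.
Notation R3 := (R * R * R)%type.
Local Notation dS := (@surface_measure R).
Local Notation E := (R3 -> (R[i])^o).
Local Notation W := (@L2 _ _ R dS : set E).
Local Notation dot := (dotL2 dS).
Implicit Types (f g : E) (phi : R3 -> R) (a b : nat) (p : {poly R}).

Lemma CintegralM f (h : R3 -> R) : Cintegral dS (fun u => f u * (h u)%:C%C) =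
  Complex (moment (re f) h) (moment (im f) h).
Proof.
congr Complex; apply: eq_Rintegral => u _; rewrite /re /im;
  by case: (f u) => x y /=; ring.
Qed.

Lemma Cintegral1 f : Cintegral dS f = Complex (moment (re f) (fun=> 1)) (moment (im f) (fun=> 1)).
Proof. by congr Complex; apply: eq_Rintegral => u _; rewrite mulr1. Qed.

Lemma smooth_rotZ phi : smooth phi -> smooth (rotZ phi).
Proof. by move=> sphi k; exact: Ck_rotZ. Qed.

Lemma smooth_continuous phi : smooth phi -> continuous phi.
Proof. by move=> /(_ 0%N); exact: Ck_continuous. Qed.

Lemma smooth1 : smooth ((fun=> 1) : R3 -> R).
Proof. by move=> k; exact: Ck_cst. Qed.

Lemma smooth_lapS phi : smooth phi -> continuous (lapS phi).
Proof.
move=> sphi.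
have c (g : R3 -> R) : smooth g -> forall v : R3, smooth ('D_v g).
  by move=> sg v k; apply: Ck_derive; exact: sg.
have C0 (g : R3 -> R) : smooth g -> Ck 0 g by exact.
have X1 := @Ck_x1 R 0; have X2 := @Ck_x2 R 0; have X3 := @Ck_x3 R 0.
have D1 v : Ck 0 ('D_v phi) by exact/C0/c.
have D2 v w : Ck 0 ('D_v ('D_w phi)) by exact/C0/c/c.
apply: (@Ck_continuous _ 0); apply: CkB; first apply: CkB.
- by apply: CkD; [apply: CkD|]; exact: D2.
- by apply: CkD; [apply: CkD|]; apply: CkM => //; apply: CkD; [apply: CkD| |apply: CkD| |apply: CkD|];
    apply: CkM => //; exact: D2.
- by apply: CkM; [exact: Ck_cst | apply: CkD; [apply: CkD|]; apply: CkM => //; exact: D1].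
Qed.

Lemma moment_cst0 (v : R3 -> R) : moment v (fun=> 0) = 0.
Proof.
rewrite /moment (eq_Rintegral _ (g := cst 0)); first by rewrite Rintegral_cst// mul0r.
by move=> u _; rewrite mulr0.
Qed.

(** Testing against 1 shows that the mean vanishes, since the rotation field kills
    constants. *)
Lemma V1P f : V1 f <-> W f /\ forall phi, smooth phi ->
  moment (re f) (rotZ phi) = moment (im f) phi /\
  moment (im f) (rotZ phi) = - moment (re f) phi.
Proof.
have weakE : W f -> forall phi, smooth phi ->
    Cintegral dS (fun u => f u * (X3 phi u)%:C%C) =
    Complex (moment (re f) (rotZ phi)) (moment (im f) (rotZ phi)) /\
    - Cintegral dS (fun u => 'i%C * f u * (phi u)%:C%C) =
    Complex (moment (im f) phi) (- moment (re f) phi).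
  move=> [Lr Li] phi sphi; have -> : X3 phi = rotZ phi by apply/funext => u; exact: X3_rotZ (sphi 1%N).
  split; first exact: CintegralM.
  have -> : (fun u => 'i%C * f u * (phi u)%:C%C) = (fun u => (imu *: f) u * (phi u)%:C%C) by [].
  rewrite CintegralM reZ imZ /= /moment.
  have -> : \int[dS]_u ((0 * re f u - 1 * im f u) * phi u) = \int[dS]_u ((-1) * (im f u * phi u)).
    by apply: eq_Rintegral => u _; ring.
  rewrite RintegralZl ?mulN1r//; last by apply: moment_integrable => //; exact: smooth_continuous.
  have -> : \int[dS]_u ((0 * im f u + 1 * re f u) * phi u) = \int[dS]_u (re f u * phi u).
    by apply: eq_Rintegral => u _; ring.
  by apply/eqP; rewrite eq_complex /= opprK !eqxx.
split.
- move=> [Wf _ wf]; split => // phi sphi; have [e1 e2] := weakE Wf phi sphi.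
  by have := wf phi sphi; rewrite e1 e2 => -[].
- move=> [Wf rel]; split => //.
    have [] := rel _ smooth1.
    have -> : rotZ ((fun=> 1) : R3 -> R) = fun=> 0.
      apply/funext => u; rewrite /rotZ.
      by rewrite [d1 _ u](derive_cst_u (1, 0, 0)) [d2 _ u](derive_cst_u (0, 1, 0)) !mulr0 subr0.
    rewrite !moment_cst0 Cintegral1 => <- /esym/eqP; rewrite oppr_eq0 => /eqP ->.
    by [].
  move=> phi sphi; have [e1 e2] := weakE Wf phi sphi; have [r1 r2] := rel phi sphi.
  by rewrite e1 e2 r1 r2.
Qed.

End V1_space.

Section V1_structure.
Context {R : realType}.
Notation R3 := (R * R * R)%type.
Local Notation dS := (@surface_measure R).
Local Notation E := (R3 -> (R[i])^o).
Local Notation W := (@L2 _ _ R dS : set E).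
Local Notation V := (@V1 R : set E).
Local Notation dot := (dotL2 dS).
Implicit Types (f : E) (g h phi : R3 -> R) (a b : nat) (p : {poly R}).

Lemma momentDv (v w : R3 -> R) g : v \in Lfun dS 2%:E -> w \in Lfun dS 2%:E -> continuous g ->
  moment (fun u => v u + w u) g = moment v g + moment w g.
Proof.
move=> Lv Lw cg; rewrite /moment -RintegralD//; [|exact: moment_integrable..].
by apply: eq_Rintegral => u _; rewrite mulrDl.
Qed.

Lemma momentZv (c : R) (v : R3 -> R) g : v \in Lfun dS 2%:E -> continuous g ->
  moment (fun u => c * v u) g = c * moment v g.
Proof.
move=> Lv cg; rewrite /moment -RintegralZl//; last exact: moment_integrable.
by apply: eq_Rintegral => u _; rewrite mulrA.
Qed.

Lemma V1_W f : V f -> W f. Proof. by case. Qed.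

Definition cplx g h : E := fun u => Complex (g u) (h u).

Lemma cplx_W g h : continuous g -> continuous h -> W (cplx g h).
Proof. by move=> cg ch; apply: L2_intro; exact: continuous_Lfun2. Qed.

Lemma dot_cplx f g h : W f -> continuous g -> continuous h ->
  dot f (cplx g h) = moment (re f) g + moment (im f) h.
Proof. by move=> Wf cg ch; rewrite dotL2E//; exact: cplx_W. Qed.

Lemma V1_subspace : subspace V.
Proof.
have sW : subspace W by exact: L2_subspace.
have m0 (v : R3 -> R) g : (forall u, v u = 0) -> moment v g = 0.
  move=> v0; rewrite -(moment_cst0 v); apply: eq_Rintegral => u _.
  by rewrite v0 !mul0r.
split.
- by apply/V1P; split; [exact: (subspace0 sW) | move=> phi _; rewrite !m0// oppr0].
- move=> f g /V1P[Wf rf] /V1P[Wg rg]; apply/V1P; split; first exact: (subspaceD sW).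
  move=> phi sphi; have [f1 f2] := rf _ sphi; have [g1 g2] := rg _ sphi.
  have c1 := smooth_continuous sphi; have c2 := smooth_continuous (smooth_rotZ sphi).
  have [Lrf Lif] := Wf; have [Lrg Lig] := Wg.
  rewrite reD imD !momentDv//; split; first by rewrite f1 g1.
  by rewrite f2 g2 opprD.
- move=> a f /V1P[Wf rf]; apply/V1P; split; first exact: (subspaceZ sW).
  move=> phi sphi; have [f1 f2] := rf _ sphi.
  have c1 := smooth_continuous sphi; have c2 := smooth_continuous (smooth_rotZ sphi).
  have [Lrf Lif] := Wf.
  have [Lr Li] : W f by [].
  have e g : continuous g ->
      moment (re (a *: f)) g = complex.Re a * moment (re f) g - complex.Im a * moment (im f) g /\
      moment (im (a *: f)) g = complex.Re a * moment (im f) g + complex.Im a * moment (re f) g.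
    move=> cg; split.
      rewrite reZ -mulNr -(momentZv _ Lr cg) -(momentZv _ Li cg) -momentDv//;
        try exact: Lfun2Z.
      by congr moment; apply/funext => u; rewrite mulNr.
    by rewrite imZ -(momentZv _ Lr cg) -(momentZv _ Li cg) -momentDv//; exact: Lfun2Z.
  have [-> ->] := e _ c1; have [-> ->] := e _ c2; rewrite f1 f2.
  by split; ring.
Qed.

(** The mode is the annihilator of explicit continuous functions. *)
Lemma V1_complete : cauchy_complete V dot.
Proof.
pose S := [set t : E | exists2 phi, smooth phi &
  t = cplx (rotZ phi) (fun u => - phi u) \/ t = cplx phi (rotZ phi)].
have cN g : continuous g -> continuous (fun u => - g u).
  by move=> cg u; apply: cvgN; exact: cg.
have SW : S `<=` W.
  move=> t [phi sphi [->|->]]; apply: cplx_W; try apply: cN;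
    by apply: smooth_continuous => //; exact: smooth_rotZ.
have mN (v : R3 -> R) g : v \in Lfun dS 2%:E -> continuous g ->
    moment v (fun u => - g u) = - moment v g.
  move=> Lv cg; rewrite -mulN1r -momentZ//; congr moment.
  by apply/funext => u; rewrite mulN1r.
suff -> : V = [set f : E | W f /\ forall t, S t -> dot f t = 0].
  by apply: annihilator_complete => //; exact: surface_lty.
apply/seteqP; split => f.
- move=> /V1P[Wf rf]; split => // t [phi sphi]; have [f1 f2] := rf _ sphi.
  have c1 := smooth_continuous sphi; have c2 := smooth_continuous (smooth_rotZ sphi).
  have [Lr Li] := Wf.
  move=> [->|->]; rewrite dot_cplx//; last by rewrite f2 subrr.
    by rewrite mN// f1 subrr.
  exact: cN.
- move=> [Wf ann]; apply/V1P; split => // phi sphi.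
  have c1 := smooth_continuous sphi; have c2 := smooth_continuous (smooth_rotZ sphi).
  have [Lr Li] := Wf.
  have : dot f (cplx (rotZ phi) (fun u => - phi u)) = 0.
    by apply: ann; exists phi => //; left.
  have : dot f (cplx phi (rotZ phi)) = 0 by apply: ann; exists phi => //; right.
  rewrite !dot_cplx//; last exact: cN.
  rewrite mN// => e1 e2; split; first by apply/eqP; rewrite -subr_eq0 e2.
  by apply/eqP; rewrite -subr_eq0 opprK addrC e1.
Qed.

Definition height f : E := fun u => (x3 u)%:C%C * f u.

Lemma re_height f : re (height f) = fun u => x3 u * re f u.
Proof. by apply/funext => u; rewrite /re /height; case: (f u) => a b /=; ring. Qed.
Lemma im_height f : im (height f) = fun u => x3 u * im f u.
Proof. by apply/funext => u; rewrite /im /height; case: (f u) => a b /=; ring. Qed.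

(* a bounded function that agrees with the height on the sphere *)
Let hcut (u : R3) : R := x3 u * \1_[set p : R3 | on_sphere p] u.

Let hcut_on (u : R3) : on_sphere u -> hcut u = x3 u.
Proof. by move=> su; rewrite /hcut indicE mem_set// mulr1. Qed.

Let hcut_le1 (u : R3) : `|hcut u| <= 1.
Proof.
rewrite /hcut indicE; have [|_] := boolP (_ \in _); last by rewrite mulr0 normr0.
rewrite inE /= mulr1 => su; rewrite ler_norml; move: su; rewrite /on_sphere.
by move=> su; apply/andP; split; nra.
Qed.

Let mhcut : measurable_fun setT hcut.
Proof.
apply: measurable_funM; first exact: measurable_snd.
exact: (measurable_indic (measurable_on_sphere)).
Qed.

Lemma Lfun2_height (v : R3 -> R) : v \in Lfun dS 2%:E -> (fun u => x3 u * v u) \in Lfun dS 2%:E.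
Proof.
move=> Lv; have mv := Lfun2_measurable Lv.
have /Lfun2P[_ fin] := Lfun2_bounded_mul mhcut hcut_le1 Lv.
apply/Lfun2P; split; first by apply: measurable_funM => //; exact: measurable_snd.
rewrite (@eq_integral_null _ _ _ _ _ measurable_on_sphere off_sphere_null _
  (fun u => ((hcut u * v u) ^+ 2)%:E))//.
by move=> u su; rewrite hcut_on.
Qed.

Lemma height_W f : W f -> W (height f).
Proof. by move=> [Lr Li]; apply: L2_intro; rewrite ?re_height ?im_height; exact: Lfun2_height. Qed.

(** The rotation about the axis commutes with functions of the height. *)
Lemma height_V1 f : V f -> V (height f).
Proof.
move=> /V1P[Wf rf]; apply/V1P; split; first exact: height_W.
move=> phi sphi; have s3 : smooth (fun u => x3 u * phi u).
  by move=> k; apply: CkM => //; exact: Ck_x3.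
have shift (v : R3 -> R) g : moment (fun u => x3 u * v u) g = moment v (fun u => x3 u * g u).
  by apply: eq_Rintegral => u _; ring.
have e : rotZ (fun u => x3 u * phi u) = fun u => x3 u * rotZ phi u.
  apply/funext => u; rewrite (rotZ_leibniz (@Ck_x3 R 1) (sphi 1%N)).
  have z : rotZ (@x3 R) u = 0.
    have := rotZ_zmono 0 0 'X u; rewrite !mul0r subrr => <-.
    by congr (rotZ _ u); apply/funext => w; rewrite /zmono !expr0 hornerX !mul1r.
  by rewrite z mul0r add0r.
rewrite re_height im_height !shift -e.
exact: rf.
Qed.

Lemma heightD f f' : height (f + f') = height f + height f'.
Proof. by apply/funext => u; rewrite /height -[(f + f') u]/(f u + f' u) mulrDr. Qed.

Lemma heightZ (c : R[i]) f : height (c *: f) = c *: height f.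
Proof. by apply/funext => u; rewrite /height -[(c *: f) u]/(c * f u) mulrCA. Qed.

Lemma height_sym f f' : dot (height f) f' = dot f (height f').
Proof.
by apply: eq_Rintegral => u _; rewrite !re_height !im_height; ring.
Qed.

Lemma height_le f : W f -> dot (height f) (height f) <= dot f f.
Proof.
move=> Wf; have i1 := dotL2_integrable Wf Wf.
have h2 u : 0 <= hcut u ^+ 2 <= 1.
  by rewrite sqr_ge0 -(real_normK (num_real (hcut u))) expr_le1// hcut_le1.
have i2 := integrable_bounded_mul (C := 1) i1 (measurable_funX 2 mhcut)
  (fun u => or_intror (_ : `|hcut u ^+ 2| <= 1)).
apply: le_trans (_ : \int[dS]_u ((re f u * re f u + im f u * im f u) * hcut u ^+ 2) <= _).
  rewrite le_eqVlt; apply/orP; left; apply/eqP.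
  apply: surface_Rintegral_ext => u su; rewrite re_height im_height hcut_on//; ring.
apply: le_Rintegral => //.
  by apply: i2 => u; have /andP[? ?] := h2 u; rewrite ger0_norm.
move=> u _; have /andP[h0 h1] := h2 u; rewrite ler_piMr//.
by move: (re f u) (im f u) => x y; nra.
Qed.

(** In the mode, the real and imaginary parts are turned into each other by the
    rotation, so that orthogonality to the complex function (x1 + i x2) p(x3) kills
    the four real moments of x1 p(x3) and x2 p(x3); the eigenpolynomials span. *)
Lemma V1_total f : V f ->
  (forall n, dot f (cplx (zmono 1 0 (eigenpoly n)) (zmono 0 1 (eigenpoly n))) = 0) ->
  (forall n, dot f (imu *: cplx (zmono 1 0 (eigenpoly n)) (zmono 0 1 (eigenpoly n))) = 0) ->
  dot f f = 0.
Proof.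
move=> /V1P[Wf rf] o1 o2; have [Lr Li] := Wf.
have cz a b p : continuous (zmono a b p) by exact: smooth_continuous (smooth_zmono a b p).
have r10 p : rotZ (zmono 1 0 p) = fun u => (-1) * zmono 0 1 p u.
  by apply/funext => u; rewrite rotZ_zmono /=; ring.
have r01 p : rotZ (zmono 0 1 p) = zmono 1 0 p.
  by apply/funext => u; rewrite rotZ_zmono /=; ring.
have J : forall n, moment (re f) (zmono 1 0 (eigenpoly n)) = 0 /\ moment (im f) (zmono 0 1 (eigenpoly n)) = 0 /\ moment (re f) (zmono 0 1 (eigenpoly n)) = 0 /\ moment (im f) (zmono 1 0 (eigenpoly n)) = 0.
  move=> n; set p := eigenpoly n.
  have [] := rf _ (smooth_zmono 0 1 p); rewrite r01 => a1 a2.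
  have := o1 n; rewrite dot_cplx// -/p => a3.
  have [] := rf _ (smooth_zmono 1 0 p); rewrite r10 !momentZ// => a4 a5.
  have e : imu *: cplx (zmono 1 0 p) (zmono 0 1 p) = cplx (fun u => (-1) * zmono 0 1 p u) (zmono 1 0 p).
    apply/funext => u; rewrite /cplx; apply/eqP; rewrite eq_complex /=; apply/andP; split; apply/eqP; ring.
  have cm : continuous (fun u => (-1) * zmono 0 1 p u) by move=> u; apply: cvgM; [exact: cvg_cst|exact: cz].
  have := o2 n; rewrite -/p e dot_cplx// momentZ// => a6.
  by do !split; lra.
have span (v : R3 -> R) a b : v \in Lfun dS 2%:E ->
    (forall n, moment v (zmono a b (eigenpoly n)) = 0) -> forall p, moment v (zmono a b p) = 0.
  move=> Lv h; apply: eigenpoly_span => //.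
  - exact: moment_zmono0.
  - by move=> p q hp hq; rewrite moment_zmonoD// hp hq addr0.
  - by move=> c p hp; rewrite moment_zmonoZ// hp mulr0.
have z1 : {ae dS, forall u, re f u = 0}.
  apply: circular_null => //; last 2 first.
  - by apply: span => // n; case: (J n).
  - by apply: span => // n; case: (J n) => _ [_ []].
  move=> phi sphi; have [-> _] := rf _ (smooth_rotZ sphi); by have [_ ->] := rf _ sphi.
have z2 : {ae dS, forall u, im f u = 0}.
  apply: circular_null => //; last 2 first.
  - by apply: span => // n; case: (J n) => _ [_ []].
  - by apply: span => // n; case: (J n) => _ [].
  move=> phi sphi; have [_ ->] := rf _ (smooth_rotZ sphi); by have [-> _] := rf _ sphi.
have m := measurable_int _ (dotL2_integrable Wf Wf).
rewrite /dotL2 /Rintegral (ae_eq_integral (cst 0%E))//; first by rewrite integral0.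
by apply: filterS2 z1 z2 => u /= -> -> _; rewrite !mul0r addr0.
Qed.

End V1_structure.

(** * Spherical harmonics of order one *)

Section eigenfunctions.
Context {R : realType}.
Notation R3 := (R * R * R)%type.
Local Notation lam := (@lebesgue_measure R).
Local Notation dS := (@surface_measure R).
Local Notation E := (R3 -> (R[i])^o).
Local Notation W := (@L2 _ _ R dS : set E).
Local Notation V := (@V1 R : set E).
Local Notation dot := (dotL2 dS).
Implicit Types (f : E) (g h phi : R3 -> R) (a b n : nat) (p q : {poly R}).

Lemma finite_roots q : q != 0 -> finite_set [set z | root q z].
Proof.
move=> q0; apply: contrapT => /infinite_set_fsetP/(_ (size q))[B BA sB].
have /(max_poly_roots q0) : all (root q) (finmap.enum_fset B) by apply/allP => z zB; exact: BA.
move=> /(_ (finmap.fset_uniq B)); by rewrite ltnNge sB.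
Qed.

Lemma latitudes_null (G : set R) : countable G -> dS [set u | G (x3 u)] = 0%E.
Proof.
move=> cG; rewrite surfaceE.
have mI : measurable (`[0, 2 * pi]%classic : set (measurableTypeR R)) by exact: measurable_itv.
have mJ : measurable (`[-1, 1]%classic : set (measurableTypeR R)) by exact: measurable_itv.
have mG : measurable (G : set (measurableTypeR R)) by apply: countable_measurable => // x; exact: measurable_set1.
rewrite (_ : _ `&` _ = `[0, 2 * pi]%classic `*` (G `&` `[-1, 1]%classic)).
  rewrite product_measure1E//; last exact: measurableI.
  rewrite [X in (_ * X)%E](_ : _ = 0%E) ?mule0//.
  apply: countable_lebesgue_measure0; apply: sub_countable cG.
  by apply: subset_card_le => z [].
by apply/seteqP; split => -[t z] /=; [move=> [? []]|move=> [? []]].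
Qed.

Lemma surface_gt0 : (0 < dS setT)%E.
Proof.
rewrite surfaceE setTI.
rewrite product_measure1E; [|exact: measurable_itv|exact: measurable_itv].
have h := @pi_gt0 R.
have e1 : lam `[0, 2 * pi]%classic = (2 * pi)%:E.
  by rewrite lebesgue_measure_itv /= lte_fin mulr_gt0// -EFinD subr0.
have e2 : lam `[-1, 1]%classic = 2%:E.
  by rewrite lebesgue_measure_itv /= lte_fin (_ : -1 < 1); [congr EFin; ring | lra].
apply: mule_gt0.
  by apply: (eq_ind _ (fun y => 0 < y)%E _ _ (esym e1)); rewrite lte_fin; lra.
by apply: (eq_ind _ (fun y => 0 < y)%E _ _ (esym e2)); rewrite lte_fin.
Qed.

Definition harmonic n : E := cplx (zmono 1 0 (eigenpoly n)) (zmono 0 1 (eigenpoly n)).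

Let cz a b p : continuous (zmono a b p).
Proof. exact: smooth_continuous (smooth_zmono a b p). Qed.

Lemma harmonic_W n : W (harmonic n). Proof. by apply: cplx_W; exact: cz. Qed.

Lemma harmonic_V1 n : V (harmonic n).
Proof.
apply/V1P; split; first exact: harmonic_W.
have cvM g h : continuous g -> continuous h -> continuous (fun u => g u * h u).
  by move=> cg ch u; apply: cvgM; [exact: cg | exact: ch].
move=> phi sphi; rewrite (_ : re _ = zmono 1 0 (eigenpoly n)) // (_ : im _ = zmono 0 1 (eigenpoly n)) //.
have parts p a b : moment (zmono a b p) (rotZ phi) = - moment (rotZ (zmono a b p)) phi.
  have C1 := Ck_zmono 1 a b p.
  apply/eqP; rewrite -addr_eq0 addrC; apply/eqP.
  have sr := smooth_rotZ (smooth_zmono a b p).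
  rewrite /moment -surface_RintegralD; last 2 first.
  - by apply: cvM; exact: smooth_continuous.
  - by apply: cvM; [exact: cz | apply: smooth_continuous; exact: smooth_rotZ].
  rewrite -(integral_rotZ (CkM C1 (sphi 1%N))).
  by apply: eq_Rintegral => u _; rewrite (rotZ_leibniz C1 (sphi 1%N)).
set p := eigenpoly n; split; rewrite parts.
  have -> : rotZ (zmono 1 0 p) = fun u => (-1) * zmono 0 1 p u.
    by apply/funext => u; rewrite rotZ_zmono /=; ring.
  rewrite momentZv ?mulN1r ?opprK//; [exact: continuous_Lfun2 | exact: smooth_continuous].
by congr (- moment _ _); apply/funext => u; rewrite rotZ_zmono /=; ring.
Qed.

(** Otherwise (1 - x3^2) p(x3) would vanish almost everywhere, that is outside
    finitely many parallels, which are null. *)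
Lemma harmonic_gt0 n : 0 < dot (harmonic n) (harmonic n).
Proof.
rewrite lt_neqAle (si_ge0 (dotL2_inner dS) (harmonic_W n)) andbT eq_sym; apply/eqP.
move=> /(dotL2_null (harmonic_W n)) null.
pose p : {poly R} := eigenpoly n; pose q := (1 - 'X^2) * p.
have q0 : q != 0.
  have [mp sp _] := eigenpolyP (R := R) n.
  rewrite mulf_neq0//; last by rewrite -size_poly_eq0 sp.
  rewrite -oppr_eq0 opprB -size_poly_eq0 size_polyDl ?size_polyXn// size_polyN size_poly1.
  by [].
have [A [mA A0 subA]] := null; have [B [mB B0 subB]] := @ae_on_sphere R.
have L0 := latitudes_null (finite_set_countable (finite_roots q0)).
have mL : measurable [set u : R3 | [set z | root q z] (x3 u)].
  have mr : measurable ([set z | root q z] : set (measurableTypeR R)).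
    apply: countable_measurable => [x|]; first exact: measurable_set1.
    exact/finite_set_countable/finite_roots.
  have m : measurable_fun setT (@x3 R) by exact: measurable_snd.
  by have := m measurableT _ mr; rewrite setTI.
have := surface_gt0; rewrite ltNge => /negP; apply.
have cover : setT `<=` A `|` (B `|` [set u : R3 | [set z | root q z] (x3 u)]).
  move=> u _; have [hu|hu] := pselect (harmonic n u = 0); last by left; exact: subA.
  have [su|su] := pselect (on_sphere u); last by right; left; exact: subB.
  right; right => /=; rewrite /root /q !(hornerE, hornerXn) -/p.
  move: hu => /eqP; rewrite eq_complex /= /zmono => /andP[/eqP h1 /eqP h2].
  have -> : 1 - x3 u ^+ 2 = x1 u ^+ 2 + x2 u ^+ 2 by rewrite -su; ring.
  rewrite -/p !expr0 !expr1 in h1 h2.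
  rewrite (_ : _ * _ = x1 u * (x1 u * 1 * p.[x3 u]) + x2 u * (1 * x2 u * p.[x3 u])); last by ring.
  by rewrite h1 h2 !mulr0 addr0.
apply: le_trans (le_measure _ _ _ cover) _; rewrite ?inE//.
  by apply: measurableU => //; exact: measurableU.
set L := [set u : R3 | _] in cover mL L0 *.
have mBL : measurable (B `|` L) by exact: measurableU.
apply: le_trans (_ : dS A + dS (B `|` L) <= _)%E; first exact: measureU2.
rewrite A0 add0e; apply: le_trans (_ : dS B + dS L <= _)%E; first exact: measureU2.
by rewrite B0 L0 adde0.
Qed.

End eigenfunctions.

Section orthonormal_basis.
Context {R : realType}.
Notation R3 := (R * R * R)%type.
Local Notation dS := (@surface_measure R).
Local Notation E := (R3 -> (R[i])^o).
Local Notation W := (@L2 _ _ R dS : set E).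
Local Notation V := (@V1 R : set E).
Local Notation dot := (dotL2 dS).
Local Notation level := (@level R).
Local Notation harmonic := (@harmonic R).
Implicit Types (f : E) (a b m n j : nat).

Let sW : subspace W := L2_subspace dS.
Let sd : semi_inner W dot := dotL2_inner dS.

Lemma lapS_harmonic a b n : (a + b = 1)%N ->
  lapS (zmono a b (eigenpoly n)) = fun u => - level n * zmono a b (eigenpoly n) u :> R.
Proof.
move=> ab; apply/funext => u; have [_ _ e] := eigenpolyP (R := R) n.
rewrite lapS_zmono ab e /zmono hornerZ.
by case: a b ab => [|[|a]] [|[|b]] //= _; ring.
Qed.

(** Eigenfunctions of a symmetric operator for different eigenvalues. *)
Lemma harmonic_moment a b m n : (a + b = 1)%N -> m != n ->
  \int[dS]_u (zmono a b (eigenpoly m) u * zmono a b (eigenpoly n) u) = 0.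
Proof.
move=> ab mn; set p := zmono a b (eigenpoly m); set q := zmono a b (eigenpoly n).
have cz (r : {poly R}) : continuous (zmono a b r) by exact: smooth_continuous (smooth_zmono a b r).
have ip : dS.-integrable setT (EFin \o (fun u => p u * q u)).
  by apply: surface_integrable_cont => u; apply: cvgM; exact: cz.
have g : \int[dS]_u (p u * lapS q u) = \int[dS]_u (q u * lapS p u).
  by apply: green; exact: Ck_zmono.
have lq u : lapS q u = - level n * q u by exact: (congr1 (@^~ u) (lapS_harmonic n ab)).
have lp u : lapS p u = - level m * p u by exact: (congr1 (@^~ u) (lapS_harmonic m ab)).
have e1 : \int[dS]_u (p u * lapS q u) = - level n * \int[dS]_u (p u * q u).
  apply: etrans (RintegralZl (- level n) measurableT ip); apply: eq_Rintegral => u _.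
  by apply: etrans (congr1 (fun t => p u * t) (lq u)) _; rewrite mulrCA.
have e2 : \int[dS]_u (q u * lapS p u) = - level m * \int[dS]_u (p u * q u).
  apply: etrans (RintegralZl (- level m) measurableT ip); apply: eq_Rintegral => u _.
  by apply: etrans (congr1 (fun t => q u * t) (lp u)) _; rewrite mulrCA [q u * _]mulrC.
have : (level n - level m) * \int[dS]_u (p u * q u) = 0 by move: (etrans (esym e1) (etrans g e2)); clear; move: (\int[dS]_u _) (level n) (level m) => x y z; lra.
move=> /eqP; rewrite mulf_eq0 => /orP[|/eqP//].
have [lt|le] := ltnP m n; first by rewrite (negbTE (level_lt lt)).
have nm : (n < m)%N by rewrite ltn_neqAle eq_sym mn.
by rewrite -opprB oppr_eq0 (negbTE (level_lt nm)).
Qed.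

Lemma harmonic_ortho m n : m != n -> dot (harmonic m) (harmonic n) = 0.
Proof.
move=> mn; rewrite dotL2E; [|exact: harmonic_W..].
by rewrite !harmonic_moment// addr0.
Qed.

Lemma harmonic_orthoJ m n : dot (harmonic m) (imu *: harmonic n) = 0.
Proof.
rewrite /dotL2 (eq_Rintegral _ (g := cst 0)); first by rewrite Rintegral_cst// mul0r.
move=> u _; rewrite reZ imZ /re /im /= /zmono; ring.
Qed.

Let nrm n : R := Num.sqrt (dot (harmonic n) (harmonic n)).

Let nrm_gt0 n : 0 < nrm n. Proof. by rewrite sqrtr_gt0 harmonic_gt0. Qed.

Let nrm2 n : nrm n * nrm n = dot (harmonic n) (harmonic n).
Proof. by rewrite -expr2 sqr_sqrtr// ltW// harmonic_gt0. Qed.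

Let unit n : E := (nrm n)^-1%:C%C *: harmonic n.

Let unit_W n : W (unit n). Proof. exact: (subspaceZ sW) (harmonic_W n). Qed.

(** e_n is followed by i e_n, since orthogonality is for the real product. *)
Definition basis j : E := if odd j then imu *: unit j./2 else unit j./2.

Lemma basis_odd n : basis n.*2.+1 = imu *: basis n.*2.
Proof. by rewrite /basis /= odd_double /= uphalf_double doubleK. Qed.

Lemma basis_V1 j : V (basis j).
Proof.
have sV := @V1_subspace R; have v n : V (unit n) by exact: (subspaceZ sV) (harmonic_V1 n).
by rewrite /basis; case: odd => //; exact: (subspaceZ sV).
Qed.

Let imu2 f : imu *: (imu *: f) = - f.
Proof.
rewrite scalerA (_ : imu * imu = -1) ?scaleN1r//.
by apply/eqP; rewrite eq_complex /=; apply/andP; split; apply/eqP; ring.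
Qed.

Let imu_unit n : imu *: unit n = (nrm n)^-1%:C%C *: (imu *: harmonic n).
Proof. by rewrite /unit !scalerA mulrC. Qed.

Let dot_unit m n : dot (unit m) (unit n) = (m == n)%:R.
Proof.
have h k := harmonic_W (R := R) k.
rewrite (siZ sd _ (h m) (unit_W n)) (siZr sW sd _ (h n) (h m)).
have [->|mn] := eqVneq m n; last by rewrite harmonic_ortho// !mulr0.
by have n0 := nrm_gt0 n; rewrite -nrm2 mulKf ?mulVf ?lt0r_neq0.
Qed.

Let dot_unitJ m n : dot (unit m) (imu *: unit n) = 0.
Proof.
have h k := harmonic_W (R := R) k; have hJ k : W (imu *: harmonic k) by exact: (subspaceZ sW).
rewrite (siZ sd _ (h m) (subspaceZ sW _ (unit_W n))).
rewrite imu_unit (siZr sW sd _ (hJ n) (h m)).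
by rewrite harmonic_orthoJ !mulr0.
Qed.

Lemma basis_ortho i j : dot (basis i) (basis j) = (i == j)%:R.
Proof.
have J m : W (imu *: unit m) by exact: (subspaceZ sW).
have eE : (i == j) = (odd i == odd j) && (i./2 == j./2).
  apply/eqP/andP => [->|[/eqP o /eqP h]]; first by rewrite !eqxx.
  by rewrite -(odd_double_half i) -(odd_double_half j) o h.
rewrite eE /basis; case: (odd i); case: (odd j) => /=.
- rewrite dotL2J// imu2 -[- unit _]scaleN1r (_ : -1 = (-1)%:C%C); last first.
    by apply/eqP; rewrite eq_complex /= oppr0 !eqxx.
  by rewrite (siZr sW sd _ (unit_W _) (unit_W _)) mulN1r opprK dot_unit.
- by rewrite dotL2J// dot_unitJ oppr0.
- exact: dot_unitJ.
- exact: dot_unit.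
Qed.

Lemma basis_total f : V f -> (forall j, dot f (basis j) = 0) -> dot f f = 0.
Proof.
move=> Vf o; have Wf := V1_W Vf; have h k := harmonic_W (R := R) k.
have hJ k : W (imu *: harmonic k) by exact: (subspaceZ sW).
have cancel n x : (nrm n)^-1 * x = 0 -> x = 0.
  by move=> /eqP; rewrite mulf_eq0 invr_eq0 (gt_eqF (nrm_gt0 n)) => /eqP.
apply: V1_total => // n; apply: (cancel n).
  rewrite -(siZr sW sd _ (h n) Wf).
  by have := o n.*2; rewrite /basis odd_double doubleK.
rewrite -(siZr sW sd _ (hJ n) Wf).
have := o n.*2.+1; rewrite /basis /= odd_double /= uphalf_double.
by rewrite imu_unit.
Qed.

Definition inv_level j : R := (level j./2)^-1.

Lemma inv_level_odd n : inv_level n.*2.+1 = inv_level n.*2.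
Proof. by rewrite /inv_level /= uphalf_double doubleK. Qed.

Lemma inv_level_le j : (3 < j)%N -> 0 <= inv_level j <= 12^-1.
Proof.
move=> j3; rewrite /inv_level /level invr_ge0 ler0n /= lef_pV2 ?posrE ?ltr0n// ler_nat.
have : (2 <= j./2)%N by lia.
by move: j./2 => k; nia.
Qed.

Lemma height_basis0 : exists a : R, height (basis 0) = a%:C%C *: basis 2.
Proof.
exists ((nrm 0)^-1 * nrm 1); rewrite /basis /= /unit heightZ scalerA.
have n1 := nrm_gt0 1.
rewrite (_ : _ * _ = (nrm 0)^-1%:C%C); last first.
  by rewrite -rmorphM /= mulfK// lt0r_neq0.
congr (_ *: _); apply/funext => u; rewrite /height /harmonic /cplx /zmono /=.
have h1 : (1 : {poly R}).[x3 u] = 1 by rewrite hornerE.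
by apply/eqP; rewrite eq_complex /= h1 hornerX; apply/andP; split; apply/eqP; ring.
Qed.

End orthonormal_basis.

(** * The inverse Laplacian *)

Section inverse_laplacian.
Context {R : realType}.
Notation R3 := (R * R * R)%type.
Local Notation dS := (@surface_measure R).
Local Notation E := (R3 -> (R[i])^o).
Local Notation W := (@L2 _ _ R dS : set E).
Local Notation V := (@V1 R : set E).
Local Notation dot := (dotL2 dS).
Local Notation b := (@basis R).
Local Notation kap := (@inv_level R).
Implicit Types (f : E) (g h phi : R3 -> R) (j : nat).

Let sW : subspace W := L2_subspace dS.
Let sd : semi_inner W dot := dotL2_inner dS.

Let cont0 : continuous ((fun=> 0) : R3 -> R).
Proof. by move=> u; exact: cvg_cst. Qed.

Lemma dot_real f g : W f -> continuous g -> dot f (cplx g (fun=> 0)) = moment (re f) g.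
Proof. by move=> Wf cg; rewrite dot_cplx// moment_cst0 addr0. Qed.

Lemma dot_imag f g : W f -> continuous g -> dot f (cplx (fun=> 0) g) = moment (im f) g.
Proof. by move=> Wf cg; rewrite dot_cplx// moment_cst0 add0r. Qed.

Lemma moment_null (v : R3 -> R) g : v \in Lfun dS 2%:E -> continuous g ->
  {ae dS, forall u, v u = 0} -> moment v g = 0.
Proof.
move=> Lv cg v0; have m := measurable_int _ (moment_integrable Lv cg).
rewrite /moment /Rintegral (ae_eq_integral (cst 0%E))//; first by rewrite integral0.
by apply: filterS v0 => u /= -> _; rewrite mul0r.
Qed.

Definition solves (u f : E) := forall phi, smooth phi ->
  moment (re u) (lapS phi) = moment (re f) phi /\
  moment (im u) (lapS phi) = moment (im f) phi.

Lemma weak_sphere_laplacianP (u : E) f : Cintegral dS f = 0 ->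
  weak_sphere_laplacian u (fun p => f p - sphere_mean f) <-> solves u f.
Proof.
move=> f0.
have -> : (fun p => f p - sphere_mean f) = f.
  by apply/funext => p; rewrite /sphere_mean f0 mul0r subr0.
have e phi : smooth phi -> Cintegral dS (fun p => u p * (sphere_laplacian phi p)%:C%C) =
    Complex (moment (re u) (lapS phi)) (moment (im u) (lapS phi)).
  move=> sphi; rewrite CintegralM.
  by congr Complex; apply: moment_ext => p sp; exact: sphere_laplacianE (sphi 2%N) sp.
split=> H phi sphi; have := H phi sphi; rewrite e// CintegralM.
  by move=> -[-> ->].
by move=> [-> ->].
Qed.

Definition order_one j g := exists (c : R) (m n : nat),
  (m + n = 1)%N /\ g = fun u => c * zmono m n (eigenpoly j./2) u.

Lemma basis_components j : order_one j (re (b j)) /\ order_one j (im (b j)).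
Proof.
pose z10 : R3 -> R := zmono 1 0 (eigenpoly j./2); pose z01 : R3 -> R := zmono 0 1 (eigenpoly j./2).
pose c : R := (Num.sqrt (dot (harmonic j./2) (harmonic j./2)))^-1.
have h : harmonic j./2 = cplx z10 z01 by [].
rewrite /basis -/c h; case: (odd j).
  split; [exists (- c), 0%N, 1%N | exists c, 1%N, 0%N]; split => //; apply/funext => u;
    by rewrite ?reZ ?imZ ?reZ ?imZ /re /im /cplx /= -/z10 -/z01; ring.
split; [exists c, 1%N, 0%N | exists c, 0%N, 1%N]; split => //; apply/funext => u;
  by rewrite ?reZ ?imZ /re /im /cplx /= -/z10 -/z01; ring.
Qed.

Lemma order_one_smooth j g : order_one j g -> smooth g.
Proof. by move=> [c [m [n [_ ->]]]] k; apply: CkZ; exact: Ck_zmono. Qed.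

Lemma order_one_lapS j g : order_one j g -> lapS g = fun u => - (kap j)^-1 * g u.
Proof.
move=> [c [m [n [mn ->]]]]; pose p : {poly R} := eigenpoly j./2; rewrite -/p.
have -> : (fun u => c * zmono m n p u) = zmono m n (c *: p).
  by apply/funext => u; rewrite /zmono hornerZ; ring.
have [_ _ e] := eigenpolyP (R := R) j./2.
apply/funext => u; apply: etrans (lapS_zmono m n (c *: p) u) _.
rewrite mn zonal_lapZ e -/p /inv_level invrK /zmono !hornerZ.
by move: mn; case: m n => [|[|m]] [|[|n]] //= _; ring.
Qed.

Lemma order_one_moment j g phi : order_one j g -> smooth phi ->
  moment g (lapS phi) = - (kap j)^-1 * moment g phi.
Proof.
move=> og sphi; have sg := order_one_smooth og.
have L2g : g \in Lfun dS 2%:E by apply: continuous_Lfun2; exact: smooth_continuous.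
have cphi := smooth_continuous sphi.
apply: etrans (green (sg 2%N) (sphi 2%N)) _.
apply: etrans (RintegralZl _ measurableT (moment_integrable L2g cphi)).
apply: eq_Rintegral => u _; apply: etrans (congr1 (fun t => phi u * t u) (order_one_lapS og)) _.
cbv beta; ring.
Qed.

Lemma inv_level_neq0 j : kap j != 0.
Proof. by rewrite /inv_level invr_eq0 pnatr_eq0. Qed.

(** The series with coefficients - kap j <f, b j> converges in the mode.  Testing it
    against the Laplacian of phi moves the Laplacian to the basis functions by
    Green's formula and returns the Parseval series of f. *)
Lemma laplacian_solvable f : V f -> exists2 u : E, V u & solves u f.
Proof.
move=> Vf; have Wf := V1_W Vf.
have [sV cV] := (@V1_subspace R, @V1_complete R).
have Wb j : W (b j) by exact: V1_W (basis_V1 j).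
have bnd n : \sum_(j < n) (- (kap j * dot f (b j))) ^+ 2 <= dot f f.
  have B := bessel sW sd sV (@V1_W R) (@basis_V1 R) (@basis_ortho R) n Wf.
  apply: le_trans B.
  apply: ler_sum => j _; rewrite sqrrN exprMn ler_piMl ?sqr_ge0//.
  have : 0 <= kap j <= 1.
    by rewrite /inv_level invr_ge0 ler0n invf_le1 ?ltr0n// ler1n.
  by move=> /andP[? ?]; rewrite expr_le1.
have [u Vu hu] := @riesz_fischer _ _ _ _ _ _ sW sd sV (@V1_W R) cV (@basis_V1 R) (@basis_ortho R) (fun j => - (kap j * dot f (b j))) _ bnd.
have Wu := V1_W Vu.
exists u => // phi sphi; have cphi := smooth_continuous sphi; have clap := smooth_lapS sphi.
have step t t' : W t -> W t' -> (forall j, dot (b j) t = - (kap j)^-1 * dot (b j) t') ->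
    dot u t = dot f t'.
  move=> Wt Wt' tt'.
  have := parseval sW sd sV (@V1_W R) cV (@basis_V1 R) (@basis_ortho R) (@basis_total R) Vf Wt'.
  have := hu t Wt.
  rewrite (_ : (fun n => \sum_(j < n) - (kap j * dot f (b j)) * dot (b j) t) =
    (fun n => \sum_(j < n) dot f (b j) * dot (b j) t')); last first.
    apply/funext => n; apply: eq_bigr => j _; rewrite tt'.
    by field; exact: inv_level_neq0.
  exact: cvg_unique.
split.
  rewrite -!dot_real//; apply: step; [exact: cplx_W|exact: cplx_W|move=> j].
  rewrite !dot_real//; apply: order_one_moment => //; exact: (basis_components j).1.
rewrite -!dot_imag//; apply: step; [exact: cplx_W|exact: cplx_W|move=> j].
rewrite !dot_imag//; apply: order_one_moment => //; exact: (basis_components j).2.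
Qed.

Lemma V1_mean0 f : V f -> Cintegral dS f = 0. Proof. by case. Qed.

Lemma inv_laplacian_spec f : V f ->
  [/\ W (inv_laplacian f), Cintegral dS (inv_laplacian f) = 0 & solves (inv_laplacian f) f].
Proof.
move=> Vf; have f0 := V1_mean0 Vf; have [u Vu su] := laplacian_solvable Vf.
have : exists u : E, [/\ L2 dS u, Cintegral dS u = 0 &
    weak_sphere_laplacian u (fun p => f p - sphere_mean f)].
  by exists u; split; [exact: V1_W | exact: V1_mean0 | exact/weak_sphere_laplacianP].
move=> /(@xgetPex _ (cst 0))[h1 h2 h3]; split => //.
exact/weak_sphere_laplacianP.
Qed.

(** The difference of two solutions has mean zero and distributional Laplacian
    zero. *)
Lemma solves_unique (u u' : E) f : W u -> W u' -> Cintegral dS u = 0 -> Cintegral dS u' = 0 ->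
  solves u f -> solves u' f -> forall g, continuous g ->
  moment (re u) g = moment (re u') g /\ moment (im u) g = moment (im u') g.
Proof.
move=> [Lr Li] [Lr' Li']; rewrite !Cintegral1 => -[r0 i0] [r0' i0'] su su' g cg.
have c1 : continuous ((fun=> 1) : R3 -> R) by move=> p; exact: cvg_cst.
have main (v v' : R3 -> R) : v \in Lfun dS 2%:E -> v' \in Lfun dS 2%:E ->
    moment v (fun=> 1) = 0 -> moment v' (fun=> 1) = 0 ->
    (forall phi, smooth phi -> moment v (lapS phi) = moment v' (lapS phi)) ->
    moment v g = moment v' g.
  move=> Lv Lv' m0 m0' e.
  have LB := Lfun2B Lv Lv'.
  have mB h : continuous h -> moment (fun p => v p - v' p) h = moment v h - moment v' h.
    move=> ch; have := momentDv Lv (Lfun2Z (-1) Lv') ch; rewrite momentZv// mulN1r => <-.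
    by congr moment; apply/funext => p; rewrite mulN1r.
  have n0 : {ae dS, forall p, v p - v' p = 0}.
    apply: harmonic_null => //; first by rewrite mB// m0 m0' subrr.
    by move=> phi sphi; rewrite mB ?e ?subrr//; exact: smooth_lapS.
  by apply/eqP; rewrite -subr_eq0 -mB//; apply/eqP; exact: moment_null.
split; apply: main => // phi sphi; have [e1 e2] := su phi sphi; have [e1' e2'] := su' phi sphi.
  by rewrite e1 e1'.
by rewrite e2 e2'.
Qed.

Lemma inv_laplacian_V1 f : V f -> V (inv_laplacian f).
Proof.
move=> Vf; have [Wk k0 sk] := inv_laplacian_spec Vf; have [u Vu su] := laplacian_solvable Vf.
have e := solves_unique Wk (V1_W Vu) k0 (V1_mean0 Vu) sk su.
have [_ ru] := (V1P u).1 Vu.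
apply/V1P; split => // phi sphi.
have [e1 e2] := e _ (smooth_continuous sphi).
have [e3 e4] := e _ (smooth_continuous (smooth_rotZ sphi)).
by rewrite e1 e2 e3 e4; exact: ru.
Qed.

Lemma inv_laplacian_coef f j : V f -> dot (inv_laplacian f) (b j) = - (kap j * dot f (b j)).
Proof.
move=> Vf; have [Wk k0 sk] := inv_laplacian_spec Vf; have Wf := V1_W Vf.
have [co1 co2] := basis_components j.
have [c1 c2] := (smooth_continuous (order_one_smooth co1), smooth_continuous (order_one_smooth co2)).
have basisE : b j = cplx (re (b j)) (im (b j)).
  by apply/funext => p; rewrite /cplx /re /im; case: (b j p).
have key (v w : R3 -> R) g : order_one j g -> v \in Lfun dS 2%:E ->
    moment v (lapS g) = moment w g -> moment v g = - (kap j * moment w g).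
  move=> og Lv; rewrite (order_one_lapS og) momentZ//; last first.
    exact: smooth_continuous (order_one_smooth og).
  by move=> <-; field; exact: inv_level_neq0.
have [Lr Li] := Wk.
rewrite basisE !dot_cplx//.
rewrite (key _ _ _ co1 Lr (proj1 (sk _ (order_one_smooth co1)))).
rewrite (key _ _ _ co2 Li (proj2 (sk _ (order_one_smooth co2)))).
ring.
Qed.

End inverse_laplacian.

(** * The spectrum *)

Section resolvent.
Context {R : realType}.
Notation R3 := (R * R * R)%type.
Local Notation dS := (@surface_measure R).
Local Notation E := (R3 -> (R[i])^o).
Local Notation W := (@L2 _ _ R dS : set E).
Local Notation V := (@V1 R : set E).
Local Notation dot := (dotL2 dS).
Implicit Types (f g : E).

Lemma M1_zonal_op (Om : R) f :
  M1 Om f = zonal_op (@inv_laplacian R : E -> E) height Om f.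
Proof.
apply/funext => u.
rewrite /M1 /coefA /coefB -[RHS]/((x3 u)%:C%C * f u + Om%:C%C * inv_laplacian f u
  + 6%:C%C * ((x3 u)%:C%C * inv_laplacian f u)).
rewrite -addrA; congr (_ + _).
by rewrite rmorphD rmorphM /=; ring.
Qed.

Lemma resolvent_nonreal (Om : R) (lam : R[i]) : complex.Im lam != 0 ->
  resolvent_set dS V (M1 Om) lam.
Proof.
move=> im0; have sV := @V1_subspace R; have sW := L2_subspace dS.
have [a Zb0] := height_basis0 (R := R).
have kap0 : inv_level (R := R) 0 = 2^-1 by rewrite /inv_level /level /= mul1n.
have kap2 : inv_level (R := R) 2 = 6^-1 by [].
have [surj [C C0 low]] := zonal_resolvent sW (dotL2_inner dS) sV (@V1_W R)
  (@V1_complete R) (@basis_V1 R) (@basis_ortho R) (@basis_total R) (@dotL2J _ _ _ dS)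
  (@basis_odd R) (@inv_level_odd R) kap0 kap2 (@inv_level_le R)
  (@inv_laplacian_V1 R) (@inv_laplacian_coef R) (@height_V1 R) (@heightD R) (@heightZ R)
  (fun f g _ _ => height_sym f g) (fun f Vf => height_le (V1_W Vf)) Zb0 Om im0.
have M1V f : V f -> V (M1 Om f).
  move=> Vf; rewrite M1_zonal_op; have VK := inv_laplacian_V1 Vf.
  apply: (subspaceD sV); first apply: (subspaceD sV).
  - exact: height_V1.
  - exact: (subspaceZ sV).
  - by apply: (subspaceZ sV); exact: height_V1.
have MlV f : V f -> V (M1 Om f - lam *: f).
  by move=> Vf; apply: (subspaceB sV); [exact: M1V | exact: (subspaceZ sV)].
split => //.
- move=> g Vg; have [f Vf fg0] := surj g Vg; exists f; split => //.
  have Wd : W (M1 Om f - lam *: f - g).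
    by apply: V1_W; apply: (subspaceB sV) => //; exact: MlV.
  have := dotL2_null Wd; rewrite M1_zonal_op => /(_ fg0).
  apply: filterS => u /eqP h; apply/eqP; move: h.
  by rewrite -[X in X == 0]/(_ - g u) subr_eq0.
- exists (Num.sqrt C) => f Vf.
  have -> : (fun x => M1 Om f x - lam * f x) = M1 Om f - lam *: f by [].
  rewrite (normL2E (V1_W Vf)) (normL2E (V1_W (MlV _ Vf))) -EFinM lee_fin -sqrtrM//.
  rewrite ler_sqrt; last first.
    by rewrite mulr_ge0//; exact: (si_ge0 (dotL2_inner dS) (V1_W (MlV _ Vf))).
  by rewrite M1_zonal_op; exact: low.
Qed.

End resolvent.

Theorem proposition5p1p2 (R : realType) (Omega : R) :
  0 < Omega ->
  spectrum (@surface_measure R) (@V1 R) (M1 Omega) `<=`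
    [set lam : R[i] | complex.Im lam = 0].
Proof.
move=> _ lam; apply: contra_notP => /eqP.
exact: resolvent_nonreal.
Qed.
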